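(* Let $d=2$, $1\le p,\theta\le\infty$, $s>1/p$, and let $C>0$. Then there are constants $0<c_1\le c_2<\infty$, depending only on $C,p,\theta,s$ (and the fixed functions defining the norm), such that for all $N\in\mathbb N$ and all $\boldsymbol g=(1,g)$ with $g\in\{1,2,\dots,N-1\}$, $\gcd(g,N)=1$ and $K(g/N)\le C$, $$c_1\,\frac{(\log N)^{1-1/\theta}}{N^s}\;\le\;\mathrm{wce}\bigl(\mathcal P_N(\boldsymbol g),\mathring{\mathbf B}^s_{p,\theta}\bigr)\;\le\; c_2\,\frac{(\log N)^{1-1/\theta}}{N^s},$$ where $\mathcal P_N(\boldsymbol g)=\{(n/N,\{ng/N\}):n=0,1,\dots,N-1\}$.
   Context: Conventions: $\log$ is the logarithm to base $2$; $1/\infty:=0$; $\{x\}$ is the fractional part of $x$. $K(g/N)$: if $a_1,\dots,a_l$ are the partial quotients in the continued fraction expansion $g/N=[0;a_1,\dots,a_l]$, then $K(g/N)=\max_{1\le j\le l}a_j$. Function space (here $d=2$): for $f\in L_1(\mathbb R^d)$ let $\mathcal F f(\boldsymbol\xi)=\int_{\mathbb R^d}f(\boldsymbol y)e^{-2\pi \mathrm i\langle\boldsymbol\xi,\boldsymbol y\rangle}\,d\boldsymbol y$, extended to tempered distributions as usual. Let $\Psi_0\in C_0^\infty(\mathbb R)$ be the up-function, i.e. the function with support $[-1,1]$ and $\mathcal F\Psi_0(\xi)=\prod_{k=0}^\infty \mathrm{sinc}(2^{-k}\xi)$, $\mathrm{sinc}(\xi)=\sin(\pi\xi)/(\pi\xi)$.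 Fix a non-negative integer $L$ with $L+1>s$, and put $\Psi_1(x)=\frac{d^L}{dx^L}\bigl(2\Psi_0(2\,\cdot)-\Psi_0\bigr)(x)$, $\Psi_j(x)=2^{j-1}\Psi_1(2^{j-1}x)$ for $j\ge1$, and $\Psi_{\boldsymbol m}(\boldsymbol x)=\prod_{i=1}^d\Psi_{m_i}(x_i)$ for $\boldsymbol m\in\mathbb N_0^d$. The Besov space of dominating mixed smoothness $\mathbf B^s_{p,\theta}(\mathbb R^d)$ is the set of tempered distributions $f$ on $\mathbb R^d$ with $$\|f\|_{\mathbf B^s_{p,\theta}}=\Bigl(\sum_{\boldsymbol m\in\mathbb N_0^d}2^{s|\boldsymbol m|_1\theta}\|\Psi_{\boldsymbol m}*f\|_{L_p(\mathbb R^d)}^\theta\Bigr)^{1/\theta}<\infty$$ (supremum over $\boldsymbol m$ if $\theta=\infty$), where $|\boldsymbol m|_1=m_1+\dots+m_d$. Put $\mathring{\mathbf B}^s_{p,\theta}=\{f\in\mathbf B^s_{p,\theta}(\mathbb R^d):\mathrm{supp}(f)\subset[0,1]^d\}$ with the same norm. Since $s>1/p$, these functions are continuous. Worst-case error of a point set $\mathcal P=\{\boldsymbol x_0,\dots,\boldsymbol x_{N-1}\}\subset[0,1)^d$: $\mathrm{wce}(\mathcal P,\mathring{\mathbf B}^s_{p,\theta})=\sup\bigl\{\bigl|\int_{[0,1]^d}f(\boldsymbol x)\,d\boldsymbol x-\frac1N\sum_{n=0}^{N-1}f(\boldsymbol x_n)\bigr|: f\in\mathring{\mathbf B}^s_{p,\theta},\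 \|f\|_{\mathbf B^s_{p,\theta}}\le1\bigr\}$. *)

(* Defs.v *)
From HB Require Import structures.
From mathcomp Require Import all_boot all_order all_algebra.
From mathcomp Require Import all_classical all_reals all_analysis.
From mathcomp Require Import complex.
Set Implicit Arguments.
Unset Strict Implicit.
Unset Printing Implicit Defensive.
Import Order.TTheory GRing.Theory Num.Theory.
Import numFieldNormedType.Exports.
Local Open Scope classical_set_scope.
Local Open Scope ring_scope.

Section ContinuedFractions.

(* Quotients produced by the Euclidean algorithm on (n, m), at most [fuel] of
   them. For 0 < m < n and fuel >= m these are the partial quotients
   a_1, ..., a_l of m / n = [0; a_1, ..., a_l], normalised by a_l >= 2. *)
Fixpoint euclid_quotients (fuel m n : nat) : seq nat :=
  if fuel is k.+1 then
    if m == 0%N then [::] else (n %/ m)%N :: euclid_quotients k (n %% m) m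
  else [::].

Definition partial_quotients (g N : nat) : seq nat := euclid_quotients g g N.

Definition cf_value (a : seq nat) : rat :=
  foldr (fun (q : nat) (v : rat) => (q%:R + v)^-1) 0 a.

Definition max_quotient (g N : nat) : nat := \max_(a <- partial_quotients g N) a.

Lemma euclid_quotients_value (fuel m n : nat) : (m <= fuel)%N -> (0 < n)%N ->
  cf_value (euclid_quotients fuel m n) = m%:R / n%:R.
Proof.
elim: fuel m n => [|k IH] m n /=.
  by rewrite leqn0 => /eqP -> _; rewrite mul0r.
move=> mk n0; case: eqVneq => [->|m0]; first by rewrite mul0r.
have mgt0 : (0 < m)%N by rewrite lt0n.
rewrite /cf_value /= -/(cf_value _) IH //; last first.
  by rewrite -ltnS; apply: leq_trans mk; rewrite ltn_mod.
have mR : (m%:R : rat) != 0 by rewrite pnatr_eq0.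
rewrite -(invf_div n%:R); congr (_^-1).
by rewrite [in RHS](divn_eq n m) natrD natrM mulrDl mulfK.
Qed.

Lemma partial_quotients_value (g N : nat) : (0 < N)%N ->
  cf_value (partial_quotients g N) = g%:R / N%:R.
Proof. exact: euclid_quotients_value. Qed.

Lemma euclid_quotients_gt0 (fuel m n : nat) : (m <= n)%N ->
  all (leq 1) (euclid_quotients fuel m n).
Proof.
elim: fuel m n => [//|k IH] m n mn /=; case: eqVneq => // m0.
rewrite /= divn_gt0 ?lt0n// mn /=; apply: IH.
by rewrite ltnW// ltn_mod lt0n.
Qed.

Lemma euclid_quotients_last (fuel m n d : nat) : (m <= fuel)%N ->
  (0 < m < n)%N -> (1 < last d (euclid_quotients fuel m n))%N.
Proof.
elim: fuel m n d => [|k IH] m n d mk /andP[m0 mn].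
  by move: mk; rewrite leqNgt m0.
rewrite /= gtn_eqF//=.
have [r0|r0] := posnP (n %% m)%N.
  have -> : euclid_quotients k (n %% m) m = [::] by rewrite r0; case: (k).
  rewrite /= ltnNge; apply/negP => qle1.
  have nE := divn_eq n m; rewrite r0 addn0 in nE.
  by move: mn; rewrite nE ltnNge -[leqRHS]mul1n leq_mul2r qle1 orbT.
apply: IH; last by rewrite r0 ltn_mod.
by rewrite -ltnS; apply: leq_trans mk; rewrite ltn_mod.
Qed.

Lemma partial_quotients_last (g N : nat) : (0 < g < N)%N ->
  (1 < last 0 (partial_quotients g N))%N.
Proof. exact: euclid_quotients_last. Qed.

End ContinuedFractions.

Section TemperedDistributions.
Context {R : realType}.
Local Notation C := R[i].
Local Notation plane := (R * R)%type.
Implicit Types (x y v : plane) (f phi : plane -> C) (T : (plane -> C) -> C).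

Definition cre f : plane -> R := fun x => complex.Re (f x).
Definition cim f : plane -> R := fun x => complex.Im (f x).
Definition cabs (z : C) : R := Normc.normc z.

Definition axis (i : bool) : plane := if i then (0, 1) else (1, 0).

Definition partial (i : bool) f : plane -> C :=
  fun x => ('D_(axis i) (cre f) x +i* 'D_(axis i) (cim f) x)%C.

Definition ccontinuous f := continuous (cre f) /\ continuous (cim f).

(* All iterated partial derivatives, in every order, exist and are
   continuous. *)
Definition smooth f := forall w : seq bool, let h := foldr partial f w in
  ccontinuous h /\
  forall (i : bool) x,
    derivable (cre h) x (axis i) /\ derivable (cim h) x (axis i).

Definition pderiv (b : nat * nat) f : plane -> C :=
  iter b.1 (partial false) (iter b.2 (partial true) f).

Definition schwartz_norm (k : nat) f : \bar R := ereal_sup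
  [set r | exists (a b : nat * nat) (x : plane),
    [/\ (a.1 + a.2 <= k)%N, (b.1 + b.2 <= k)%N &
        r = (`|x.1| ^+ a.1 * `|x.2| ^+ a.2 * cabs (pderiv b f x))%:E]].

Definition schwartz f := smooth f /\ forall k, (schwartz_norm k f < +oo)%E.

(* The values of T outside the Schwartz space are irrelevant. *)
Definition tempered_distribution T :=
  (forall (c : C) phi psi, schwartz phi -> schwartz psi ->
     T (fun x => c * phi x + psi x) = c * T phi + T psi) /\
  exists (k : nat) (M : R), forall phi, schwartz phi ->
     ((cabs (T phi))%:E <= M%:E * schwartz_norm k phi)%E.

Definition fsupport f : set plane := closure [set x | f x != 0].

Definition test_function (U : set plane) f :=
  [/\ smooth f, compact (fsupport f) & fsupport f `<=` U].

(* The complement of the largest open set on which T vanishes. *)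
Definition dsupport T : set plane :=
  [set x | forall U : set plane, open U -> U x ->
     exists2 phi, test_function U phi & T phi != 0].

Definition dconv (psi : plane -> R) T : plane -> C :=
  fun x => T (fun y => (psi (x - y))%:C%C).

Definition leb2 :
    {measure set (measurableTypeR R * measurableTypeR R) -> \bar R} :=
  (@lebesgue_measure R \x @lebesgue_measure R)%E.

Definition cintegral (D : set plane) f : C :=
  (Rintegral leb2 D (cre f) +i* Rintegral leb2 D (cim f))%C.

Definition unit_square : set plane := `[0, 1]%classic `*` `[0, 1]%classic.

Definition represents f T := forall phi, schwartz phi ->
  T phi = cintegral setT (fun x => f x * phi x).

Definition LpC (p : \bar R) f : \bar R :=
  Lnorm leb2 p (fun x => (cabs (f x))%:E).

End TemperedDistributions.

Section UpFunction.
Context {R : realType}.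

Definition sinc (x : R) : R := if x == 0 then 1 else sin (pi * x) / (pi * x).

Definition fourier (f : R -> R) (xi : R) : R[i] :=
  (Rintegral lebesgue_measure setT (fun y => f y * cos (2 * pi * (xi * y)))
   -i* Rintegral lebesgue_measure setT
         (fun y => f y * sin (2 * pi * (xi * y))))%C.

(* These conditions determine Psi0 uniquely; the limit is the infinite product
   over k of sinc (2^-k xi). *)
Definition up_function (Psi0 : R -> R) :=
  [/\ forall (n : nat) (x : R), derivable (derive1n n Psi0) x 1,
      closure [set x | Psi0 x != 0] = `[-1, 1]%classic &
      forall xi : R,
        (fun n => \prod_(k < n) sinc (2 ^- k * xi)) @ \oo
          --> complex.Re (fourier Psi0 xi)
        /\ complex.Im (fourier Psi0 xi) = 0].

Definition Psi1 (L : nat) (Psi0 : R -> R) : R -> R :=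
  derive1n L (fun x => 2 * Psi0 (2 * x) - Psi0 x).

Definition Psi (L : nat) (Psi0 : R -> R) (j : nat) (x : R) : R :=
  if j is k.+1 then 2 ^+ k * Psi1 L Psi0 (2 ^+ k * x) else Psi0 x.

Definition Psi2 (L : nat) (Psi0 : R -> R) (m : nat * nat) (x : R * R) : R :=
  Psi L Psi0 m.1 x.1 * Psi L Psi0 m.2 x.2.

End UpFunction.

Section Cubature.
Context {R : realType}.
Local Notation C := R[i].
Local Notation plane := (R * R)%type.
Variables (L : nat) (Psi0 : R -> R) (s : R) (p theta : \bar R).

Definition besov_norm (T : (plane -> C) -> C) : \bar R :=
  let block (m : nat * nat) := LpC p (dconv (Psi2 L Psi0 m) T) in
  if theta is t%:E then
    ((\esum_(m in [set: nat * nat])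
       ((2 `^ (s * (m.1 + m.2)%:R * t))%:E * block m `^ t)) `^ t^-1)%E
  else
    ereal_sup (range (fun m : nat * nat =>
      ((2 `^ (s * (m.1 + m.2)%:R))%:E * block m)%E)).

Definition besov (T : (plane -> C) -> C) :=
  tempered_distribution T /\ (besov_norm T < +oo)%E.

(* T lies in the Besov space with support in the unit square; f is the unique
   continuous function representing T, which exists because s > 1/p. *)
Definition besov_unit_square (T : (plane -> C) -> C) (f : plane -> C) :=
  [/\ besov T, dsupport T `<=` unit_square, ccontinuous f & represents f T].

Definition wce (N : nat) (X : 'I_N -> plane) : \bar R := ereal_sup
  [set r | exists T f, [/\ besov_unit_square T f, (besov_norm T <= 1)%E &
     r = (cabs (cintegral unit_square f
                - N%:R^-1 * \sum_(n < N) f (X n)))%:E]].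

Definition frac (x : R) : R := x - (Num.floor x)%:~R.

Definition lattice_points (N g : nat) (n : 'I_N) : plane :=
  (n%:R / N%:R, frac ((n * g)%:R / N%:R)).

Definition log2 (x : R) : R := ln x / ln 2.

End Cubature.

(* Main.v *)
Require Import Defs.
From HB Require Import structures.
From mathcomp Require Import all_boot all_order all_algebra.
From mathcomp Require Import all_classical all_reals all_analysis.
From mathcomp Require Import measurable_realfun ess_sup_inf complex ring lra zify.
Import Order.TTheory GRing.Theory Num.Theory.
Import numFieldNormedType.Exports.
Local Open Scope classical_set_scope.
Local Open Scope ring_scope.
Set Implicit Arguments.
Unset Strict Implicit.
Unset Printing Implicit Defensive.

(* Upper bound. Let e be the cubature error. A Calderon-type formula
   sum_(j <= J) Lam_j * Psi_j = dil J q with compactly supported Lam_j writes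
   e(f) as a sum over m of the integrals of (Psi_m * f)(y) E_m(y), where
   E_m(y) = e(Lam_m(. - y)). Stopping the Euclidean algorithm on (N, g) at
   scale t gives a basis of the lattice Z(1, g)/N + Z^2 with vectors of size at
   most t/N by (K+1)/t. Averaging over the parallelogram of a basis makes the
   lattice sum exact, so e(F) is controlled by differences of F along short
   vectors; iterating this on derivatives yields |E_m| <= C (2^|m|/N)^n when
   2^|m| <= N, and otherwise |E_m| <= C 2^|m|/N while the L1 norm of E_m stays
   bounded. By Hoelder the contribution of level |m| = l decays geometrically
   in |l - log2 N|, and Hoelder in theta over its l+1 blocks costs
   (l+1)^(1-1/theta).

   Lower bound. If 2N <= 2^l < 4N, then for each a <= l at least half of the
   2^l dyadic boxes of size 2^-a by 2^-(l-a) contain no lattice point. The sum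
   over a of tensor bumps on these boxes vanishes at all lattice points and has
   integral at least c(l+1). Moving L+1 derivatives from Psi_m to the bumps
   bounds its blocks by sums over a of
   2^-((L+1)((m_1-a)^+ + (m_2-(l-a))^+)), so its Besov norm is at most
   C 2^(sl) (l+1)^(1/theta). *)

(** * Integrals of bounded functions of bounded support *)

(** The kernels [Lam_j] need compact support, because the error of a translate is estimated by
    counting lattice points near its support. Dividing by the Fourier transform of [Psi_j] is
    therefore replaced by polynomial identities in the convolution algebra, and the L derivatives
    inside [Psi_j] are absorbed one at a time by antiderivatives of mean-zero functions.

    Bounded partial quotients enter in one place: consecutive remainders of the Euclidean algorithm
    have ratio at most K+1, so for every t in [1, N] some basis fits the box t/N by (K+1)/t. For t =
    N 2^(-m_1) sqrt(2^|m|/N) it is, in both directions, about sqrt(2^|m|/N) times the size of the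
    support of the kernel. Taking 2n differences then gains (2^|m|/N)^n, and n > s makes the coarse
    levels summable. On fine levels no cancellation is left; interpolating sup and L1 bounds gives
    (2^|m|/N)^(1/p), which 2^(-s|m|) outweighs because s > 1/p.

    The lower bound is blind to arithmetic: it holds for any N >= 2 points. The exponent 1 - 1/theta
    arises as l+1 shapes of boxes add up in the integral, but only as (l+1)^(1/theta) in the
    norm. *)

Section mcs.
Context {d} {T : measurableType d} {R : realType}.

(** All integrals are taken in this one class, which is stable under sums, bounded measurable
    factors and partial integration, so integrability is never carried as a separate hypothesis. The
    size function [nm] is a parameter so that the line, the plane and the product of two planes are
    instances of the same lemmas. *)
Definition mcs (nm : T -> R) (F : T -> R) :=
  measurable_fun setT F /\
  exists M r, forall x, `|F x| <= M /\ (r < nm x -> F x = 0).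

Definition gauge (m : set T -> \bar R) (nm : T -> R) :=
  forall r, measurable [set x | nm x <= r] /\ (m [set x | (nm x <= r)%R] < +oo)%E.

Variable (nm : T -> R).
Implicit Types F G : T -> R.

Lemma mcsD F G : mcs nm F -> mcs nm G -> mcs nm (fun x => F x + G x).
Proof.
move=> [mF [M [r FM]]] [mG [M' [r' GM]]]; split; first exact: measurable_funD.
exists (M + M'), (Num.max r r') => x; have [F1 F2] := FM x; have [G1 G2] := GM x.
split; first by apply: le_trans (ler_normD _ _) _; apply: lerD.
by rewrite gt_max => /andP[h1 h2]; rewrite F2// G2// addr0.
Qed.

Lemma mcsM F G : mcs nm F -> measurable_fun setT G -> (exists M, forall x, `|G x| <= M) ->
  mcs nm (fun x => G x * F x).
Proof.
move=> [mF [M [r FM]]] mG [M' GM]; split; first exact: measurable_funM.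
exists (M' * M), r => x; have [F1 F2] := FM x.
by split; [rewrite normrM ler_pM|move=> h; rewrite F2// mulr0].
Qed.

Lemma mcsMr F G : mcs nm F -> measurable_fun setT G -> (exists M, forall x, `|G x| <= M) ->
  mcs nm (fun x => F x * G x).
Proof.
move=> hF mG hG; rewrite (_ : (fun x => _) = (fun x => G x * F x)); first exact: mcsM.
by apply/funext => x; rewrite mulrC.
Qed.

Lemma mcsZ F c : mcs nm F -> mcs nm (fun x => c * F x).
Proof. by move=> hF; apply: mcsM => //; exists `|c|. Qed.

Lemma mcsN F : mcs nm F -> mcs nm (fun x => - F x).
Proof.
move=> hF; rewrite (_ : (fun x => _) = (fun x => -1 * F x)); first exact: mcsZ.
by apply/funext => x; rewrite mulN1r.
Qed.

Lemma mcsB F G : mcs nm F -> mcs nm G -> mcs nm (fun x => F x - G x).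
Proof. by move=> hF hG; apply: mcsD => //; apply: mcsN. Qed.

Lemma mcs0 : mcs nm (fun=> 0).
Proof. by split => //; exists 0, 0 => x; rewrite normr0. Qed.

Lemma mcs_abs F : mcs nm F -> mcs nm (fun x => `|F x|).
Proof.
move=> [mF [M [r FM]]]; split; first exact: measurableT_comp.
by exists M, r => x; have [F1 F2] := FM x; split; [rewrite normr_id|move=> /F2 ->; rewrite normr0].
Qed.

Lemma mcs_sum (K : Type) (s : seq K) (P : pred K) (F : K -> T -> R) :
  (forall k, mcs nm (F k)) -> mcs nm (fun x => \sum_(k <- s | P k) F k x).
Proof.
move=> h; elim: s => [|k s IH].
  by rewrite (_ : (fun x => _) = (fun=> 0)); [exact: mcs0|apply/funext => x; rewrite big_nil].
rewrite (_ : (fun x => _) = (fun x => (if P k then F k x else 0) + \sum_(k <- s | P k) F k x)).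
  by apply: mcsD => //; case: (P k) => //; exact: mcs0.
by apply/funext => x; rewrite big_cons; case: ifP => // _; rewrite add0r.
Qed.

Lemma mcs_indic D r : measurable D -> (forall x, D x -> nm x <= r) -> mcs nm (\1_D : T -> R).
Proof.
move=> mD Dr; split => //.
exists 1, r => x; rewrite indicE; split; first by case: (_ \in _); rewrite ?normr1 ?normr0.
by move=> h; rewrite memNset// => /Dr; rewrite leNgt h.
Qed.

Variable (m : {measure set T -> \bar R}).
Hypothesis gm : gauge m nm.
Local Notation I F := (\int[m]_x F x).

Lemma mcs_integrable F : mcs nm F -> m.-integrable setT (EFin \o F).
Proof.
move=> [mF [M [r FM]]]; have [mD fD] := gm r.
set D := [set x | _] in mD fD.
have -> : F = F \_ D.
  apply/funext => x; rewrite patchE; case: ifPn => // /negP xD.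
  by have [_ ->//] := FM x; rewrite ltNge; apply/negP => h; apply: xD; rewrite inE.
rewrite -restrict_EFin; apply/integrable_restrict => //; rewrite setTI.
apply: measurable_bounded_integrable => //; first exact: measurable_funTS.
exists (Num.max M 0); split; first by rewrite num_real.
move=> x; rewrite gt_max => /andP[Mx _] y _ /=.
by apply: le_trans (ltW Mx); have [] := FM y.
Qed.

Lemma intD F G : mcs nm F -> mcs nm G -> I (fun x => F x + G x) = I F + I G.
Proof. by move=> hF hG; rewrite RintegralD//; exact: mcs_integrable. Qed.

Lemma intB F G : mcs nm F -> mcs nm G -> I (fun x => F x - G x) = I F - I G.
Proof. by move=> hF hG; rewrite RintegralB//; exact: mcs_integrable. Qed.

Lemma intZ F c : mcs nm F -> I (fun x => c * F x) = c * I F.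
Proof. by move=> hF; rewrite RintegralZl//; exact: mcs_integrable. Qed.

Lemma int0 : I (fun=> 0) = 0 :> R.
Proof. by rewrite -[RHS](mul0r (I (fun=> 0))) -intZ;
  [under [RHS]eq_Rintegral do rewrite mulr0|exact: mcs0]. Qed.

Lemma int_sum (K : Type) (s : seq K) (P : pred K) (F : K -> T -> R) :
  (forall k, mcs nm (F k)) -> I (fun x => \sum_(k <- s | P k) F k x) = \sum_(k <- s | P k) I (F k).
Proof.
move=> h; elim: s => [|k s IH].
  by rewrite big_nil -[RHS]int0; apply: eq_Rintegral => x _; rewrite big_nil.
rewrite big_cons; under eq_Rintegral do rewrite big_cons.
by case: (P k) => //; rewrite intD ?IH//; exact: mcs_sum.
Qed.

Lemma le_int F G : mcs nm F -> mcs nm G -> (forall x, F x <= G x) -> I F <= I G.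
Proof. by move=> hF hG FG; apply: le_Rintegral => //; exact: mcs_integrable. Qed.

Lemma norm_int F : mcs nm F -> `|I F| <= I (fun x => `|F x|).
Proof. by move=> hF; apply: le_normr_Rintegral => //; exact: mcs_integrable. Qed.

Lemma norm_int_le F G : mcs nm F -> mcs nm G -> (forall x, `|F x| <= G x) -> `|I F| <= I G.
Proof. by move=> hF hG FG; apply: le_trans (norm_int hF) _; apply: le_int => //;
  exact: mcs_abs. Qed.

Lemma int_indic D : measurable D -> I (\1_D : T -> R) = fine (m D).
Proof. by move=> mD; rewrite /Rintegral integral_indic// setIT. Qed.

End mcs.

Section fubini.
Context {d1 d2} {T1 : measurableType d1} {T2 : measurableType d2} {R : realType}.
Variables (n1 : T1 -> R) (n2 : T2 -> R).
Definition pgauge (z : T1 * T2) := Num.max (n1 z.1) (n2 z.2).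
Variables (m1 : {sigma_finite_measure set T1 -> \bar R})
  (m2 : {sigma_finite_measure set T2 -> \bar R}).
Hypotheses (g1 : gauge m1 n1) (g2 : gauge m2 n2).

Lemma pgauge_gauge : gauge (m1 \x m2)%E pgauge.
Proof.
move=> r; have [mD1 fD1] := g1 r; have [mD2 fD2] := g2 r.
have -> : [set x | pgauge x <= r] = [set x | n1 x <= r] `*` [set x | n2 x <= r].
  apply/seteqP; split => -[x y] /=; rewrite /pgauge /= ge_max; first by move=> /andP.
  by move=> [-> ->].
split; first exact: measurableX.
by rewrite product_measure1E// lte_mul_pinfty// ge0_fin_numE.
Qed.

Variable F : T1 * T2 -> R.
Hypothesis hF : mcs pgauge F.

Lemma mcs_xsec x : mcs n2 (fun y => F (x, y)).
Proof.
case: hF => mF [M [r FM]]; split; first exact: measurableT_comp.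
exists M, r => y; have [F1 F2] := FM (x, y); split => // h; apply: F2.
by rewrite /pgauge lt_max h orbT.
Qed.

Lemma mcs_ysec y : mcs n1 (fun x => F (x, y)).
Proof.
case: hF => mF [M [r FM]]; split; first exact: measurableT_comp.
exists M, r => x; have [F1 F2] := FM (x, y); split => // h; apply: F2.
by rewrite /pgauge lt_max h.
Qed.

Let iF : (m1 \x m2)%E.-integrable setT (EFin \o F).
Proof. exact: (mcs_integrable pgauge_gauge). Qed.

(** Measurability comes from Fubini, the bound is that of [F] times the finite measure of a sublevel
    set of [n2], and the radius is inherited. Because the class is preserved, exchanges of integrals
    can be nested. *)
Lemma mcs_partial_int : mcs n1 (fun x => \int[m2]_y F (x, y)).
Proof.
split.
  apply/measurable_EFinP.
  have := measurable_fubini_F iF; congr measurable_fun; apply/funext => x /=.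
  rewrite /fubini_F /= /Rintegral fineK//; apply: integrable_fin_num => //.
  exact: (mcs_integrable g2 (mcs_xsec x)).
case: (hF) => mF [M [r FM]]; have [mD fD] := g2 r.
exists (M * fine (m2 [set x | n2 x <= r])), r => x; split.
  have -> : M * fine (m2 [set x | n2 x <= r]) = \int[m2]_y (M * \1_[set x | n2 x <= r] y).
    by rewrite (intZ g2) ?int_indic//; apply: (@mcs_indic _ _ _ n2 _ r).
  apply: (norm_int_le g2 (mcs_xsec x)) => [|y]; first by apply: mcsZ;
    apply: (@mcs_indic _ _ _ n2 _ r).
  have [F1 F2] := FM (x, y); rewrite indicE; case: (boolP (_ \in _)) => [_|/negP h];
    first by rewrite mulr1.
  rewrite mulr0 F2 ?normr0// /pgauge lt_max; apply/orP; right; rewrite ltNge; apply/negP => h'.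
  by apply: h; rewrite inE.
move=> h; rewrite -[RHS](int0 g2); apply: eq_Rintegral => y _.
by have [_ ->//] := FM (x, y); rewrite /pgauge lt_max h.
Qed.

Lemma Rfubini1 : \int[(m1 \x m2)%E]_z F z = \int[m1]_x \int[m2]_y F (x, y).
Proof.
rewrite /Rintegral -(integral12_prod_meas1 iF); congr fine; apply: eq_integral => x _.
rewrite /fubini_F fineK//; apply: integrable_fin_num => //.
exact: (mcs_integrable g2 (mcs_xsec x)).
Qed.

Lemma Rfubini : \int[m1]_x \int[m2]_y F (x, y) = \int[m2]_y \int[m1]_x F (x, y).
Proof.
rewrite -Rfubini1 /Rintegral -(integral21_prod_meas1 iF); congr fine; apply: eq_integral => y _.
rewrite /fubini_G fineK//; apply: integrable_fin_num => //.
exact: (mcs_integrable g1 (mcs_ysec y)).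
Qed.

End fubini.

(** * Integrals on the line and the plane, affine changes of variable *)

Section plane.
Context {R : realType}.
Notation mu := (@lebesgue_measure R).
Implicit Types f g : R -> R.

Definition nm1 (x : R) : R := `|x|.

Lemma gauge1 : gauge mu nm1.
Proof.
move=> r; have -> : [set x : R | nm1 x <= r] = `[- r, r]%classic.
  by apply/seteqP; split => x /=; rewrite /nm1 in_itv /= ler_norml.
by split => //; rewrite lebesgue_measure_itv /= ; case: ifP => // _; rewrite -EFinD ltry.
Qed.

Local Notation PT := (measurableTypeR R * measurableTypeR R)%type.
Lemma leb2_sigma_finite : sigma_finite setT (@leb2 R).
Proof.
exists (fun n => [set x | pgauge nm1 nm1 x <= n%:R]).
  apply/seteqP; split => // x _; exists (Num.trunc (pgauge nm1 nm1 x)).+1 => //=.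
  exact/ltW/Num.Theory.truncnS_gt.
by move=> n; exact: (pgauge_gauge gauge1 gauge1).
Qed.
(* [leb2] repackaged as a sigma-finite measure, as Fubini requires. *)
Definition plane_measure : {sigma_finite_measure set PT -> \bar R} :=
  HB.pack (leb2 : set PT -> \bar R) (Measure.class (@leb2 R)) (@Measure_isSigmaFinite.Build _ _ _
    (@leb2 R) leb2_sigma_finite).

Definition nm2 : R * R -> R := pgauge nm1 nm1.
Lemma gauge2 : gauge plane_measure nm2.
Proof. exact: (pgauge_gauge gauge1 gauge1). Qed.

Definition nm4 : (R * R) * (R * R) -> R := pgauge nm2 nm2.

Definition I1 (f : R -> R) : R := \int[mu]_x f x.
Definition I2 (F : R * R -> R) : R := \int[leb2]_x F x.
Local Notation RT := (measurableTypeR R).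
Definition mc1 (f : R -> R) := mcs nm1 f.
Definition mc2 (F : R * R -> R) := mcs nm2 F.
Definition mc4 (F : (R * R) * (R * R) -> R) := mcs nm4 F.
Implicit Types F G : R * R -> R.

Lemma I1_ext f g : f =1 g -> I1 f = I1 g.
Proof. by move=> /funext ->. Qed.
Lemma I1D f g : mc1 f -> mc1 g -> I1 (fun x => f x + g x) = I1 f + I1 g.
Proof. exact: (intD gauge1). Qed.
Lemma I1B f g : mc1 f -> mc1 g -> I1 (fun x => f x - g x) = I1 f - I1 g.
Proof. exact: (intB gauge1). Qed.
Lemma I1Z f c : mc1 f -> I1 (fun x => c * f x) = c * I1 f.
Proof. exact: (intZ gauge1). Qed.
Lemma I10 : I1 (fun=> 0) = 0.
Proof. exact: (int0 gauge1). Qed.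
Lemma I1_sum (K : Type) (s : seq K) (P : pred K) (F : K -> R -> R) :
  (forall k, mc1 (F k)) -> I1 (fun x => \sum_(k <- s | P k) F k x) = \sum_(k <- s | P k) I1 (F k).
Proof. exact: (int_sum gauge1). Qed.
Lemma le_I1 f g : mc1 f -> mc1 g -> (forall x, f x <= g x) -> I1 f <= I1 g.
Proof. exact: (le_int gauge1). Qed.
Lemma I1_ge0 f : (forall x, 0 <= f x) -> 0 <= I1 f.
Proof. by move=> h; apply: Rintegral_ge0. Qed.
Lemma norm_I1 f g : mc1 f -> mc1 g -> (forall x, `|f x| <= g x) -> `|I1 f| <= I1 g.
Proof. exact: (norm_int_le gauge1). Qed.

Lemma I2_ext F G : F =1 G -> I2 F = I2 G.
Proof. by move=> /funext ->. Qed.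
Lemma I2D F G : mc2 F -> mc2 G -> I2 (fun x => F x + G x) = I2 F + I2 G.
Proof. exact: (intD gauge2). Qed.
Lemma I2B F G : mc2 F -> mc2 G -> I2 (fun x => F x - G x) = I2 F - I2 G.
Proof. exact: (intB gauge2). Qed.
Lemma I2Z F c : mc2 F -> I2 (fun x => c * F x) = c * I2 F.
Proof. exact: (intZ gauge2). Qed.
Lemma I20 : I2 (fun=> 0) = 0.
Proof. exact: (int0 gauge2). Qed.
Lemma I2_sum (K : Type) (s : seq K) (P : pred K) (F : K -> R * R -> R) :
  (forall k, mc2 (F k)) -> I2 (fun x => \sum_(k <- s | P k) F k x) = \sum_(k <- s | P k) I2 (F k).
Proof. exact: (int_sum gauge2). Qed.
Lemma le_I2 F G : mc2 F -> mc2 G -> (forall x, F x <= G x) -> I2 F <= I2 G.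
Proof. exact: (le_int gauge2). Qed.
Lemma I2_ge0 F : (forall x, 0 <= F x) -> 0 <= I2 F.
Proof. by move=> h; apply: Rintegral_ge0. Qed.
Lemma norm_I2 F G : mc2 F -> mc2 G -> (forall x, `|F x| <= G x) -> `|I2 F| <= I2 G.
Proof. exact: (norm_int_le gauge2). Qed.

Lemma I2E F : mc2 F -> I2 F = I1 (fun x => I1 (fun y => F (x, y))).
Proof. exact: (@Rfubini1 _ _ RT RT R nm1 nm1 mu mu gauge1 gauge1). Qed.
Lemma I1_swap F : mc2 F -> I1 (fun x => I1 (fun y => F (x, y))) =
  I1 (fun y => I1 (fun x => F (x, y))).
Proof. exact: (@Rfubini _ _ RT RT R nm1 nm1 mu mu gauge1 gauge1). Qed.
Lemma mc1_partial F : mc2 F -> mc1 (fun x => I1 (fun y => F (x, y))).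
Proof. exact: (@mcs_partial_int _ _ RT RT R nm1 nm1 mu mu gauge1 gauge1). Qed.
Lemma mc1_xsec F x : mc2 F -> mc1 (fun y => F (x, y)).
Proof. move=> h; exact: (mcs_xsec h). Qed.
Lemma I2_swap H : mc4 H -> I2 (fun x => I2 (fun y => H (x, y))) =
  I2 (fun y => I2 (fun x => H (x, y))).
Proof. exact: (@Rfubini _ _ PT PT R nm2 nm2 plane_measure plane_measure gauge2 gauge2). Qed.
Lemma mc2_partial H : mc4 H -> mc2 (fun x => I2 (fun y => H (x, y))).
Proof. exact: (@mcs_partial_int _ _ PT PT R nm2 nm2 plane_measure plane_measure gauge2 gauge2). Qed.
Lemma mc2_xsec H x : mc4 H -> mc2 (fun y => H (x, y)).
Proof. move=> h; exact: (mcs_xsec h). Qed.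
Lemma mc1_affine a b f : a != 0 -> mc1 f -> mc1 (fun x => f (a * x + b)).
Proof.
move=> a0 [mf [M [r fM]]]; split.
  apply: (measurableT_comp mf); apply: measurable_funD => //; exact: measurable_funM.
exists M, ((r + `|b|) / `|a|) => x; have [f1 f2] := fM (a * x + b); split => // h; apply: f2.
move: h; rewrite ltr_pdivrMr ?normr_gt0// => h; rewrite /nm1.
have := ler_normB (a * x + b) b; rewrite addrK normrM; rewrite mulrC in h; rewrite /nm1 in h; lra.
Qed.

(** The image of Lebesgue measure under x -> ax + b, multiplied by |a|, agrees with Lebesgue measure
    on half-open intervals, hence everywhere by uniqueness. For a < 0 the preimage is closed at the
    other end, which does not change its length. *)
Let ge0_I1_affine a b f : a != 0 -> mc1 f -> (forall x, 0 <= f x) ->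
  I1 f = `|a| * I1 (fun x => f (a * x + b)).
Proof.
move=> a0 hf f0; pose phi (x : RT) : RT := a * x + b.
have mphi : measurable_fun setT phi by apply: measurable_funD => //; exact: measurable_funM.
have aa : 0 <= `|a| by [].
pose nu_ : {measure set RT -> \bar R} := mscale (NngNum aa) (pushforward mu phi).
pose nu := nu_ mphi.
have key A : measurable A -> mu A = nu A.
  move=> mA; apply: lebesgue_measure_unique => // _ [[x y] _ <-] /=.
  rewrite /nu /nu_ /= /mscale /= /pushforward.
  have [ap|an|ae] := ltgtP a 0; last by rewrite ae eqxx in a0.
    have -> : phi @^-1` `]x, y]%classic = `[(y - b) / a, (x - b) / a[%classic.
      apply/seteqP; split => z /=; rewrite /phi !in_itv /= ler_ndivrMr// ltr_ndivlMr//; lra.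
    rewrite !lebesgue_measure_itv /= !lte_fin ltr_nM2r ?invr_lt0// ltrD2r.
    case: ifP => // _; last by rewrite mule0.
    by rewrite -!EFinD -EFinM ltr0_norm//; congr EFin; field.
  have -> : phi @^-1` `]x, y]%classic = `](x - b) / a, (y - b) / a]%classic.
    apply/seteqP; split => z /=; rewrite /phi !in_itv /= ler_pdivlMr// ltr_pdivrMr//; lra.
  rewrite !lebesgue_measure_itv /= !lte_fin ltr_pM2r ?invr_gt0// ltrD2r.
  case: ifP => // _; last by rewrite mule0.
  by rewrite -!EFinD -EFinM gtr0_norm//; congr EFin; field.
rewrite /I1 /Rintegral.
have mf : measurable_fun setT (EFin \o f) by apply/measurable_EFinP; case: hf.
rewrite (@eq_measure_integral _ RT R setT nu mu (EFin \o f)); last by move=> A mA _; exact: key.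
rewrite ge0_integral_mscale//; last by move=> x _; rewrite lee_fin.
rewrite ge0_integral_pushforward//; last by move=> x _; rewrite lee_fin.
by rewrite preimage_setT /= fineM//; apply: integrable_fin_num => //;
  apply: (mcs_integrable gauge1); exact: mc1_affine.
Qed.

(** The nonnegative case applies to both terms of f = (|f| + f) - |f|. *)
Lemma I1_affine a b f : a != 0 -> mc1 f -> I1 (fun x => f (a * x + b)) = `|a|^-1 * I1 f.
Proof.
move=> a0 hf; have ha := mcs_abs hf; have hp := mcsD ha hf;
  have an : `|a| != 0 by rewrite normr_eq0.
have f0 x : 0 <= `|f x| + f x by have := ler_norm (- f x); rewrite normrN; lra.
have E1 := ge0_I1_affine b a0 hp f0; have E2 := ge0_I1_affine b a0 ha (fun x => normr_ge0 _).
have -> : I1 f = I1 (fun x => `|f x| + f x) - I1 (fun x => `|f x|).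
  by rewrite -(I1B hp ha); apply: I1_ext => x; lra.
have -> : I1 (fun x => f (a * x + b)) = I1 (fun x => (fun x => `|f x| + f x) (a * x + b)) - I1
  (fun x => (fun x => `|f x|) (a * x + b)).
  by rewrite -(I1B (mc1_affine b a0 hp) (mc1_affine b a0 ha)); apply: I1_ext => x; lra.
by rewrite E1 E2; field.
Qed.

End plane.

(** * Measurability, translations and tensor products in the plane *)

Section planar.
Context {R : realType}.
Implicit Types (f g : R -> R) (F G : R * R -> R).

(** Open refers to the product topology, measurable to the product sigma-algebra. The two meet
    because an open set is a countable union of boxes with rational corners. *)
Lemma open_plane_measurable (O : set (R * R)) : open O -> measurable O.
Proof.
move=> oO.
pose box (q : (rat * rat) * (rat * rat)) : set (R * R) :=
  `]ratr q.1.1, ratr q.1.2[%classic `*` `]ratr q.2.1, ratr q.2.2[%classic.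
pose B (n : nat) : set (R * R) := if unpickle n is Some q then
  (if asbool (box q `<=` O) then box q else set0) else set0.
have BE q : B (pickle q) = if asbool (box q `<=` O) then box q else set0 by rewrite /B pickleK.
have -> : O = \bigcup_n B n.
  apply/seteqP; split => [[x y] Oxy|z [n _]]; last first.
    by rewrite /B; case: unpickle => // q; case: asboolP => // h /h.
  have /nbhs_ballP[e /= e0 eO] : nbhs (x, y) O by rewrite nbhsE; exists O.
  have e1 : x - e < x by rewrite ltrBlDr ltrDl.
  have e2 : x < x + e by rewrite ltrDl.
  have e3 : y - e < y by rewrite ltrBlDr ltrDl.
  have e4 : y < y + e by rewrite ltrDl.
  have [a] := rat_in_itvoo e1; rewrite in_itv /= => /andP[a1 a2].
  have [b] := rat_in_itvoo e2; rewrite in_itv /= => /andP[b1 b2].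
  have [c] := rat_in_itvoo e3; rewrite in_itv /= => /andP[c1 c2].
  have [d] := rat_in_itvoo e4; rewrite in_itv /= => /andP[d1 d2].
  exists (pickle ((a, b), (c, d))); first exact: Logic.I.
  rewrite BE {BE B}.
  case: asboolP => [_|[]]; first by split; rewrite /= in_itv /= ?a2 ?b1 ?c2 ?d1.
  move=> [u v] [] /=; rewrite !in_itv /= => /andP[u1 u2] /andP[v1 v2]; apply: eO.
  by split; rewrite /= /ball /= ltr_norml; apply/andP; split; lra.
apply: bigcupT_measurable => n; rewrite /B; case: unpickle => // q.
by case: asboolP => // _; apply: measurableX.
Qed.

Lemma continuous_plane_measurable F : continuous F -> measurable_fun setT F.
Proof.
move=> /continuousP cF; apply: (measurability _ (RGenOpens.measurableE R)).
move=> _ [_ [a [b ->] <-]]; rewrite setTI; apply: open_plane_measurable.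
exact/cF/interval_open.
Qed.

Lemma mf_sub1 f (c : R) : measurable_fun setT f -> measurable_fun setT (fun x : R => f (c - x)).
Proof. by move=> mf; apply: (measurableT_comp mf); exact: measurable_funB. Qed.

Lemma mf_fst f : measurable_fun setT f -> measurable_fun setT (fun z : R * R => f z.1).
Proof. by move=> mf; exact: (measurableT_comp mf). Qed.

Lemma mf_snd f : measurable_fun setT f -> measurable_fun setT (fun z : R * R => f z.2).
Proof. by move=> mf; exact: (measurableT_comp mf). Qed.

Lemma mf_diff f : measurable_fun setT f -> measurable_fun setT (fun z : R * R => f (z.1 - z.2)).
Proof. by move=> mf; apply: (measurableT_comp mf); exact: measurable_funB. Qed.

Lemma mf_shift2 F (c : R * R) : measurable_fun setT F -> measurable_fun setT
  (fun x : R * R => F (x + c)).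
Proof.
move=> mf; apply: (measurableT_comp mf).
by apply: measurable_fun_pair => /=; apply: measurable_funD.
Qed.

Lemma mf_sub2 F (c : R * R) : measurable_fun setT F -> measurable_fun setT
  (fun x : R * R => F (c - x)).
Proof.
move=> mf; apply: (measurableT_comp mf).
by apply: measurable_fun_pair => /=; apply: measurable_funB.
Qed.

Lemma mf_diff2 F : measurable_fun setT F -> measurable_fun setT
  (fun z : (R * R) * (R * R) => F (z.1 - z.2)).
Proof.
move=> mf; apply: (measurableT_comp mf).
apply: measurable_fun_pair => /=; apply: measurable_funB; apply: measurableT_comp => //.
Qed.

Lemma mc2_shift F c : mc2 F -> mc2 (fun z => F (z + c)).
Proof.
move=> [mF [M [r FM]]]; split; first exact: mf_shift2.
exists M, (r + Num.max `|c.1| `|c.2|) => z; have [F1 F2] := FM (z + c); split => // h; apply: F2.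
have z1 : `|z.1| <= `|z.1 + c.1| + `|c.1| by have := ler_normB (z.1 + c.1) c.1; rewrite addrK.
have z2 : `|z.2| <= `|z.2 + c.2| + `|c.2| by have := ler_normB (z.2 + c.2) c.2; rewrite addrK.
move: h; rewrite /nm2 /pgauge /nm1 /= -ltrBrDr.
have c1 : `|c.1| <= Num.max `|c.1| `|c.2| by rewrite le_max lexx.
have c2 : `|c.2| <= Num.max `|c.1| `|c.2| by rewrite le_max lexx orbT.
move: (Num.max `|c.1| _) c1 c2 => m c1 c2; rewrite ltrBrDr !lt_max => /orP[] h; apply/orP;
  [left|right]; lra.
Qed.

Lemma mc2_opp F : mc2 F -> mc2 (fun z => F (- z)).
Proof.
move=> [mF [M [r FM]]]; split.
  by have := mf_sub2 0 mF; under eq_fun do rewrite sub0r.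
exists M, r => z; have [F1 F2] := FM (- z); split => // h; apply: F2.
by move: h; rewrite /nm2 /pgauge /nm1 /= !normrN.
Qed.

Lemma mc2_sub F c : mc2 F -> mc2 (fun z => F (c - z)).
Proof.
move=> /(mc2_shift c) /mc2_opp; rewrite (_ : (fun z => F (- z + c)) = (fun z => F (c - z)))//.
by apply/funext => z; rewrite addrC.
Qed.

Lemma mc1_shift f c : mc1 f -> mc1 (fun z => f (z + c)).
Proof. by move=> /(mc1_affine c (oner_neq0 R)); under eq_fun do rewrite mul1r. Qed.

Lemma mc1_sub f c : mc1 f -> mc1 (fun z => f (c - z)).
Proof.
move=> /(@mc1_affine _ (-1) c) h; have /h : (-1 : R) != 0 by rewrite oppr_eq0 oner_neq0.
by rewrite (_ : (fun x => f (-1 * x + c)) = (fun z => f (c - z)))//; apply/funext => z;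
  rewrite mulN1r addrC.
Qed.

Lemma I1_shift f c : mc1 f -> I1 (fun z => f (z + c)) = I1 f.
Proof.
move=> hf; have := I1_affine c (oner_neq0 R) hf; rewrite normr1 invr1 mul1r => <-.
by apply: I1_ext => x; rewrite mul1r.
Qed.

Lemma I1_sub f c : mc1 f -> I1 (fun z => f (c - z)) = I1 f.
Proof.
move=> hf; have n0 : (-1 : R) != 0 by rewrite oppr_eq0 oner_neq0.
have := I1_affine c n0 hf; rewrite normrN normr1 invr1 mul1r => <-.
by apply: I1_ext => x; rewrite mulN1r addrC.
Qed.

Lemma I2_shift F c : mc2 F -> I2 (fun z => F (z + c)) = I2 F.
Proof.
move=> hF; rewrite (I2E (mc2_shift c hF)) (I2E hF).
rewrite -(I1_shift c.1 (mc1_partial hF)); apply: I1_ext => x /=.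
by rewrite -(I1_shift c.2 (mc1_xsec (x + c.1) hF)); apply: I1_ext => y.
Qed.

Lemma I2_sub F c : mc2 F -> I2 (fun z => F (c - z)) = I2 F.
Proof.
move=> hF; rewrite (I2E (mc2_sub c hF)) (I2E hF).
rewrite -(I1_sub c.1 (mc1_partial hF)); apply: I1_ext => x /=.
by rewrite -(I1_sub c.2 (mc1_xsec (c.1 - x) hF)); apply: I1_ext => y.
Qed.

Definition tens f g (z : R * R) := f z.1 * g z.2.

Lemma mc2_tens f g : mc1 f -> mc1 g -> mc2 (tens f g).
Proof.
move=> [mf [M [r fM]]] [mg [M' [r' gM]]]; split.
  by apply: measurable_funM; [exact: mf_fst|exact: mf_snd].
exists (M * M'), (Num.max r r') => -[x y]; rewrite /tens /=.
have [f1 f2] := fM x; have [g1 g2] := gM y; split; first by rewrite normrM ler_pM.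
rewrite /nm2 /pgauge /= lt_max !gt_max => /orP[/andP[h _]|/andP[_ h]]; first by rewrite f2// mul0r.
by rewrite g2// mulr0.
Qed.

Lemma I2_tens f g : mc1 f -> mc1 g -> I2 (tens f g) = I1 f * I1 g.
Proof.
move=> hf hg; rewrite (I2E (mc2_tens hf hg)) /tens /= mulrC -(I1Z _ hf).
by apply: I1_ext => x; rewrite I1Z// mulrC.
Qed.

Lemma mc2_conv f g : mc1 f -> mc1 g -> mc2 (fun z => f (z.1 - z.2) * g z.2).
Proof.
move=> [mf [M [r fM]]] [mg [M' [r' gM]]]; split.
  by apply: measurable_funM; [exact: mf_diff|exact: mf_snd].
exists (M * M'), (`|r| + `|r'|) => -[x y] /=.
have [f1 f2] := fM (x - y); have [g1 g2] := gM y; split; first by rewrite normrM ler_pM.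
move: f2 g2; rewrite /nm2 /pgauge /nm1 /= => f2 g2.
case: (ltP r' `|y|) => hy; first by rewrite g2 ?mulr0.
case: (ltP r `|x - y|) => hxy; first by rewrite f2 ?mul0r.
have := ler_normD (x - y) y; rewrite subrK => h; have := ler_norm r; have := ler_norm r' => h1 h2.
have := normr_ge0 r => h3.
by rewrite lt_max => /orP[]; lra.
Qed.

Lemma mc4_conv F G : mc2 F -> mc2 G -> mc4 (fun z => F (z.1 - z.2) * G z.2).
Proof.
move=> [mf [M [r fM]]] [mg [M' [r' gM]]]; split.
  by apply: measurable_funM; [exact: mf_diff2|exact: measurableT_comp].
exists (M * M'), (`|r| + `|r'|) => -[x y] /=.
have [f1 f2] := fM (x - y); have [g1 g2] := gM y; split; first by rewrite normrM ler_pM.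
move: f2 g2; rewrite /nm4 /nm2 /pgauge /nm1 /= => f2 g2.
case: (ltP r' (Num.max `|y.1| `|y.2|)) => hy; first by rewrite g2 ?mulr0.
case: (ltP r (Num.max `|x.1 - y.1| `|x.2 - y.2|)) => hxy; first by rewrite f2 ?mul0r.
have := ler_norm r; have := ler_norm r' => h1 h2; have := normr_ge0 r => h3.
move: hy hxy; rewrite !ge_max => /andP[y1 y2] /andP[x1 x2].
have := ler_normD (x.1 - y.1) y.1; rewrite subrK => hh1.
have := ler_normD (x.2 - y.2) y.2; rewrite subrK => hh2.
by rewrite !lt_max => /orP[/orP[]|/orP[]]; lra.
Qed.

End planar.

(** * Convolution and dilation *)

Section convolution.
Context {R : realType}.
Implicit Types (f g h : R -> R) (F G : R * R -> R).

Definition convol f g (x : R) := I1 (fun y => f (x - y) * g y).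

(** Normalised in L1, so that it keeps the integral and is multiplicative for convolution. Level k+1
    of [Psi] is [dil k] of [Psi1]. *)
Definition dil (k : nat) f (x : R) := 2 ^+ k * f (2 ^+ k * x).

Lemma pow2_gt0 (k : nat) : 0 < (2 : R) ^+ k. Proof. by rewrite exprn_gt0. Qed.
Lemma pow2_neq0 (k : nat) : (2 : R) ^+ k != 0. Proof. by rewrite gt_eqF// pow2_gt0. Qed.
Hint Resolve pow2_gt0 pow2_neq0 : core.

Lemma mc1_meas f : mc1 f -> measurable_fun setT f. Proof. by case. Qed.
Lemma mc1_bnd f : mc1 f -> exists M, forall x, `|f x| <= M.
Proof. by move=> [_ [M [r h]]]; exists M => x; have [] := h x. Qed.
Lemma mc2_meas F : mc2 F -> measurable_fun setT F. Proof. by case. Qed.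
Lemma mc2_bnd F : mc2 F -> exists M, forall x, `|F x| <= M.
Proof. by move=> [_ [M [r h]]]; exists M => x; have [] := h x. Qed.

Lemma mc1_mul f g : mc1 f -> mc1 g -> mc1 (fun x => f x * g x).
Proof. by move=> hf hg; apply: mcsM => //; [exact: mc1_meas|exact: mc1_bnd]. Qed.

Lemma mc2_mul F G : mc2 F -> mc2 G -> mc2 (fun x => F x * G x).
Proof. by move=> hf hg; apply: mcsM => //; [exact: mc2_meas|exact: mc2_bnd]. Qed.

Lemma conv_int f g x : mc1 f -> mc1 g -> mc1 (fun y => f (x - y) * g y).
Proof. by move=> hf hg; apply: mc1_mul => //; exact: mc1_sub. Qed.

Lemma mc1_convolution f g : mc1 f -> mc1 g -> mc1 (convol f g).
Proof. by move=> hf hg; have := mc1_partial (mc2_conv hf hg). Qed.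

Lemma convC f g : mc1 f -> mc1 g -> convol f g = convol g f.
Proof.
move=> hf hg; apply/funext => x; rewrite /convol.
rewrite -(I1_sub x (conv_int x hg hf)); apply: I1_ext => y.
by rewrite subKr mulrC.
Qed.

Lemma I1_conv f g : mc1 f -> mc1 g -> I1 (convol f g) = I1 f * I1 g.
Proof.
move=> hf hg; rewrite /convol (I1_swap (mc2_conv hf hg)) /= -I1Z//; apply: I1_ext => y.
under I1_ext do rewrite mulrC.
by rewrite I1Z 1?mulrC ?I1_shift//; exact: mc1_shift.
Qed.

Lemma convA f g h : mc1 f -> mc1 g -> mc1 h -> convol (convol f g) h = convol f (convol g h).
Proof.
move=> hf hg hh; apply/funext => x; rewrite /convol.
have hF : mc2 (fun z : R * R => g (z.2 - z.1) * h z.1 * f (x - z.2)).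
  have hgh := mc2_conv hg hh.
  have [mg [M [r gM]]] : mc2 (fun z : R * R => g (z.2 - z.1) * h z.1).
    case: hgh => mF [M [r FM]]; split.
      apply: measurable_funM; last exact: mf_fst (mc1_meas hh).
      by apply: (measurableT_comp (mc1_meas hg)); apply: measurable_funB.
    exists M, r => -[a b]; have := FM (b, a); rewrite /nm2 /pgauge /=.
    by rewrite maxC.
  have hG : mc2 (fun z : R * R => g (z.2 - z.1) * h z.1) by split => //; exists M, r.
  have mfx : measurable_fun setT (fun z : R * R => f (x - z.2)).
    by apply: (@mf_snd _ (fun y => f (x - y))); apply: mf_sub1; exact: mc1_meas.
  apply: (mcsMr hG mfx).
  by have [M' fM] := mc1_bnd hf; exists M' => z.
transitivity (I1 (fun y => I1 (fun w => g (w - y) * h y * f (x - w)))).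
  apply: I1_ext => y; rewrite mulrC -I1Z; last exact: conv_int.
  have hS := mcsZ (h y) (conv_int (x - y) hf hg).
  rewrite -(I1_shift (- y) hS); apply: I1_ext => w.
  by rewrite opprB addrA [x - y + y]subrK; ring.
rewrite (I1_swap hF) /=; apply: I1_ext => w.
rewrite -I1Z; last exact: conv_int.
by apply: I1_ext => y; ring.
Qed.

Lemma convDl f g h : mc1 f -> mc1 g -> mc1 h -> convol (fun x => f x + g x) h =
  (fun x => convol f h x + convol g h x).
Proof.
move=> hf hg hh; apply/funext => x; rewrite /convol -I1D; try exact: conv_int.
by apply: I1_ext => y; rewrite mulrDl.
Qed.

Lemma convBl f g h : mc1 f -> mc1 g -> mc1 h -> convol (fun x => f x - g x) h =
  (fun x => convol f h x - convol g h x).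
Proof.
move=> hf hg hh; apply/funext => x; rewrite /convol -I1B; try exact: conv_int.
by apply: I1_ext => y; rewrite mulrBl.
Qed.

Lemma convZl f c h : mc1 f -> mc1 h -> convol (fun x => c * f x) h = (fun x => c * convol f h x).
Proof.
move=> hf hh; apply/funext => x; rewrite /convol -I1Z; last exact: conv_int.
by apply: I1_ext => y; rewrite mulrA.
Qed.

Lemma convBr f g h : mc1 f -> mc1 g -> mc1 h -> convol h (fun x => f x - g x) =
  (fun x => convol h f x - convol h g x).
Proof.
move=> hf hg hh; rewrite convC//; last exact: mcsB.
by rewrite convBl// (convC hf hh) (convC hg hh).
Qed.

Lemma mc1_dil k f : mc1 f -> mc1 (dil k f).
Proof.
move=> hf; apply: mcsZ; have := mc1_affine 0 (pow2_neq0 k) hf.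
by under eq_fun do rewrite addr0.
Qed.

Lemma I1_scale k f : mc1 f -> I1 (fun x => f (2 ^+ k * x)) = 2 ^- k * I1 f.
Proof.
move=> hf; have := I1_affine 0 (pow2_neq0 k) hf; rewrite gtr0_norm// => <-.
by apply: I1_ext => x; rewrite addr0.
Qed.

Lemma mc1_scale k f : mc1 f -> mc1 (fun x => f (2 ^+ k * x)).
Proof. by move=> hf; have := mc1_affine 0 (pow2_neq0 k) hf; under eq_fun do rewrite addr0. Qed.

Lemma I1_dil k f : mc1 f -> I1 (dil k f) = I1 f.
Proof. by move=> hf; rewrite /dil I1Z ?I1_scale// ?mulrA ?divff ?mul1r//; exact: mc1_scale. Qed.

Lemma dil_conv k f g : mc1 f -> mc1 g -> dil k (convol f g) = convol (dil k f) (dil k g).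
Proof.
move=> hf hg; apply/funext => x; rewrite /dil /convol.
have hS := conv_int (2 ^+ k * x) hf hg.
have := I1_scale k hS => E.
transitivity (2 ^+ k * 2 ^+ k * I1 (fun y => f (2 ^+ k * x - 2 ^+ k * y) * g (2 ^+ k * y))).
  by rewrite E -!mulrA mulVKf.
rewrite -I1Z; last exact: (mc1_scale k hS).
by apply: I1_ext => y; rewrite mulrBr; ring.
Qed.

Lemma dil_dil j k f : dil j (dil k f) = dil (k + j) f.
Proof. by apply/funext => x; rewrite /dil exprD; rewrite mulrA (mulrC (2 ^+ j)) -!mulrA. Qed.

Lemma dil0 f : dil 0 f = f.
Proof. by apply/funext => x; rewrite /dil expr0 !mul1r. Qed.

Lemma dilB k f g : dil k (fun x => f x - g x) = (fun x => dil k f x - dil k g x).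
Proof. by apply/funext => x; rewrite /dil mulrBr. Qed.

End convolution.

(** * Smooth functions of compact support on the line *)

Section smooth.
Context {R : realType}.
Implicit Types (f g h : R -> R).

Definition smooth1 f := forall (n : nat) (x : R), derivable (derive1n n f) x 1.
Definition test1 f := smooth1 f /\ exists r : R, forall x, r < `|x| -> f x = 0.

Lemma is_derive_derive1 f g : (forall x : R, is_derive x 1 f (g x)) -> f^`()%classic = g.
Proof. by move=> h; apply/funext => x; rewrite derive1E; have [] := h x. Qed.

Lemma smooth1_is_derive f (x : R) : smooth1 f -> is_derive x 1 f (f^`()%classic x).
Proof. by move=> /(_ 0%N x) d; split => //; rewrite derive1E. Qed.

Lemma smooth1_derive f : smooth1 f -> smooth1 f^`()%classic.
Proof. by move=> h n x; have := h n.+1 x; rewrite derive1Sn. Qed.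

Lemma smooth1_deriven k f : smooth1 f -> smooth1 (derive1n k f).
Proof. by move=> h n x; have := h (n + k)%N x; rewrite /derive1n iterD. Qed.

(** Coinduction for smoothness: a class of derivable functions closed under differentiation consists
    of smooth functions. It spares formulas for the higher derivatives of sums and products. *)
Lemma smooth1_coind (P : (R -> R) -> Prop) :
  (forall f, P f -> (forall x : R, derivable f x 1) /\ P f^`()%classic) -> forall f,
    P f -> smooth1 f.
Proof.
move=> hP f Pf n; suff : P (derive1n n f) by move=> /hP[].
by elim: n => [//|n IH]; rewrite derive1nS; have [] := hP _ IH.
Qed.

Lemma smooth1_continuous f : smooth1 f -> continuous f.
Proof. by move=> h x; apply: differentiable_continuous; apply/derivable1_diffP; exact: (h 0%N). Qed.

(** The algebra generated by the smooth functions. The product rule keeps derivatives inside it, so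
    [smooth1_coind] applies. *)
Inductive smooth_alg : (R -> R) -> Prop :=
| Smooth_base f : smooth1 f -> smooth_alg f
| Smooth_add f g : smooth_alg f -> smooth_alg g -> smooth_alg (fun x => f x + g x)
| Smooth_mul f g : smooth_alg f -> smooth_alg g -> smooth_alg (fun x => f x * g x).

Lemma is_derive1D f g (x a b : R) : is_derive x 1 f a -> is_derive x 1 g b ->
  is_derive x 1 (fun x => f x + g x) (a + b).
Proof. by move=> h1 h2; exact: is_deriveD. Qed.

Lemma is_derive1M f g (x a b : R) : is_derive x 1 f a -> is_derive x 1 g b ->
  is_derive x 1 (fun x => f x * g x) (a * g x + f x * b).
Proof.
move=> h1 h2; apply: (is_derive_eq (is_deriveM h1 h2)).
by rewrite /GRing.scale /=; ring.
Qed.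

Lemma smooth_alg_smooth1 f : smooth_alg f -> smooth1 f.
Proof.
apply: (smooth1_coind (P := smooth_alg)) => {f} f.
elim=> {f} [f hf|f g hf [df sf] hg [dg sg]|f g hf [df sf] hg [dg sg]].
- by split; [exact: (hf 0%N)|apply: Smooth_base; exact: smooth1_derive].
- have D (x : R) : is_derive x 1 (fun x => f x + g x) (f^`()%classic x + g^`()%classic x).
    by apply: is_derive1D; split => //; rewrite derive1E.
  split; first by move=> x; have [] := D x.
  by rewrite (is_derive_derive1 D); exact: Smooth_add.
- have D (x : R) : is_derive x 1 (fun x => f x * g x) (f^`()%classic x * g x +
  f x * g^`()%classic x).
    by apply: is_derive1M; split => //; rewrite derive1E.
  split; first by move=> x; have [] := D x.
  by rewrite (is_derive_derive1 D); apply: Smooth_add; exact: Smooth_mul.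
Qed.

Lemma smooth1D f g : smooth1 f -> smooth1 g -> smooth1 (fun x => f x + g x).
Proof. by move=> hf hg; apply: smooth_alg_smooth1; apply: Smooth_add; exact: Smooth_base. Qed.

Lemma smooth1M f g : smooth1 f -> smooth1 g -> smooth1 (fun x => f x * g x).
Proof. by move=> hf hg; apply: smooth_alg_smooth1; apply: Smooth_mul; exact: Smooth_base. Qed.

Lemma smooth1_cst (c : R) : smooth1 (fun=> c).
Proof.
apply: (smooth1_coind (P := fun f => exists c, f = fun=> c)) => [f [{}c ->]|]; last by exists c.
by split => [x|]; [exact: derivable_cst|exists 0; apply/funext => x; rewrite derive1_cst].
Qed.

Lemma smooth1Z f c : smooth1 f -> smooth1 (fun x => c * f x).
Proof. by move=> hf; apply: smooth1M => //; exact: smooth1_cst. Qed.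

Lemma is_derive_affine f g a b c : (forall x : R, is_derive x 1 f (g x)) ->
  forall x : R, is_derive x 1 (fun x => c * f (a * x + b)) (c * a * g (a * x + b)).
Proof.
move=> h x.
have d1 : is_derive x 1 (fun x : R => a * x + b) a.
  apply: (is_derive_eq (is_deriveD (is_deriveZ a (is_derive_id x (1 : R))) (is_derive_cst b x 1))).
  by rewrite addr0 /GRing.scale /= mulr1.
have d2 : is_derive x 1 (fun x : R => f (a * x + b)) _ := @is_derive1_comp R f (fun x => a * x + b)
  x _ _ (h (a * x + b)) d1.
have d3 := is_derive1M (is_derive_cst c x 1) d2.
apply: (is_derive_eq d3).
by rewrite /GRing.scale /=; ring.
Qed.

Lemma derive1_affine f a b c : smooth1 f ->
  (fun x => c * f (a * x + b))^`()%classic = (fun x => c * a * f^`()%classic (a * x + b)).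
Proof. by move=> hf; apply: is_derive_derive1; apply: is_derive_affine => x;
  exact: smooth1_is_derive. Qed.

Lemma smooth1_affine f a b c : smooth1 f -> smooth1 (fun x => c * f (a * x + b)).
Proof.
move=> hf; apply: (smooth1_coind (P := fun h => exists f c, smooth1 f /\ h = fun x => c * f
  (a * x + b))).
  move=> h [{}f [{}c [{}hf ->]]];
    have := is_derive_affine a b c (fun x => smooth1_is_derive x hf) => D.
  split => [x|]; first by have [] := D x.
  by exists f^`()%classic, (c * a); split; [exact: smooth1_derive|exact: is_derive_derive1].
by exists f, c.
Qed.

Lemma derive1n_affine f a b c n : smooth1 f ->
  derive1n n (fun x => c * f (a * x + b)) = (fun x => c * a ^+ n * derive1n n f (a * x + b)).
Proof.
move=> hf; elim: n => [|n IH]; first by apply/funext => x; rewrite expr0 mulr1.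
rewrite derive1nS IH derive1_affine; last exact: smooth1_deriven.
by apply/funext => x; rewrite exprSr mulrA derive1nS.
Qed.

Lemma derive1_out f (c r : R) : (forall x, r < `|x - c| -> f x = 0) ->
  forall x, r < `|x - c| -> f^`()%classic x = 0.
Proof.
move=> h x rx; rewrite derive1E.
have : \forall y \near x, f y = (fun=> 0) y.
  have : \forall y \near x, r < `|y - c|.
    have : `|y - c| @[y --> x] --> `|x - c| by apply: cvg_norm; apply: cvgB;
      [exact: cvg_id|exact: cvg_cst].
    by move=> /cvgr_gt; exact.
  by apply: filterS => y; exact: h.
by move=> hn; rewrite (near_eq_derive _ hn)// ?oner_neq0// derive_cst.
Qed.

Lemma derive1n_out f (c r : R) n : (forall x, r < `|x - c| -> f x = 0) ->
  forall x, r < `|x - c| -> derive1n n f x = 0.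
Proof. by move=> h; elim: n => [//|n IH]; rewrite derive1nS; exact: derive1_out. Qed.

Lemma test1_derive f : test1 f -> test1 f^`()%classic.
Proof.
move=> [sf [r h]]; split; first exact: smooth1_derive.
by exists r => x rx; apply: (@derive1_out f 0 r) => [y|]; rewrite subr0//; exact: h.
Qed.

Lemma test1_deriven k f : test1 f -> test1 (derive1n k f).
Proof. by move=> h; elim: k => [//|k IH]; rewrite derive1nS; exact: test1_derive. Qed.

Lemma test1_continuous f : test1 f -> continuous f.
Proof. by move=> [/smooth1_continuous]. Qed.

Lemma test1_bnd f : test1 f -> exists2 M, 0 <= M & forall x, `|f x| <= M.
Proof.
move=> hf; have cf := test1_continuous hf; case: hf => sf [r h].
have cpt : compact (f @` `[- r, r]%classic).
  by apply: continuous_compact; [exact: continuous_subspaceT|exact: segment_compact].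
have [M [Mr hM]] := compact_bounded cpt.
exists (Num.max 0 (M + 1)); first by rewrite le_max lexx.
move=> x; case: (ltP r `|x|) => rx; first by rewrite h// normr0 le_max lexx.
rewrite le_max; apply/orP; right; apply: (hM (M + 1)); first by rewrite ltrDl.
by exists x => //; rewrite /= in_itv /= -ler_norml.
Qed.

Lemma test1_mc1 f : test1 f -> mc1 f.
Proof.
move=> hf; have [M M0 fM] := test1_bnd hf; have cf := test1_continuous hf; case: hf => sf [r h].
split; first exact: continuous_measurable_fun.
by exists M, r => x; split => // /h.
Qed.

Lemma test1D f g : test1 f -> test1 g -> test1 (fun x => f x + g x).
Proof.
move=> [sf [r h]] [sg [r' h']]; split; first exact: smooth1D.
by exists (Num.max r r') => x; rewrite gt_max => /andP[/h -> /h' ->]; rewrite addr0.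
Qed.

Lemma test1Z f c : test1 f -> test1 (fun x => c * f x).
Proof. by move=> [sf [r h]]; split; [exact: smooth1Z|exists r => x /h ->; rewrite mulr0]. Qed.

Lemma test1B f g : test1 f -> test1 g -> test1 (fun x => f x - g x).
Proof.
move=> hf hg; have := test1D hf (test1Z (-1) hg).
by under eq_fun do rewrite mulN1r.
Qed.

Lemma test1M f g : test1 f -> test1 g -> test1 (fun x => f x * g x).
Proof.
move=> [sf [r h]] [sg _]; split; first exact: smooth1M.
by exists r => x /h ->; rewrite mul0r.
Qed.

Lemma test1_affine f a b c : a != 0 -> test1 f -> test1 (fun x => c * f (a * x + b)).
Proof.
move=> a0 [sf [r h]]; split; first exact: smooth1_affine.
exists ((r + `|b|) / `|a|) => x; rewrite ltr_pdivrMr ?normr_gt0// => hx; rewrite h ?mulr0//.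
have := ler_normB (a * x + b) b; rewrite addrK normrM mulrC; lra.
Qed.

Lemma test1_dil k f : test1 f -> test1 (dil k f).
Proof. by move=> hf; have := test1_affine 0 (2 ^+ k) (pow2_neq0 k) hf;
  under eq_fun do rewrite addr0. Qed.

Lemma lipschitz_derive f M : smooth1 f -> (forall x, `|f^`()%classic x| <= M) ->
  forall x y, `|f y - f x| <= M * `|y - x|.
Proof.
move=> sf fM x y; wlog xy : x y / x <= y => [hw|].
  by case: (leP x y) => [/hw//|/ltW/hw]; rewrite distrC (distrC x y).
have [|c _ ->] := MVT_segment xy (fun z _ => smooth1_is_derive z sf).
  by apply: continuous_subspaceT; exact: smooth1_continuous.
by rewrite normrM ler_wpM2r.
Qed.

(** Differentiation under the integral sign, dominated by M |g(y)| with M a bound for f'. All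
    regularity falls on [f], so [g] may be discontinuous. *)
Lemma conv_is_derive f g (x : R) : test1 f -> mc1 g -> is_derive x 1 (convol f g)
  (convol f^`()%classic g x).
Proof.
move=> hf hg; have hf' := test1_derive hf; have [M M0 fM] := test1_bnd hf'.
pose F (a y : R) := f (a - y) * g y.
have dF (a y : R) : is_derive a 1 (F ^~ y) (f^`()%classic (a - y) * g y).
  have := is_derive_affine 1 (- y) (g y) (fun z => smooth1_is_derive z hf.1) a.
  under eq_fun do rewrite mul1r mulrC.
  by move=> h; apply: (is_derive_eq h); rewrite mul1r mulr1 mulrC.
have xI : `](x - 1), (x + 1)[%classic x by rewrite /= in_itv /=; apply/andP; split; lra.
have iF a : `](x - 1), (x + 1)[%classic a -> (@lebesgue_measure R).-integrable setT (EFin \o F a).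
  by move=> _; apply: (mcs_integrable gauge1); apply: conv_int => //; exact: test1_mc1.
have derF a y : `](x - 1), (x + 1)[%classic a -> setT y -> derivable (F ^~ y) a 1.
  by move=> _ _; have [] := dF a y.
have G0 y : 0 <= M * `|g y| by rewrite mulr_ge0.
have iG : (@lebesgue_measure R).-integrable setT (EFin \o (fun y => M * `|g y|)).
  by apply: (mcs_integrable gauge1); apply: mcsZ; exact: mcs_abs.
have ub a y : `](x - 1), (x + 1)[%classic a -> setT y -> `|partial1of2 F a y| <= M * `|g y|.
  move=> _ _; rewrite /partial1of2 (is_derive_derive1 (dF ^~ y)) normrM.
  by apply: ler_wpM2r.
have E y : partial1of2 F x y = f^`()%classic (x - y) * g y.
  by rewrite /partial1of2 (is_derive_derive1 (dF ^~ y)).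
split.
  by have := derivable_under_integral measurableT xI iF derF G0 iG ub.
have := differentiation_under_integral measurableT xI iF derF G0 iG ub.
rewrite derive1E => ->; rewrite /convol /I1.
by apply: eq_Rintegral => y _; exact: E.
Qed.

Lemma derive1_conv f g : test1 f -> mc1 g -> (convol f g)^`()%classic = convol f^`()%classic g.
Proof. by move=> hf hg; apply: is_derive_derive1 => x; exact: conv_is_derive. Qed.

Lemma derive1n_conv n f g : test1 f -> mc1 g -> derive1n n (convol f g) = convol (derive1n n f) g.
Proof.
by move=> hf hg; elim: n => [//|n IH]; rewrite !derive1nS IH derive1_conv//; exact: test1_deriven.
Qed.

Lemma test1_conv f g : test1 f -> mc1 g -> test1 (convol f g).
Proof.
move=> hf hg; split.
  move=> n x; rewrite derive1n_conv//; have := conv_is_derive x (test1_deriven n hf) hg; case => //.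
have [_ [M [r h]]] := mc1_convolution (test1_mc1 hf) hg.
by exists r => x rx; have [_ ->] := h x.
Qed.

Lemma conv_derive f g : test1 f -> test1 g -> convol f^`()%classic g = convol f g^`()%classic.
Proof.
move=> hf hg; have mf := test1_mc1 hf; have mg := test1_mc1 hg.
rewrite -(derive1_conv hf mg) (convC mf mg) (derive1_conv hg mf).
by rewrite convC//; apply: test1_mc1; exact: test1_derive.
Qed.

Lemma conv_deriven n f g : test1 f -> test1 g -> convol (derive1n n f) g = convol f (derive1n n g).
Proof.
move=> hf; elim: n g => [|n IH] g hg; first by [].
rewrite derive1nS (conv_derive (test1_deriven n hf) hg) IH; first by rewrite derive1Sn.
exact: test1_derive.
Qed.

(** The primitive taken from minus infinity is 0 to the left of the support and equals the total
    integral to the right of it, so mean zero is what makes it compactly supported. This undoes one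
    derivative in the reproducing formula, and again in the lower bound. *)
Lemma test1_antiderivative w : test1 w -> I1 w = 0 -> exists2 W, test1 W & W^`()%classic = w.
Proof.
move=> hw iw; have cw := test1_continuous hw; have hm := test1_mc1 hw.
have iW : (@lebesgue_measure R).-integrable setT (EFin \o w) := mcs_integrable gauge1 hm.
pose W x := \int[lebesgue_measure]_(t in `]-oo, x]%classic) w t.
have D (x : R) : is_derive x 1 W (w x).
  have x1 : x < x + 1 by rewrite ltrDl.
  have iW' : (@lebesgue_measure R).-integrable [set` Interval -oo%O (BRight (x + 1))] (EFin \o w).
    by apply: (integrableS _ _ _ iW).
  have := @continuous_FTC1 R w -oo%O x (x + 1) x1 iW'; case;
    [by rewrite ltNyr|exact: cw|move=> d1 d2].
  by split; [exact: d1|rewrite -derive1E; exact: d2].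
have dW := is_derive_derive1 D.
exists W => //; split.
  by case=> [|n] x; [have [] := D x|rewrite derive1Sn dW; exact: hw.1].
case: (hw) => _ [r h]; exists r => x rx; rewrite /W.
have [x0|x0] := ltP x 0.
  rewrite (@eq_Rintegral _ _ _ _ _ (fun=> 0)) ?Rintegral0//.
    by rewrite Rintegral_cst// mul0r.
  move=> t; rewrite inE /= in_itv /= => tx; rewrite h//.
  by rewrite ltr0_norm in rx => //; rewrite ltr0_norm; lra.
rewrite -iw /I1 Rintegral_mkcond; apply: eq_Rintegral => t _; rewrite patchE.
case: ifPn => // /negP; rewrite inE /= in_itv /= => /negP; rewrite -ltNge => xt.
rewrite ger0_norm in rx => //; rewrite h// ger0_norm; lra.
Qed.

End smooth.

(** * A reproducing formula *)

Section reproducing.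
Context {R : realType}.
Implicit Types (f g h A B : R -> R).

(** The polynomial Q(t) = 3t^2 - 2t^3 evaluated with convolution as product. Q(0) = 0 leaves a
    factor f to split off, Q(1) = 1 keeps the integral 1, and Q'(1) = 0 gives the difference
    quotient mean zero. *)
Let cubic f := fun x => 3 * convol f f x - 2 * convol (convol f f) f x.

Let test1_cc f g : test1 f -> test1 g -> test1 (convol f g).
Proof. by move=> hf hg; apply: test1_conv => //; exact: test1_mc1. Qed.

Let test1_cubic f : test1 f -> test1 (cubic f).
Proof. by move=> hf; exact: (test1B (test1Z 3 (test1_cc hf hf))
  (test1Z 2 (test1_cc (test1_cc hf hf) hf))). Qed.

Let quot A B := fun x => 3 * A x + 3 * B x - (2 * convol A A x + 2 * convol A B x +
  2 * convol B B x).

Let test1_quot A B : test1 A -> test1 B -> test1 (quot A B).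
Proof.
move=> hA hB; exact: (test1B (test1D (test1Z 3 hA) (test1Z 3 hB))
  (test1D (test1D (test1Z 2 (test1_cc hA hA)) (test1Z 2 (test1_cc hA hB)))
    (test1Z 2 (test1_cc hB hB)))).
Qed.

Let conv_quot A B h : mc1 A -> mc1 B -> mc1 h -> convol (quot A B) h =
  fun x => 3 * convol A h x + 3 * convol B h x - (2 * convol (convol A A) h x +
    2 * convol (convol A B) h x + 2 * convol (convol B B) h x).
Proof.
move=> hA hB hh.
have hAA := mc1_convolution hA hA; have hAB := mc1_convolution hA hB;
  have hBB := mc1_convolution hB hB.
rewrite /quot (convBl (mcsD (mcsZ 3 hA) (mcsZ 3 hB)) (mcsD (mcsD (mcsZ 2 hAA) (mcsZ 2 hAB))
  (mcsZ 2 hBB)) hh).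
have E1 := convDl (mcsZ 3 hA) (mcsZ 3 hB) hh.
have E2 := convDl (mcsD (mcsZ 2 hAA) (mcsZ 2 hAB)) (mcsZ 2 hBB) hh.
have E3 := convDl (mcsZ 2 hAA) (mcsZ 2 hAB) hh.
rewrite E1 E2 E3.
have Z1 := convZl 3 hA hh; have Z2 := convZl 3 hB hh; have Z3 := convZl 2 hAA hh.
have Z4 := convZl 2 hAB hh; have Z5 := convZl 2 hBB hh.
by rewrite Z1 Z2 Z3 Z4 Z5.
Qed.

(* [Q(a) - Q(b) = (a - b)(3a + 3b - 2a^2 - 2ab - 2b^2)] for [Q(t) = 3t^2 - 2t^3] *)
Let cubic_diff A B : mc1 A -> mc1 B ->
  convol (quot A B) (fun x => A x - B x) = fun x => cubic A x - cubic B x.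
Proof.
move=> hA hB.
have hAA := mc1_convolution hA hA; have hAB := mc1_convolution hA hB;
  have hBB := mc1_convolution hB hB.
rewrite (convBr hA hB (mcsB (mcsD (mcsZ 3 hA) (mcsZ 3 hB)) (mcsD (mcsD (mcsZ 2 hAA) (mcsZ 2 hAB))
  (mcsZ 2 hBB)))).
rewrite (conv_quot hA hB hA) (conv_quot hA hB hB); apply/funext => x; rewrite /cubic.
have -> : convol (convol A B) A = convol (convol A A) B by rewrite (convA hA hB hA) (convC hB hA)
  (convA hA hA hB).
have -> : convol (convol B B) A = convol (convol A B) B by rewrite (convC hBB hA) (convA hA hB hB).
by rewrite (convC hB hA); ring.
Qed.

(** Integration is multiplicative on convolutions, so the value is the difference quotient of Q at
    (1, 1), that is 3 + 3 - 2 - 2 - 2 = Q'(1). *)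
Let I1_quot A B : mc1 A -> mc1 B -> I1 A = 1 -> I1 B = 1 -> I1 (quot A B) = 0.
Proof.
move=> hA hB iA iB.
have hAA := mc1_convolution hA hA; have hAB := mc1_convolution hA hB;
  have hBB := mc1_convolution hB hB.
have E1 := I1B (mcsD (mcsZ 3 hA) (mcsZ 3 hB)) (mcsD (mcsD (mcsZ 2 hAA) (mcsZ 2 hAB)) (mcsZ 2 hBB)).
have E2 := I1D (mcsZ 3 hA) (mcsZ 3 hB).
have E3 := I1D (mcsD (mcsZ 2 hAA) (mcsZ 2 hAB)) (mcsZ 2 hBB).
have E4 := I1D (mcsZ 2 hAA) (mcsZ 2 hAB).
rewrite /quot E1 E2 E3 E4 (I1Z _ hA) (I1Z _ hB) (I1Z _ hAA) (I1Z _ hAB) (I1Z _ hBB).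
rewrite (I1_conv hA hA) (I1_conv hA hB) (I1_conv hB hB) iA iB; ring.
Qed.

Let dil_cubic k f : mc1 f -> dil k (cubic f) = cubic (dil k f).
Proof.
move=> hf; have hff := mc1_convolution hf hf.
rewrite /cubic -(dil_conv k hf hf) -(dil_conv k hff hf); apply/funext => x; rewrite /dil; ring.
Qed.

(** Induction on L. The base case is a^2 - b^2 = (a + b)(a - b) with a = [dil 1 phi] and b = [phi].
    In the step q is replaced by Q(q): the quotient [quot (dil 1 q) q] has mean zero, so it is W'
    for some W of compact support, and this derivative passes through the convolution onto the
    factor that already carries L of them. *)
Lemma reproducing_formula (phi : R -> R) (L : nat) : test1 phi -> I1 phi = 1 ->
  exists lam0 lam q : R -> R, [/\ test1 lam0, test1 lam, test1 q, I1 q = 1 &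
    convol lam0 phi = q /\
    convol lam (derive1n L (fun x => dil 1 phi x - phi x)) = (fun x => dil 1 q x - q x)].
Proof.
move=> hphi iphi; have mphi := test1_mc1 hphi.
elim: L => [|L [lam0 [lam [q [h0 h1 hq iq [e0 e1]]]]]].
  have hd := test1_dil 1 hphi; have md := test1_mc1 hd.
  exists phi, (fun x => dil 1 phi x + phi x), (convol phi phi); split.
  - by [].
  - exact: (test1D hd hphi).
  - exact: (test1_cc hphi hphi).
  - by rewrite I1_conv// iphi mulr1.
  split; first by [].
  rewrite derive1n0 (dil_conv 1 mphi mphi) (convDl md mphi (mcsB md mphi)) (convBr md mphi md)
    (convBr md mphi mphi).
  by apply/funext => x; rewrite (convC mphi md); ring.
have hd := test1_dil 1 hq; have md := test1_mc1 hd; have mq := test1_mc1 hq.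
have hw := test1_quot hd hq; have iw : I1 (quot (dil 1 q) q) = 0 by rewrite I1_quot ?I1_dil.
have [W hW dW] := test1_antiderivative hw iw; have mW := test1_mc1 hW.
have m0 := test1_mc1 h0; have m1 := test1_mc1 h1; have mqq := mc1_convolution mq mq.
have hD : test1 (derive1n L (fun x => dil 1 phi x - phi x)).
  by apply: test1_deriven; apply: test1B => //; exact: test1_dil.
(* The factor 3q - 2q^2 is Q(q)/q, so it turns the product of [lam0] and [phi], which is q, into
   Q(q). *)
exists (convol lam0 (fun x => 3 * q x - 2 * convol q q x)), (convol W lam), (cubic q); split.
- exact: (test1_cc h0 (test1B (test1Z 3 hq) (test1Z 2 (test1_cc hq hq)))).
- exact: (test1_cc hW h1).
- exact: (test1_cubic hq).
- by rewrite /cubic (I1B (mcsZ 3 mqq) (mcsZ 2 (mc1_convolution mqq mq))) (I1Z _ mqq)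
  (I1Z _ (mc1_convolution mqq mq)) (I1_conv mqq mq) (I1_conv mq mq) iq; ring.
split.
  have m3 : mc1 (fun x => 3 * q x - 2 * convol q q x) := mcsB (mcsZ 3 mq) (mcsZ 2 mqq).
  rewrite (convC m0 m3) (convA m3 m0 mphi) e0 (convBl (mcsZ 3 mq) (mcsZ 2 mqq) mq).
  by rewrite (convZl 3 mq mq) (convZl 2 mqq mq).
have mD := test1_mc1 hD; have mD' := test1_mc1 (test1_derive hD); have hB := test1B hd hq.
rewrite derive1nS (convA mW m1 mD') -(conv_derive h1 hD) -(derive1_conv h1 mD) e1.
by rewrite -(conv_derive hW hB) dW (cubic_diff md mq) (dil_cubic 1 mq).
Qed.

End reproducing.

(** * Sums over the lattice *)

Section lattice.
Context {R : realType}.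
Variables (N g : nat).
Hypothesis N0 : (0 < N)%N.
Implicit Types (F G : R * R -> R) (z : int * int) (u v w : R * R).

Let N0R : 0 < N%:R :> R. Proof. by rewrite ltr0n. Qed.

Definition lattice_pt z : R * R := (z.1%:~R / N%:R, z.1%:~R * g%:R / N%:R + z.2%:~R).

(* The points [lattice_pt z] form the lattice Z(1, g)/N + Z^2; over a function supported
   in the unit square this is the mean over the cubature points. *)
Definition lsum F : R := N%:R^-1 * \sum_(z \in [set: int * int]) F (lattice_pt z).

Definition irange (K : nat) : seq int := [seq n%:Z - K%:Z | n <- iota 0 (K + K).+1].

Lemma irange_uniq K : uniq (irange K).
Proof. by rewrite map_inj_uniq ?iota_uniq// => a b /addIr []. Qed.

Lemma mem_irange K (i : int) : `|i%:~R| <= K%:R :> R -> i \in irange K.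
Proof.
move=> h; have {h} : (`|i| <= K%:Z)%R by rewrite -(ler_int R) intr_norm.
rewrite ler_norml => /andP[h1 h2].
apply/mapP; exists (absz (i + K%:Z)); last by lia.
by rewrite mem_iota /=; lia.
Qed.

Lemma sum_irange_telescope K (phi : R -> R) :
  \sum_(i <- irange K) (phi i%:~R - phi (i%:~R + 1)) = phi (- K%:R) - phi (K%:R + 1).
Proof.
rewrite big_map.
have : forall n, \sum_(i <- iota 0 n) (phi ((i%:Z - K%:Z)%:~R) - phi ((i%:Z - K%:Z)%:~R + 1)) =
    phi (- K%:R) - phi (n%:R - K%:R).
  elim=> [|n IH]; first by rewrite big_nil sub0r subrr.
  rewrite -addn1 iotaD big_cat IH /= big_cons big_nil add0n addr0.
  rewrite intrB /= natrD.
  have -> : n%:R - K%:R + 1 = n%:R + 1 - K%:R :> R by ring.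
  by ring.
move=> ->; congr (_ - phi _); rewrite -addn1 !natrD; ring.
Qed.

Definition bsupp (r : R) F := forall x, r < nm2 x -> F x = 0.

Lemma nm2_gt x (r : R) : (r < nm2 x) = (r < `|x.1|) || (r < `|x.2|).
Proof. by rewrite /nm2 /pgauge lt_max. Qed.

Lemma nm2_le x (r : R) : (nm2 x <= r) = (`|x.1| <= r) && (`|x.2| <= r).
Proof. by rewrite /nm2 /pgauge ge_max. Qed.

(** A lattice point of size at most r has |i| <= rN by its first coordinate, and then |j| <= r + |i|
    g/N by its second. This fixes the two index ranges. *)
Lemma lsum_irange r F (K1 K2 : nat) : bsupp r F -> r * N%:R <= K1%:R -> r +
  K1%:R * g%:R / N%:R <= K2%:R ->
  lsum F = N%:R^-1 * \sum_(i <- irange K1) \sum_(j <- irange K2) F (lattice_pt (i, j)).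
Proof.
move=> hF h1 h2; congr (_ * _).
have <- : \sum_(z <- [seq (i, j) | i <- irange K1, j <- irange K2]) F (lattice_pt z) =
  \sum_(i <- irange K1) \sum_(j <- irange K2) F (lattice_pt (i, j)) by rewrite big_allpairs.
rewrite (@fsbigE _ _ _ _ _ [seq (i, j) | i <- irange K1, j <- irange K2]) //.
- by apply: eq_bigl => z; rewrite in_setT.
- by apply: allpairs_uniq; [exact: irange_uniq|exact: irange_uniq|move=> [a b] [c d]].
move=> [i j] _ /negP hij; apply: hF; rewrite ltNge; apply/negP; rewrite nm2_le => /andP[hi hj];
  apply: hij.
rewrite /lattice_pt /= in hi hj.
have hi' : `|i%:~R| <= K1%:R :> R.
  apply: le_trans h1; rewrite -ler_pdivrMr//; move: hi.
  by rewrite normrM normfV (ger0_norm (ltW N0R)).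
have hj' : `|j%:~R| <= K2%:R :> R.
  apply: le_trans h2.
  have -> : j%:~R = (i%:~R * g%:R / N%:R + j%:~R) - i%:~R * g%:R / N%:R :> R by ring.
  apply: le_trans (ler_normB _ _) _; apply: lerD => //.
  rewrite -!mulrA normrM ler_pM// ger0_norm// divr_ge0//; exact: ltW.
have mi := mem_irange hi'; have mj := mem_irange hj'.
by apply: (allpairs_f (fun i j => (i, j)) mi mj).
Qed.

(** The list depends on the radius alone. Functions with a common radius are thus summed over one
    finite list, which reduces linearity, monotonicity and exchange with integrals to finite
    sums. *)
Lemma lsum_seq r : exists s : seq (int * int), forall F, bsupp r F ->
  lsum F = N%:R^-1 * \sum_(z <- s) F (lattice_pt z).
Proof.
have [K1 hK1] : exists K : nat, r * N%:R <= K%:R by exists (Num.trunc (r * N%:R)).+1;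
  exact/ltW/truncnS_gt.
have [K2 hK2] : exists K : nat, r + K1%:R * g%:R / N%:R <= K%:R.
  by exists (Num.trunc (r + K1%:R * g%:R / N%:R)).+1; exact/ltW/truncnS_gt.
exists [seq (i, j) | i <- irange K1, j <- irange K2] => F hF.
by rewrite (lsum_irange hF hK1 hK2) big_allpairs.
Qed.

Lemma bsuppW r r' F : r <= r' -> bsupp r F -> bsupp r' F.
Proof. by move=> rr hF x h; apply: hF; exact: le_lt_trans h. Qed.

Lemma bsupp2 r r' F G : bsupp r F -> bsupp r' G -> bsupp (Num.max r r') F /\ bsupp (Num.max r r') G.
Proof. by move=> h1 h2; split; [apply: bsuppW h1|apply: bsuppW h2]; rewrite le_max lexx ?orbT. Qed.

Lemma bsupp_shift r F w : bsupp r F -> bsupp (r + nm2 w) (fun x => F (x + w)).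
Proof.
move=> hF x; rewrite nm2_gt => h; apply: hF; rewrite nm2_gt /=.
have w1 : `|w.1| <= nm2 w by rewrite /nm2 /pgauge le_max lexx.
have w2 : `|w.2| <= nm2 w by rewrite /nm2 /pgauge le_max lexx orbT.
have := ler_normB (x.1 + w.1) w.1; have := ler_normB (x.2 + w.2) w.2; rewrite !addrK => h1 h2.
by case/orP: h => h; apply/orP; [left|right]; lra.
Qed.

Lemma mc2_bsupp F : mc2 F -> exists2 r, 0 <= r & bsupp r F.
Proof.
move=> [_ [M [r h]]]; exists (Num.max 0 r); first by rewrite le_max lexx.
by apply: (@bsuppW r); [rewrite le_max lexx orbT|move=> x hx; have [_ ->] := h x].
Qed.

Lemma lsumB F G r r' : bsupp r F -> bsupp r' G -> lsum (fun x => F x - G x) = lsum F - lsum G.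
Proof.
move=> /bsupp2 h /h [hF hG]; have [s hs] := lsum_seq (Num.max r r').
rewrite (hs F)// (hs G)// hs -?mulrBr ?sumrB//.
by move=> x hx; rewrite hF// hG// subr0.
Qed.

Lemma le_lsum F G r r' : bsupp r F -> bsupp r' G -> (forall x, F x <= G x) -> lsum F <= lsum G.
Proof.
move=> /bsupp2 h /h [hF hG] FG; have [s hs] := lsum_seq (Num.max r r').
by rewrite (hs F)// (hs G)// ler_wpM2l// ?invr_ge0//; apply: ler_sum.
Qed.

Lemma norm_lsum F r : bsupp r F -> `|lsum F| <= lsum (fun x => `|F x|).
Proof.
move=> hF; have [s hs] := lsum_seq r; rewrite (hs F)// hs; last by move=> x /hF ->; rewrite normr0.
by rewrite normrM gtr0_norm ?invr_gt0// ler_wpM2l ?invr_ge0//; exact: ler_norm_sum.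
Qed.

Lemma lsum_ext F G : F =1 G -> lsum F = lsum G.
Proof. by move=> /funext ->. Qed.

Lemma lsumZ F c r : bsupp r F -> lsum (fun x => c * F x) = c * lsum F.
Proof.
move=> hF; have [s hs] := lsum_seq r; rewrite (hs F)// hs; last by move=> x /hF ->; rewrite mulr0.
by rewrite -mulr_sumr mulrCA.
Qed.

Lemma lpt_add z z' : lattice_pt (z + z') = lattice_pt z + lattice_pt z'.
Proof.
apply: injective_projections => /=; rewrite !intrD; first by rewrite mulrDl.
by rewrite !mulrDl addrACA.
Qed.

Lemma lsum_shift F z : lsum (fun x => F (x + lattice_pt z)) = lsum F.
Proof.
rewrite /lsum; congr (_ * _); rewrite [RHS](reindex_fsbigT (fun z' => z' + z)).
  by apply: eq_fsbigr => z' _; rewrite lpt_add.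
by exists (fun z' => z' - z) => z'; rewrite ?addrK ?subrK.
Qed.

Definition lvec u := exists z, u = lattice_pt z.

Lemma lvecD u v : lvec u -> lvec v -> lvec (u + v).
Proof. by move=> [z ->] [z' ->]; exists (z + z'); rewrite lpt_add. Qed.

End lattice.

(** * Averages along a segment *)

Section averaging.
Context {R : realType}.
Implicit Types (F G : R * R -> R) (u v w : R * R) (ka : R -> R).
Local Notation RT := (measurableTypeR R).
Local Notation PT := (RT * RT)%type.

Definition lin (t : R) u : R * R := (t * u.1, t * u.2).

Definition line_int ka u G (x : R * R) := I1 (fun t => ka t * G (x + lin t u)).

Lemma nm2D u v : nm2 (u + v) <= nm2 u + nm2 v.
Proof.
have h1 : `|u.1| <= nm2 u by rewrite /nm2 /pgauge le_max lexx.
have h2 : `|u.2| <= nm2 u by rewrite /nm2 /pgauge le_max lexx orbT.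
have h3 : `|v.1| <= nm2 v by rewrite /nm2 /pgauge le_max lexx.
have h4 : `|v.2| <= nm2 v by rewrite /nm2 /pgauge le_max lexx orbT.
rewrite nm2_le /=; apply/andP; split; apply: le_trans (ler_normD _ _) _; exact: lerD.
Qed.

Lemma nm2_ge0 u : 0 <= nm2 u.
Proof. by rewrite /nm2 /pgauge le_max normr_ge0. Qed.

Lemma nm2N u : nm2 (- u) = nm2 u.
Proof. by rewrite /nm2 /pgauge /nm1 /= !normrN. Qed.

Lemma nm2_lin t u : nm2 (lin t u) = `|t| * nm2 u.
Proof. by rewrite /nm2 /pgauge /nm1 /= !normrM maxr_pMr. Qed.

Let mc3 ka u G : mc1 ka -> mc2 G -> mcs (pgauge nm2 nm1)
  (fun z : PT * RT => ka z.2 * G (z.1 + lin z.2 u)).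
Proof.
move=> [mk [M [r hk]]] [mG [M' [r' hG]]]; split.
  apply: measurable_funM; first exact: measurableT_comp.
  apply: (measurableT_comp mG); apply: measurable_fun_pair => /=; apply: measurable_funD.
  - by apply: measurableT_comp => //; exact: measurable_fst.
  - by apply: measurable_funM => //; exact: measurable_snd.
  - by apply: measurableT_comp => //; exact: measurable_fst.
  - by apply: measurable_funM => //; exact: measurable_snd.
exists (M * M'), (`|r'| + `|r| * (1 + nm2 u)) => -[x t] /=.
have [k1 k2] := hk t; have [g1 g2] := hG (x + lin t u); split; first by rewrite normrM ler_pM.
move=> h; case: (ltP r (nm1 t)) => ht; first by rewrite k2// mul0r.
rewrite g2 ?mulr0//; move: ht; rewrite /nm1 => ht.
have hr : `|t| <= `|r| by apply: le_trans (ler_norm _).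
have := nm2D (x + lin t u) (- lin t u); rewrite addrK nm2N nm2_lin => h3.
have n0 := nm2_ge0 u.
have h4 : `|t| * nm2 u <= `|r| * nm2 u by rewrite ler_wpM2r.
have h5 := ler_norm r'; have h6 := normr_ge0 r; have h7 := normr_ge0 r'.
have h8 : 0 <= `|r| * nm2 u by rewrite mulr_ge0.
move: h; rewrite mulrDr mulr1 {1}/pgauge lt_max /= /nm1 => /orP[h|h]; lra.
Qed.

Lemma mc2_line_int ka u G : mc1 ka -> mc2 G -> mc2 (line_int ka u G).
Proof.
move=> hk hG; exact: (@mcs_partial_int _ _ PT RT R nm2 nm1 plane_measure lebesgue_measure gauge2
  gauge1 _ (mc3 u hk hG)).
Qed.

Lemma mc1_line ka u G x : mc1 ka -> mc2 G -> mc1 (fun t => ka t * G (x + lin t u)).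
Proof. move=> hk hG; exact: (mcs_xsec (mc3 u hk hG) x). Qed.

Lemma line_intC ka kb u v G : mc1 ka -> mc1 kb -> mc2 G ->
  line_int ka u (line_int kb v G) = line_int kb v (line_int ka u G).
Proof.
move=> hk hb hG; apply/funext => x; rewrite /line_int.
pose H (z : RT * RT) := ka z.1 * (kb z.2 * G (x + lin z.1 u + lin z.2 v)).
have hH : mc2 H.
  have [mt [Mt [rt ht]]] := mc2_tens hk hb; have [mG [M [r hM]]] := hG; split.
    apply: measurable_funM; first exact: (mf_fst (mc1_meas hk)).
    apply: measurable_funM; first exact: (mf_snd (mc1_meas hb)).
    apply: (measurableT_comp mG); apply: measurable_fun_pair => /=.
      by apply: measurable_funD; [apply: measurable_funD => //|]; exact: measurable_funM.
    by apply: measurable_funD; [apply: measurable_funD => //|]; exact: measurable_funM.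
  exists (Mt * M), rt => z; rewrite /H mulrA; have [t1 t2] := ht z;
    have [G1 _] := hM (x + lin z.1 u + lin z.2 v).
  split; first by rewrite normrM ler_pM.
  by move=> /t2; rewrite /tens => ->; rewrite mul0r.
transitivity (I1 (fun t => I1 (fun s => H (t, s)))).
  by apply: I1_ext => t; rewrite -I1Z//; exact: mc1_line.
rewrite (I1_swap hH); apply: I1_ext => s; rewrite -I1Z; last exact: mc1_line.
apply: I1_ext => t; rewrite /H /= mulrCA addrAC//.
Qed.

Lemma linD s t u : lin (s + t) u = lin s u + lin t u.
Proof. by apply: injective_projections => /=; rewrite mulrDl. Qed.

Lemma line_int_shift ka u G c : mc1 ka -> mc2 G ->
  line_int ka u (fun x => G (x + lin c u)) = line_int (fun t => ka (t - c)) u G.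
Proof.
move=> hk hG; apply/funext => x; rewrite /line_int.
rewrite -(I1_shift c (mc1_line u x (mc1_shift (- c) hk) hG)); apply: I1_ext => t.
by rewrite addrK linD addrA.
Qed.

Lemma line_int_translate ka u G w x : line_int ka u G (x + w) = line_int ka u
  (fun y => G (y + w)) x.
Proof. by apply: I1_ext => t; rewrite addrAC. Qed.

Lemma line_intB ka kb u G x : mc1 ka -> mc1 kb -> mc2 G ->
  line_int (fun t => ka t - kb t) u G x = line_int ka u G x - line_int kb u G x.
Proof.
move=> hk hb hG; rewrite /line_int -I1B; try exact: mc1_line.
by apply: I1_ext => t; rewrite mulrBl.
Qed.

Definition heaviside (t : R) : R := if 0 <= t then 1 else 0.
(** The indicator of [0, 1[, written as a difference of steps so that sums over integer translates
    telescope. The half-open convention makes these translates partition the line at every point,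
    not just almost everywhere. *)
Definition unit_ind (t : R) : R := heaviside t - heaviside (t - 1).

Lemma mc1_heaviside c d : mc1 (fun t => heaviside (t - c) - heaviside (t - d)).
Proof.
wlog cd : c d / c <= d => [hw|].
  case: (leP c d) => [/hw//|/ltW/hw/mcsN].
  by rewrite (_ : (fun x => _) = (fun t => heaviside (t - c) - heaviside (t - d)))//;
    apply/funext => x; rewrite opprB.
have -> : (fun t => heaviside (t - c) - heaviside (t - d)) = \1_`[c, d[%classic.
  apply/funext => t; rewrite indicE /heaviside !subr_ge0; case: (boolP (t \in _)) => h.
    by move: h; rewrite inE /= in_itv /= => /andP[-> h]; rewrite leNgt h subr0.
  case: ifP => h1; case: ifP => h2; rewrite ?subrr//.
    by move/negP: h; case; rewrite inE /= in_itv /= h1 ltNge h2.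
  by move: h1; rewrite (le_trans cd h2).
apply: (@mcs_indic _ RT R nm1 _ (`|c| + `|d|)) => // x;
  rewrite /= in_itv /= /nm1 ler_norml => /andP[h1 h2].
have := ler_norm (- c); have := ler_norm d; rewrite normrN => h3 h4.
have := normr_ge0 c; have := normr_ge0 d => h5 h6; lra.
Qed.

Lemma mc1_unit_ind : mc1 unit_ind.
Proof. by have := mc1_heaviside 0 1; under eq_fun do rewrite subr0. Qed.

Lemma unit_ind_out t : t < 0 \/ 1 <= t -> unit_ind t = 0.
Proof.
rewrite /unit_ind /heaviside subr_ge0 => -[h|h]; last by rewrite h (le_trans _ h)// subrr.
by rewrite leNgt h /= leNgt (lt_trans h)// subrr.
Qed.

Lemma unit_ind_in t : 0 <= t < 1 -> unit_ind t = 1.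
Proof. by rewrite /unit_ind /heaviside subr_ge0 => /andP[-> h]; rewrite leNgt h subr0. Qed.

Lemma unit_ind_ge0 t : 0 <= unit_ind t.
Proof.
have [h|h] := ltP t 0; first by rewrite unit_ind_out//; left.
by have [h'|h'] := ltP t 1; [rewrite unit_ind_in ?h|rewrite unit_ind_out//; right].
Qed.

Lemma unit_ind_sum K (s : R) : - K%:R <= s < K%:R + 1 ->
  \sum_(i <- irange K) unit_ind (s - i%:~R) = 1.
Proof.
move=> /andP[h1 h2]; rewrite /unit_ind.
have := sum_irange_telescope K (fun x => heaviside (s - x)) => E.
rewrite (eq_bigr (fun i : int => heaviside (s - i%:~R) - heaviside (s - (i%:~R + 1)))); last first.
  by move=> i _; rewrite opprD addrA.
rewrite E /heaviside !subr_ge0 h1 leNgt h2 subr0//.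
Qed.

Lemma I1_unit_ind : I1 unit_ind = 1.
Proof.
have -> : unit_ind = \1_`[0, 1[%classic.
  apply/funext => t; rewrite indicE; case: (boolP (t \in _)) => h.
    by rewrite unit_ind_in//; move: h; rewrite inE /= in_itv.
  rewrite unit_ind_out//; case: (ltP t 0) => h1; [by left|right]; rewrite leNgt;
    apply: contra h => h.
  by rewrite inE /= in_itv /= h1.
transitivity (fine (lebesgue_measure (`[0 : R, 1[%classic : set RT))).
  exact: (@int_indic _ RT R lebesgue_measure).
by rewrite lebesgue_measure_itv /= lte_fin ltr01 oppr0 adde0.
Qed.

Definition avg u G := line_int unit_ind u G.

End averaging.

(** * Bases of the lattice and exactness of averaged sums *)

Section tiling.
Context {R : realType}.
Variables (N g : nat).
Hypothesis N0 : (0 < N)%N.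
Implicit Types (F G : R * R -> R) (u v w : R * R) (f ka : R -> R).
Local Notation S := (lsum N g).

(* Holds when (u, v) is a basis of the lattice: the translates of its
   parallelogram then tile the plane. *)
Definition tiling u v := forall F, mc2 F -> S (avg u (avg v F)) = I2 F.

Lemma bsupp_line ka w r r' G : (forall t, r' < `|t| -> ka t = 0) -> bsupp r G ->
  forall t, ka t != 0 -> bsupp (r + `|r'| * nm2 w) (fun x => G (x + lin t w)).
Proof.
move=> hk hG t kt; apply: (bsuppW (r := r + nm2 (lin t w))); last exact: bsupp_shift.
rewrite lerD2l nm2_lin ler_wpM2r ?nm2_ge0//.
by rewrite (le_trans _ (ler_norm r'))// leNgt; apply: contra kt => /hk ->.
Qed.

Lemma lsum_line ka w G : mc1 ka -> mc2 G ->
  S (line_int ka w G) = I1 (fun t => ka t * S (fun x => G (x + lin t w))).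
Proof.
move=> hk hG; have [_ [M [r' hk']]] := hk; have [r r0 Gr] := mc2_bsupp hG.
have kr t : r' < `|t| -> ka t = 0 by move=> h; have [_ ->] := hk' t.
have [s hs] := lsum_seq g N0 (r + `|r'| * nm2 w); have sup := bsupp_line (w := w) kr Gr.
rewrite hs; last first.
  move=> x hx; rewrite -I10; apply: I1_ext => t.
  by have [->|k0] := eqVneq (ka t) 0; rewrite ?mul0r// (sup t k0) ?mulr0.
rewrite /line_int -I1_sum; last by move=> z; exact: mc1_line.
rewrite -I1Z; last by apply: mcs_sum => z; exact: mc1_line.
apply: I1_ext => t; have [->|k0] := eqVneq (ka t) 0.
  by rewrite mul0r big1 ?mulr0// => i _; rewrite mul0r.
by rewrite (hs _ (sup t k0)) -mulr_sumr mulrCA.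
Qed.

(** Averaging over one period in the direction of a lattice vector makes the sum periodic and
    constant along that direction, so any real shift along it is harmless. *)
Lemma lsum_avg_inv u G c : lvec N g u -> mc2 G ->
  S (avg u (fun x => G (x + lin c u))) = S (avg u G).
Proof.
move=> [z uz] hG; have hU := @mc1_unit_ind R.
have hU' : mc1 (fun t => unit_ind (t - c)) by exact: mc1_shift.
(* Shifting [unit_ind] by c changes it by the difference of [ka] and its translate by 1. A translate
   by 1 of the kernel is a translate of the function by the lattice vector u, which the sum does not
   see. *)
pose ka (t : R) := heaviside t - heaviside (t - c).
have hka : mc1 ka by have := mc1_heaviside 0 c; under eq_fun do rewrite subr0.
have hka' : mc1 (fun t => ka (t - 1)) by exact: mc1_shift.
rewrite /avg (line_int_shift u c hU hG); apply/eqP; rewrite -subr_eq0; apply/eqP.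
have [r1 _ b1] := mc2_bsupp (mc2_line_int u hU' hG);
  have [r2 _ b2] := mc2_bsupp (mc2_line_int u hU hG).
have [r3 _ b3] := mc2_bsupp (mc2_line_int u hka' hG);
  have [r4 _ b4] := mc2_bsupp (mc2_line_int u hka hG).
rewrite -(lsumB g N0 b1 b2).
transitivity (S (fun x => line_int (fun t => ka (t - 1)) u G x - line_int ka u G x)).
  apply: lsum_ext => x; rewrite -!line_intB//; apply: I1_ext => t; congr (_ * _).
  rewrite /ka /unit_ind; have -> : t - c - 1 = t - 1 - c by ring.
  by ring.
rewrite (lsumB g N0 b3 b4) -(line_int_shift u 1 hka hG).
apply/eqP; rewrite subr_eq0; apply/eqP; rewrite -[RHS](lsum_shift _ _ _ z); apply: lsum_ext => x.
rewrite line_int_translate; apply: I1_ext => t; congr (_ * G (_ + _)).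
by rewrite -uz /lin !mul1r; case: (u).
Qed.

(** At each parameter t the points t(u + cv) and tu differ by a real multiple of v, which
    [lsum_avg_inv] ignores. The coefficient c may be any real number; the initial basis relies on
    this. *)
Lemma lsum_avg_shear u v c F : lvec N g v -> mc2 F ->
  S (avg v (avg (u + lin c v) F)) = S (avg v (avg u F)).
Proof.
move=> hv hF; have hU := @mc1_unit_ind R; have hA := mc2_line_int v hU hF.
have E w : S (avg v (avg w F)) = I1 (fun t => unit_ind t * S (fun x => avg v F (x + lin t w))).
  by rewrite -(lsum_line w hU hA); congr lsum; exact: line_intC.
rewrite !E; apply: I1_ext => t; congr (_ * _).
transitivity (S (avg v (fun x => (fun y => F (y + lin t u)) (x + lin (t * c) v)))).
  apply: lsum_ext => x; rewrite [LHS]line_int_translate; apply: I1_ext => s; congr (_ * F _).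
  by rewrite -[RHS]addrA; congr (_ + _); apply: injective_projections => /=; ring.
rewrite (lsum_avg_inv (t * c) hv (mc2_shift (lin t u) hF)).
by apply: lsum_ext => x; apply/esym; exact: line_int_translate.
Qed.

(** A shear along a lattice vector leaves the sum unchanged and the two averages commute, so a step
    of the Euclidean algorithm preserves exactness. *)
Lemma tiling_step u v c : lvec N g v -> tiling u v -> tiling v (u + lin c v).
Proof.
move=> hv huv F hF; rewrite lsum_avg_shear// -(huv F hF); congr lsum.
exact: (line_intC _ _ (@mc1_unit_ind R) (@mc1_unit_ind R) hF).
Qed.

Lemma unit_ind_sumN K (s : R) : - K%:R <= s < K%:R + 1 ->
  \sum_(i <- irange K) unit_ind (s + i%:~R) = 1.
Proof.
move=> /andP[h1 h2]; rewrite /unit_ind.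
have := sum_irange_telescope K (fun x => heaviside (s + x - 1)) => E.
rewrite (eq_bigr (fun i : int => - (heaviside (s + i%:~R - 1) - heaviside (s + (i%:~R + 1) - 1))));
  last first.
  by move=> i _; rewrite addrA addrK opprB.
rewrite sumrN E opprB /heaviside; have -> : s + (K%:R + 1) - 1 = s + K%:R by ring.
have -> : 0 <= s + K%:R by lra.
by rewrite leNgt (_ : s + - K%:R - 1 < 0) ?subr0//; lra.
Qed.

Lemma unit_tile f r K : mc1 f -> (forall t, r < `|t| -> f t = 0) -> r <= K%:R ->
  \sum_(i <- irange K) I1 (fun t => unit_ind t * f (t + i%:~R)) = I1 f.
Proof.
move=> hf fr rK; have hU := @mc1_unit_ind R.
have hi (i : int) : mc1 (fun t => unit_ind (t - i%:~R) * f t) by apply: mc1_mul => //;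
  exact: mc1_shift.
have hi' (i : int) : mc1 (fun t => unit_ind t * f (t + i%:~R)) by apply: mc1_mul => //;
  exact: mc1_shift.
rewrite (eq_bigr (fun i : int => I1 (fun t => unit_ind (t - i%:~R) * f t))); last first.
  move=> i _; rewrite -(I1_shift (- i%:~R) (hi' i)); apply: I1_ext => t.
  by rewrite subrK.
rewrite -I1_sum//; apply: I1_ext => t; rewrite -mulr_suml.
have [h|h] := ltP r `|t|; first by rewrite fr// mulr0.
rewrite unit_ind_sum ?mul1r//; move: (le_trans h rK); rewrite ler_norml => /andP[-> h2] /=.
lra.
Qed.

Lemma unit_tileN f r K (y0 : R) : mc1 f -> (forall t, r < `|t| -> f t = 0) -> `|y0| + r <= K%:R ->
  \sum_(i <- irange K) I1 (fun t => unit_ind t * f (y0 + i%:~R - t)) = I1 f.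
Proof.
move=> hf fr rK; have hU := @mc1_unit_ind R.
have hi (i : int) : mc1 (fun t => unit_ind (y0 + i%:~R - t) * f t) by apply: mc1_mul => //;
  exact: mc1_sub.
have hi' (i : int) : mc1 (fun t => unit_ind t * f (y0 + i%:~R - t)) by apply: mc1_mul => //;
  exact: mc1_sub.
rewrite (eq_bigr (fun i : int => I1 (fun t => unit_ind (y0 + i%:~R - t) * f t))); last first.
  move=> i _; rewrite -(I1_sub (y0 + i%:~R) (hi' i)); apply: I1_ext => t.
  by rewrite subKr.
rewrite -I1_sum//; apply: I1_ext => t; rewrite -mulr_suml.
have [h|h] := ltP r `|t|; first by rewrite fr// mulr0.
rewrite (eq_bigr (fun i : int => unit_ind (y0 - t + i%:~R))); last by move=> i _; rewrite addrAC.
rewrite unit_ind_sumN ?mul1r//.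
have h3 : `|y0 - t| <= K%:R by apply: le_trans (ler_normB _ _) _; lra.
move: h3; rewrite ler_norml => /andP[-> h2] /=; lra.
Qed.

Let NR0 : 0 < N%:R :> R. Proof. by rewrite ltr0n. Qed.
Let NRn : N%:R != 0 :> R. Proof. by rewrite gt_eqF. Qed.

Lemma nat_bound (x : R) : exists K : nat, x <= K%:R.
Proof. by exists (Num.trunc x).+1; exact/ltW/truncnS_gt. Qed.

Lemma lvec_vert : lvec N g ((0, -1) : R * R).
Proof. by exists (0, -1); rewrite /lattice_pt /= !mul0r add0r. Qed.

Lemma lvec_diag : lvec N g ((N%:R^-1, g%:R / N%:R) : R * R).
Proof. by exists (1, 0); rewrite /lattice_pt /= !mul1r addr0. Qed.

(** The vertical average turns each column of lattice points into an integral over y at abscissa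
    n/N; the horizontal average over a length 1/N then joins these columns into the full
    integral. *)
Lemma tiling_init : tiling (0, -1) (N%:R^-1, g%:R / N%:R).
Proof.
move=> F hF; have hU := @mc1_unit_ind R.
(* A shear by the real coefficient -g/N makes the second vector horizontal. It is no longer a
   lattice vector, but the shear only needs (0, -1) to be one. *)
have -> : (N%:R^-1, g%:R / N%:R) = (N%:R^-1, 0) + lin (- (g%:R / N%:R)) (0, -1) :> R * R.
  by apply: injective_projections; rewrite /= ?mulr0 ?addr0// mulrN1 opprK add0r.
rewrite lsum_avg_shear//; last exact: lvec_vert.
set G := avg (N%:R^-1, 0) F; have hG : mc2 G by exact: mc2_line_int.
have [r r0 Gr] := mc2_bsupp hG; have [r1 r10 Ar] := mc2_bsupp (mc2_line_int (0, -1) hU hG).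
have [rF rF0 Fr] := mc2_bsupp hF.
have [K1 hK1] := nat_bound (Num.max (r1 * N%:R) (rF * N%:R)).
move: hK1; rewrite ge_max => /andP[hK1 hK1'].
have [K2 hK2] := nat_bound (Num.max (r1 + K1%:R * g%:R / N%:R) (K1%:R * g%:R / N%:R + r)).
move: hK2; rewrite ge_max => /andP[hK2 hK2'].
rewrite (lsum_irange N0 Ar hK1 hK2).
have hn n : n \in irange K1 -> `|n%:~R| <= K1%:R :> R.
  move=> /mapP[k]; rewrite mem_iota => hk ->; rewrite intrB /= ler_norml.
  have : (k%:R : R) <= (K1 + K1)%:R by rewrite ler_nat; lia.
  by rewrite natrD; have : 0 <= k%:R :> R by []; move=> *; apply/andP; split; lra.
have E1 n : n \in irange K1 ->
    \sum_(j <- irange K2) line_int unit_ind (0, -1) G (lattice_pt N g (n, j)) =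
      I1 (fun y => G (n%:~R / N%:R, y)).
  move=> nK; rewrite -(@unit_tileN _ r K2 (n%:~R * g%:R / N%:R) (mc1_xsec (n%:~R / N%:R) hG)).
  - apply: eq_bigr => j _; apply: I1_ext => t; congr (_ * G _).
    by apply: injective_projections; rewrite /= ?mulr0 ?addr0// mulrN1.
  - by move=> t ht; apply: Gr; rewrite nm2_gt ht orbT.
  apply: le_trans hK2'; rewrite lerD2r -!mulrA normrM ler_pM//; first exact: hn.
  by rewrite ger0_norm// divr_ge0//; exact: ltW.
rewrite big_seq (eq_bigr _ E1) -big_seq.
pose Ga x := I1 (fun y => F (x, y)); have hGa : mc1 Ga := mc1_partial hF.
have E2 (n : int) : I1 (fun y => G (n%:~R / N%:R, y)) =
  I1 (fun t => unit_ind t * Ga (N%:R^-1 * (t + n%:~R) + 0)).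
  rewrite /G /avg /line_int.
  pose H (z : R * R) := unit_ind z.1 * F (N%:R^-1 * (z.1 + n%:~R), z.2).
  have hH : mc2 H.
    have [mF [M [r2 FM]]] := hF; have [mu0 [MU [rU hUM]]] := hU; split.
      apply: measurable_funM; first exact: (mf_fst mu0).
      apply: (measurableT_comp mF); apply: measurable_fun_pair => //=.
      by apply: measurable_funM => //; apply: measurable_funD.
    exists (MU * M), (Num.max rU rF) => -[a b]; rewrite /H /=.
    have [u1 u2] := hUM a; have [f1 _] := FM (N%:R^-1 * (a + n%:~R), b).
    split; first by rewrite normrM ler_pM.
    rewrite nm2_gt /= !gt_max => /orP[/andP[h _]|/andP[_ h]]; first by rewrite u2// mul0r.
    by rewrite Fr ?mulr0// nm2_gt /= h orbT.
  transitivity (I1 (fun y => I1 (fun t => H (t, y)))).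
    apply: I1_ext => y; apply: I1_ext => t; congr (_ * F _).
    by apply: injective_projections; rewrite /= ?mulr0 ?addr0// mulrDr addrC ![_ * N%:R^-1]mulrC.
  rewrite -(I1_swap hH); apply: I1_ext => t; rewrite addr0 /Ga -I1Z//.
  exact: mc1_xsec.
have N1 : N%:R^-1 != 0 :> R by rewrite invr_eq0.
have hf := mc1_affine 0 N1 hGa.
have fr t : rF * N%:R < `|t| -> Ga (N%:R^-1 * t + 0) = 0.
  rewrite addr0 => ht; rewrite /Ga -I10; apply: I1_ext => y; apply: Fr; rewrite nm2_gt /=.
  by rewrite normrM normfV [`|N%:R|]ger0_norm ?(ltW NR0)// mulrC ltr_pdivlMr// ht.
have := unit_tile hf fr hK1'; rewrite (eq_bigr _ (fun n _ => E2 n)) => ->.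
rewrite (I1_affine 0 N1 hGa) normfV [`|N%:R|]ger0_norm ?(ltW NR0)// invrK mulrA mulVf// mul1r.
by rewrite (I2E hF).
Qed.

End tiling.

(** * Reduced bases and the cubature error *)

Section error.
Context {R : realType}.
Variables (N g : nat).
Hypothesis N0 : (0 < N)%N.
Implicit Types (F G : R * R -> R) (u v w : R * R) (f ka : R -> R).
Local Notation S := (lsum N g).

Let NR0 : 0 < N%:R :> R. Proof. by rewrite ltr0n. Qed.
Let NRn : N%:R != 0 :> R. Proof. by rewrite gt_eqF. Qed.

Lemma lvec_lin u (n : nat) : lvec N g u -> lvec N g (lin n%:R u).
Proof.
move=> hu; elim: n => [|n IH].
  by exists 0; apply: injective_projections => /=; rewrite !mul0r ?add0r.
rewrite (_ : lin _ _ = lin n%:R u + u); first exact: lvecD.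
by rewrite -natr1 linD; congr (_ + _); apply: injective_projections; rewrite /= mul1r.
Qed.

(** Here n, m are consecutive remainders and a, b the denominators of consecutive convergents; b n +
    a m = N is the determinant, and [sg] follows the alternating signs. The algorithm runs as long
    as the next denominator a + Qb is at most t. When it stops, m t <= m(a + Qb) <= N bounds m/N by
    1/t, and n = Qm + r <= (K + 1) m bounds the other vector. *)
Lemma euclid_basis (K : nat) (t : R) : 1 <= t -> t <= N%:R ->
  forall k m n a b (sg : R), (m <= k)%N -> (m <= n)%N -> coprime m n ->
  all (fun q => q <= K)%N (euclid_quotients k m n) ->
  (b * n + a * m)%N = N -> (a <= b)%N -> b%:R <= t -> `|sg| = 1 ->
  lvec N g (a%:R / N%:R, sg * n%:R / N%:R) -> lvec N g (b%:R / N%:R, - sg * m%:R / N%:R) ->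
  tiling N g (a%:R / N%:R, sg * n%:R / N%:R) (b%:R / N%:R, - sg * m%:R / N%:R) ->
  exists u v, [/\ tiling N g u v, `|u.1| <= t / N%:R, `|v.1| <= t / N%:R,
    `|u.2| <= K.+1%:R / t & `|v.2| <= K.+1%:R / t].
Proof.
move=> t1 tN; have t0 : 0 < t by apply: lt_le_trans t1.
have nN (i : nat) : 0 <= i%:R / N%:R :> R by rewrite divr_ge0.
have e1 (i : nat) : i%:R <= t -> `|i%:R / N%:R| <= t / N%:R.
  by move=> it; rewrite ger0_norm// ler_pM2r ?invr_gt0.
have e2 (sg : R) (i : nat) : `|sg| = 1 -> i%:R * t <= K.+1%:R * N%:R -> `|sg * i%:R / N%:R|
  <= K.+1%:R / t.
  move=> sg1 h; rewrite -mulrA normrM sg1 mul1r ger0_norm// ler_pdivrMr// mulrAC ler_pdivlMr//.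
elim=> [|k IH] m n a b sg mk mn cop.
  move: mk cop; rewrite leqn0 => /eqP ->; rewrite /coprime gcd0n => /eqP -> _.
  rewrite muln1 muln0 addn0 => -> aN Nt sg1 _ _ til.
  exists (a%:R / N%:R, sg * 1 / N%:R), (N%:R / N%:R, - sg * 0 / N%:R); split => //.
  - by apply: e1; apply: le_trans Nt; rewrite ler_nat.
  - exact: e1.
  - by apply: (e2 _ 1%N) => //; rewrite mul1r (le_trans tN)// ler_peMl// ler1n.
  - by rewrite mulr0 mul0r normr0 divr_ge0// ltW.
rewrite /=; case: eqVneq => [m0|m0].
  (* Remainder 0: coprimality gives n = 1 and b = N, hence v = (1, 0), which is short enough since N
     = b <= t. The height 1/N of u is at most (K + 1)/t because t <= N. *)
  move: cop; rewrite m0 /coprime gcd0n => /eqP -> _.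
  rewrite muln1 muln0 addn0 => -> aN Nt sg1 _ _ til.
  exists (a%:R / N%:R, sg * 1 / N%:R), (N%:R / N%:R, - sg * 0 / N%:R); split => //.
  - by apply: e1; apply: le_trans Nt; rewrite ler_nat.
  - exact: e1.
  - by apply: (e2 _ 1%N) => //; rewrite mul1r (le_trans tN)// ler_peMl// ler1n.
  - by rewrite mulr0 mul0r normr0 divr_ge0// ltW.
have mgt0 : (0 < m)%N by rewrite lt0n.
move=> /= /andP[QK allq] det ab bt sg1 lu lv til.
have nE := divn_eq n m; set Q := (n %/ m)%N in QK nE; set r := (n %% m)%N in nE allq.
have rm : (r < m)%N by rewrite ltn_mod.
have Q1 : (1 <= Q)%N by rewrite divn_gt0.
have det' : ((a + Q * b) * m + b * r)%N = N by rewrite -det nE; ring.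
have [bt'|bt'] := leP (a + Q * b)%:R t.
  have v'E : (a%:R / N%:R, sg * n%:R / N%:R) + lin Q%:R (b%:R / N%:R, - sg * m%:R / N%:R)
     = ((a + Q * b)%:R / N%:R, - - sg * r%:R / N%:R) :> R * R.
    apply: injective_projections => /=; first by rewrite natrD natrM; ring.
    by rewrite nE natrD natrM; ring.
  apply: (IH r m b (a + Q * b)%N (- sg)) => //.
  - by rewrite -ltnS; apply: leq_trans mk.
  - exact: ltnW.
  - by rewrite /r coprime_modl coprime_sym.
  - by rewrite (leq_trans _ (leq_addl _ _))// leq_pmull.
  - by rewrite normrN.
  - by rewrite -v'E; apply: lvecD => //; exact: lvec_lin.
  - by rewrite -v'E; exact: tiling_step.
have mt : m%:R * t <= N%:R.
  rewrite -det' (le_trans (y := m%:R * (a + Q * b)%:R))//; first by rewrite ler_wpM2l// ltW.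
  by rewrite -natrM ler_nat mulnC leq_addr.
exists (a%:R / N%:R, sg * n%:R / N%:R), (b%:R / N%:R, - sg * m%:R / N%:R); split => //.
- by apply: e1; apply: le_trans bt; rewrite ler_nat.
- exact: e1.
- apply: e2 => //; apply: (@le_trans _ _ (K.+1%:R * m%:R * t)).
    rewrite ler_pM2r// -natrM ler_nat nE mulSn addnC leq_add ?(ltnW rm)//.
    by rewrite leq_mul2r QK orbT.
  by rewrite -mulrA ler_wpM2l.
- by apply: e2; rewrite ?normrN//; apply: le_trans mt _; rewrite ler_peMl// ler1n.
Qed.

Lemma reduced_basis (K : nat) (t : R) : (0 < g < N)%N -> coprime g N -> (max_quotient g N <= K)%N ->
  1 <= t -> t <= N%:R ->
  exists u v, [/\ tiling N g u v, `|u.1| <= t / N%:R, `|v.1| <= t / N%:R,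
    `|u.2| <= K.+1%:R / t & `|v.2| <= K.+1%:R / t].
Proof.
move=> /andP[g0 gN] cop hK t1 tN.
have uE : (0%:R / N%:R, - 1 * N%:R / N%:R) = (0, -1) :> R * R.
  by apply: injective_projections; rewrite /= ?mul0r// mulfK.
have vE : (1%:R / N%:R, - - 1 * g%:R / N%:R) = (N%:R^-1, g%:R / N%:R) :> R * R.
  by apply: injective_projections; rewrite /= ?mul1r// opprK mul1r.
apply: (@euclid_basis K t t1 tN g g N 0 1 (- 1)) => //.
- exact: ltnW.
- apply/allP => q qin; apply: leq_trans hK; rewrite /max_quotient.
  exact: (@leq_bigmax_seq _ (partial_quotients g N) xpredT id q).
- by rewrite mul1n mul0n addn0.
- by rewrite normrN normr1.
- by rewrite uE; exact: lvec_vert.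
- by rewrite vE; exact: lvec_diag.
- by rewrite uE vE; exact: tiling_init.
Qed.

Definition err F := I2 F - S F.

Lemma errB F G : mc2 F -> mc2 G -> err (fun x => F x - G x) = err F - err G.
Proof.
move=> hF hG; have [r _ b1] := mc2_bsupp hF; have [r' _ b2] := mc2_bsupp hG.
by rewrite /err I2B// (lsumB g N0 b1 b2); ring.
Qed.

Lemma errZ F c : mc2 F -> err (fun x => c * F x) = c * err F.
Proof.
move=> hF; have [r _ b1] := mc2_bsupp hF.
by rewrite /err I2Z// (lsumZ g N0 c b1) mulrBr.
Qed.

Lemma errD F G : mc2 F -> mc2 G -> err (fun x => F x + G x) = err F + err G.
Proof.
move=> hF hG; have := errB hF (mcsZ (-1) hG); rewrite errZ// mulN1r opprK => <-.
by congr err; apply/funext => x; rewrite mulN1r opprK.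
Qed.

Lemma mc1_lsum_line ka w G : mc1 ka -> mc2 G -> mc1 (fun t => ka t * S (fun x => G (x + lin t w))).
Proof.
move=> hk hG; have [_ [M [r' hk']]] := hk; have [r r0 Gr] := mc2_bsupp hG.
have kr t : r' < `|t| -> ka t = 0 by move=> h; have [_ ->] := hk' t.
have [s hs] := lsum_seq g N0 (r + `|r'| * nm2 w); have sup := bsupp_line (w := w) kr Gr.
rewrite (_ : (fun t => _) = (fun t => N%:R^-1 * \sum_(z <- s)
  (ka t * G (lattice_pt N g z + lin t w)))).
  by apply: mcsZ; apply: mcs_sum => z; exact: mc1_line.
apply/funext => t; have [->|k0] := eqVneq (ka t) 0.
  by rewrite mul0r big1 ?mulr0// => i _; rewrite mul0r.
by rewrite (hs _ (sup t k0)) -mulr_sumr mulrCA.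
Qed.

Lemma lsum_avg_near w G c M : mc2 G ->
  (forall t, 0 <= t < 1 -> `|S (fun x => G (x + lin t w)) - c| <= M) -> `|S (avg w G) - c| <= M.
Proof.
move=> hG h; have hU := @mc1_unit_ind R.
rewrite /avg lsum_line//.
have -> : c = I1 (fun t => c * unit_ind t) by rewrite I1Z// I1_unit_ind mulr1.
rewrite -I1B; [|exact: mc1_lsum_line|exact: mcsZ].
have -> : M = I1 (fun t => M * unit_ind t) by rewrite I1Z// I1_unit_ind mulr1.
apply: norm_I1; [|exact: mcsZ|].
  by apply: mcsB; [exact: mc1_lsum_line|exact: mcsZ].
move=> t; rewrite mulrC -mulrBl normrM (ger0_norm (unit_ind_ge0 t)).
have [ht|ht] := boolP (0 <= t < 1); first by rewrite ler_wpM2r ?unit_ind_ge0// h.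
rewrite unit_ind_out ?mulr0//; move: ht; rewrite negb_and -ltNge -leNgt => /orP[]; by [left|right].
Qed.

(** The double average of F has lattice sum exactly [I2 F], and [I2] ignores shifts, so up to sign
    [err F] is the mean over the parallelogram of the errors of F - F(. + w). These are cubature
    errors again, hence the step can be iterated. *)
Lemma err_diff u v F M : tiling N g u v -> mc2 F ->
  (forall s t, 0 <= s < 1 -> 0 <= t < 1 -> `|err (fun x => F x - F (x + (lin s u + lin t v)))| <= M)
    ->
  `|err F| <= M.
Proof.
move=> til hF h; have hU := @mc1_unit_ind R.
rewrite /err -(til F hF); apply: lsum_avg_near => [|s hs]; first exact: mc2_line_int.
have -> : S (fun x => avg v F (x + lin s u)) = S (avg v (fun x => F (x + lin s u))).
  by apply: lsum_ext => x; exact: line_int_translate.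
apply: lsum_avg_near => [|t ht]; first exact: mc2_shift.
have := h s t hs ht; rewrite errB//; last exact: mc2_shift.
rewrite /err I2_shift//; set X := S (fun x => F (x + _)).
have -> : I2 F - S F - (I2 F - X) = X - S F by ring.
rewrite /X => h'; apply: le_trans h'; rewrite le_eqVlt; apply/orP; left; apply/eqP.
by congr (`|_ - _|); apply: lsum_ext => x; rewrite -addrA [lin t v + _]addrC.
Qed.

Section estimates.
Variables (u v : R * R) (a1 a2 : R).
Hypotheses (til : tiling N g u v) (u1 : `|u.1| <= a1 / 2) (v1 : `|v.1| <= a1 / 2)
  (u2 : `|u.2| <= a2 / 2) (v2 : `|v.2| <= a2 / 2).

Let a10 : 0 <= a1. Proof. by have h : 0 <= a1 / 2 := le_trans (normr_ge0 _) u1; lra. Qed.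
Let a20 : 0 <= a2. Proof. by have h : 0 <= a2 / 2 := le_trans (normr_ge0 _) u2; lra. Qed.

Let stepw s t : 0 <= s < 1 -> 0 <= t < 1 ->
  `|(lin s u + lin t v).1| <= a1 /\ `|(lin s u + lin t v).2| <= a2.
Proof.
move=> /andP[s0 s1] /andP[t0 t1].
have B (x y a : R) : `|x| <= a / 2 -> `|y| <= a / 2 -> `|s * x + t * y| <= a.
  move=> hx hy; apply: le_trans (ler_normD _ _) _; rewrite !normrM (ger0_norm s0) (ger0_norm t0).
  have := normr_ge0 x; have := normr_ge0 y => h1 h2.
  have : s * `|x| <= 1 * `|x| by rewrite ler_wpM2r// ltW.
  have : t * `|y| <= 1 * `|y| by rewrite ler_wpM2r// ltW.
  lra.
by split; exact: B.
Qed.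

Definition box_ind (c b : R) : R -> R := \1_`[c - b, c + b]%classic.

Lemma mc1_box_ind c b : mc1 (box_ind c b).
Proof.
apply: (@mcs_indic _ (measurableTypeR R) R nm1 _ (`|c| + `|b|)) => // x.
rewrite /= in_itv /= /nm1 ler_norml => /andP[h1 h2].
have := ler_norm (- c); have := ler_norm c; have := ler_norm b; rewrite normrN; move=> *; lra.
Qed.

Lemma I1_box_ind c b : 0 <= b -> I1 (box_ind c b) = 2 * b.
Proof.
move=> b0; transitivity (fine (lebesgue_measure
  (`[c - b, c + b]%classic : set (measurableTypeR R)))).
  exact: (@int_indic _ (measurableTypeR R) R lebesgue_measure).
rewrite lebesgue_measure_itv /= lte_fin; case: ifP => h; first by rewrite /=; ring.
by move/negbT: h; rewrite -leNgt /= => h; lra.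
Qed.

Lemma box_ind_in c b x : `|x - c| <= b -> box_ind c b x = 1.
Proof.
rewrite ler_norml => /andP[h1 h2]; rewrite /box_ind indicE mem_set//= in_itv /=;
  apply/andP; split; lra.
Qed.

Lemma box_ind_ge0 c b x : 0 <= box_ind c b x.
Proof. by rewrite /box_ind indicE. Qed.

(** Points are counted by area: enlarge the box by (a1, a2), so that the double average of its
    indicator is still 1 on the original box. Exactness of the averaged sum then gives the area of
    the enlarged box. *)
Lemma lsum_box F B c1 c2 b1 b2 : 0 <= B -> 0 <= b1 -> 0 <= b2 -> (exists r, bsupp r F) ->
  (forall x, `|F x| <= B) ->
  (forall x, b1 < `|x.1 - c1| \/ b2 < `|x.2 - c2| -> F x = 0) ->
  S (fun x => `|F x|) <= B * (4 * (b1 + a1) * (b2 + a2)).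
Proof.
have A1 := a10; have A2 := a20; move=> B0 b10 b20 [r hr] FB F0; have hU := @mc1_unit_ind R.
pose Q := tens (box_ind c1 (b1 + a1)) (box_ind c2 (b2 + a2)).
have hQ : mc2 Q by apply: mc2_tens; exact: mc1_box_ind.
have hv := mc2_line_int v hU hQ; have huv := mc2_line_int u hU hv.
have [r' _ br'] := mc2_bsupp huv.
have -> : B * (4 * (b1 + a1) * (b2 + a2)) = B * S (avg u (avg v Q)).
  rewrite (til hQ) I2_tens; [|exact: mc1_box_ind..].
  by rewrite !I1_box_ind; [ring|lra|lra].
rewrite -(lsumZ g N0 B br').
have br : bsupp r (fun x => `|F x|) by move=> x /hr ->; rewrite normr0.
have br2 : bsupp r' (fun x => B * avg u (avg v Q) x) by move=> x /br'; rewrite /avg => ->;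
  rewrite mulr0.
apply: (le_lsum g N0 br br2) => x.
have Q0 z : 0 <= Q z by rewrite /Q /tens mulr_ge0// box_ind_ge0.
have [h|h] := pselect (b1 < `|x.1 - c1| \/ b2 < `|x.2 - c2|).
  rewrite F0// normr0 mulr_ge0//; apply: I1_ge0 => t; rewrite mulr_ge0 ?unit_ind_ge0//.
  by apply: I1_ge0 => s; rewrite mulr_ge0 ?unit_ind_ge0.
move/not_orP: h => [/negP h1 /negP h2]; rewrite -!leNgt in h1 h2.
suff -> : avg u (avg v Q) x = 1 by rewrite mulr1.
rewrite -I1_unit_ind; apply: I1_ext => s.
have [hs|hs] := boolP (0 <= s < 1); last first.
  by rewrite unit_ind_out ?mul0r//; move: hs; rewrite negb_and -ltNge -leNgt => /orP[];
    [left|right].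
rewrite -[RHS]mulr1; congr (_ * _); rewrite -I1_unit_ind; apply: I1_ext => t.
have [ht|ht] := boolP (0 <= t < 1); last first.
  by rewrite unit_ind_out ?mul0r//; move: ht; rewrite negb_and -ltNge -leNgt => /orP[];
    [left|right].
rewrite -[RHS]mulr1; congr (_ * _); have [w1 w2] := stepw hs ht.
rewrite -addrA /Q /tens !box_ind_in ?mulr1//.
  have -> : (x + (lin s u + lin t v)).2 - c2 = (x.2 - c2) + (lin s u + lin t v).2 by
    rewrite /= addrAC.
  by apply: le_trans (ler_normD _ _) _; exact: lerD.
have -> : (x + (lin s u + lin t v)).1 - c1 = (x.1 - c1) + (lin s u + lin t v).1 by
  rewrite /= addrAC.
by apply: le_trans (ler_normD _ _) _; exact: lerD.
Qed.

Lemma I2_box F B c1 c2 b1 b2 : 0 <= B -> 0 <= b1 -> 0 <= b2 -> mc2 F ->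
  (forall x, `|F x| <= B) ->
  (forall x, b1 < `|x.1 - c1| \/ b2 < `|x.2 - c2| -> F x = 0) ->
  `|I2 F| <= B * (4 * b1 * b2).
Proof.
move=> B0 b10 b20 hF FB F0.
pose Q := tens (box_ind c1 b1) (box_ind c2 b2).
have hQ : mc2 Q by apply: mc2_tens; exact: mc1_box_ind.
have -> : B * (4 * b1 * b2) = I2 (fun x => B * Q x).
  rewrite I2Z// I2_tens; [|exact: mc1_box_ind..].
  by rewrite !I1_box_ind//; ring.
apply: norm_I2 => //; first exact: mcsZ.
move=> x; have [h|h] := pselect (b1 < `|x.1 - c1| \/ b2 < `|x.2 - c2|).
  by rewrite F0// normr0 mulr_ge0// /Q /tens mulr_ge0// box_ind_ge0.
move/not_orP: h => [/negP h1 /negP h2]; rewrite -!leNgt in h1 h2.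
by rewrite /Q /tens !box_ind_in// !mulr1.
Qed.

Lemma err_box F B c1 c2 b1 b2 : 0 <= B -> 0 <= b1 -> 0 <= b2 -> mc2 F ->
  (forall x, `|F x| <= B) ->
  (forall x, b1 < `|x.1 - c1| \/ b2 < `|x.2 - c2| -> F x = 0) ->
  `|err F| <= 8 * B * (b1 + a1) * (b2 + a2).
Proof.
have A1 := a10; have A2 := a20; move=> B0 b10 b20 hF FB F0; have [r _ br] := mc2_bsupp hF.
have h1 := I2_box B0 b10 b20 hF FB F0.
have h2 := lsum_box B0 b10 b20 (ex_intro _ r br) FB F0.
have h3 := norm_lsum g N0 br.
apply: le_trans (ler_normB _ _) _.
have h4 : B * (4 * b1 * b2) <= B * (4 * (b1 + a1) * (b2 + a2)).
  rewrite ler_wpM2l// -!mulrA ler_wpM2l// ler_pM//; lra.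
move: h1 h2 h3 h4; set X := B * (4 * (b1 + a1) * (b2 + a2)) => h1 h2 h3 h4.
have -> : 8 * B * (b1 + a1) * (b2 + a2) = X + X by rewrite /X; ring.
lra.
Qed.

(** Induction on the number k of differences. Each one uses up a derivative, enlarges the supports
    by (a1, a2) and gains a factor h by the mean value theorem. The final crude bound [err_box]
    enlarges the box once more, whence [k.+1]. *)
Lemma err_tens (k : nat) (r1 r2 h : R) : 0 <= r1 -> 0 <= r2 -> 0 <= h -> a1 * r1 <= h ->
  a2 * r2 <= h ->
  forall f1 f2 (c1 c2 b1 b2 M1 M2 : R), test1 f1 -> test1 f2 -> 0 <= b1 -> 0 <= b2 -> 0 <=
    M1 -> 0 <= M2 ->
  (forall x, b1 < `|x - c1| -> f1 x = 0) -> (forall x, b2 < `|x - c2| -> f2 x = 0) ->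
  (forall i x, (i <= k)%N -> `|derive1n i f1 x| <= M1 * r1 ^+ i) ->
  (forall i x, (i <= k)%N -> `|derive1n i f2 x| <= M2 * r2 ^+ i) ->
  `|err (tens f1 f2)| <= (2 * h) ^+ k * (8 * (M1 * M2) * (b1 + k.+1%:R * a1) * (b2 + k.+1%:R * a2)).
Proof.
have A1 := a10; have A2 := a20; move=> r10 r20 h0 ar1 ar2.
have diffs (f : R -> R) (c b M a r w : R) k' : test1 f -> 0 <= a -> 0 <= M -> 0 <= r -> a * r <=
  h -> `|w| <= a ->
   (forall x, b < `|x - c| -> f x = 0) ->
   (forall i x, (i <= k'.+1)%N -> `|derive1n i f x| <= M * r ^+ i) ->
   [/\ test1 (fun x => f (x + w)), test1 (fun x => f x - f (x + w)),
     (forall x, b + a < `|x - c| -> f (x + w) = 0 /\ f x - f (x + w) = 0) &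
     (forall i x, (i <= k')%N -> `|derive1n i (fun x => f (x + w)) x| <= M * r ^+ i /\
        `|derive1n i (fun x => f x - f (x + w)) x| <= (M * h) * r ^+ i)].
  move=> hf a0 M0 r0 ar wa f0 fM.
  have E : (fun x => 1 * f (1 * x + w)) = (fun x => f (x + w)) by apply/funext => x; rewrite !mul1r.
  have hs : test1 (fun x => f (x + w)) by rewrite -E; apply: test1_affine => //; exact: oner_neq0.
  have Es i : derive1n i (fun x => f (x + w)) = fun x => derive1n i f (x + w).
    rewrite -E derive1n_affine; last exact: hf.1.
    by apply/funext => x; rewrite expr1n !mul1r.
  have Ed i : derive1n i (fun x => f x - f (x + w)) = fun x =>
    derive1n i f x - derive1n i f (x + w).
    elim: i => [//|i IH]; rewrite !derive1nS IH; apply: is_derive_derive1 => x.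
    have d1 := smooth1_is_derive x (@smooth1_deriven _ i _ hf.1).
    have d2 := smooth1_is_derive x (@smooth1_deriven _ i _ hs.1).
    rewrite -derive1nS !Es derive1nS in d2.
    exact: (is_deriveB d1 d2).
  split => //; first exact: test1B.
    move=> x hx; have h1 : f x = 0 by apply: f0; lra.
    have h2 : f (x + w) = 0.
      apply: f0; have := ler_normB (x + w - c) w.
      have -> : x + w - c - w = x - c by ring.
      lra.
    by rewrite h1 h2 subrr.
  move=> i x ik; rewrite Es Ed; split; first by apply: fM; exact: leq_trans ik _.
  have := lipschitz_derive (@smooth1_deriven _ i _ hf.1) (M := M * r ^+ i.+1).
  rewrite -derive1nS => /(_ (fun y => fM i.+1 y ik) x (x + w)) hl.
  rewrite distrC; apply: le_trans hl _; rewrite addrAC subrr add0r exprS.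
  have hr : 0 <= r ^+ i by rewrite exprn_ge0.
  have -> : M * (r * r ^+ i) * `|w| = M * r ^+ i * (`|w| * r) by ring.
  have -> : M * h * r ^+ i = M * r ^+ i * h by ring.
  by rewrite ler_wpM2l ?mulr_ge0// (le_trans _ ar)// ler_wpM2r.
elim: k => [|k IH] f1 f2 c1 c2 b1 b2 M1 M2 hf1 hf2 b10 b20 M10 M20 f10 f20 fM1 fM2.
  rewrite expr0 !mul1r.
  apply: (@err_box _ (M1 * M2) c1 c2) => //; first exact: mulr_ge0.
  - by apply: mc2_tens; exact: test1_mc1.
  - move=> x; rewrite /tens normrM ler_pM//.
      by have := fM1 0%N x.1 (leqnn _); rewrite expr0 mulr1.
    by have := fM2 0%N x.2 (leqnn _); rewrite expr0 mulr1.
  - by move=> x [/f10|/f20]; rewrite /tens => ->; rewrite ?mul0r ?mulr0.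
have mt := mc2_tens (test1_mc1 hf1) (test1_mc1 hf2).
apply: (err_diff til mt) => s t hs ht; have [w1 w2] := stepw hs ht.
set w := lin s u + lin t v in w1 w2 *.
have [s1 d1 z1 e1] := diffs f1 c1 b1 M1 a1 r1 w.1 k hf1 a10 M10 r10 ar1 w1 f10 fM1.
have [s2 d2 z2 e2] := diffs f2 c2 b2 M2 a2 r2 w.2 k hf2 a20 M20 r20 ar2 w2 f20 fM2.
have m1 := mc2_tens (test1_mc1 d1) (test1_mc1 hf2);
  have m2 := mc2_tens (test1_mc1 s1) (test1_mc1 d2).
(* Discrete product rule: change one factor at a time. Both terms are again tensors, so the
   induction hypothesis applies to each and the gain per step is 2h. *)
have -> : (fun x => tens f1 f2 x - tens f1 f2 (x + w)) =
   (fun x => tens (fun x => f1 x - f1 (x + w.1)) f2 x + tens (fun x => f1 (x + w.1))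
     (fun x => f2 x - f2 (x + w.2)) x).
  by apply/funext => x; rewrite /tens /=; ring.
rewrite errD//; apply: le_trans (ler_normD _ _) _.
have b2le : b2 <= b2 + a2 by rewrite lerDl.
have b1' : 0 <= b1 + a1 by lra.
have b2' : 0 <= b2 + a2 by lra.
have H1 := IH _ _ c1 c2 (b1 + a1) (b2 + a2) (M1 * h) M2 d1 hf2 b1' b2' (mulr_ge0 M10 h0) M20
  (fun x hx => (z1 x hx).2)
   (fun x hx => f20 x (le_lt_trans b2le hx)).
have H2 := IH _ _ c1 c2 (b1 + a1) (b2 + a2) M1 (M2 * h) s1 d2 b1' b2' M10 (mulr_ge0 M20 h0)
  (fun x hx => (z1 x hx).1)
   (fun x hx => (z2 x hx).2).
have {}H1 := H1 (fun i x ik => (e1 i x ik).2) (fun i x ik => fM2 i x (leqW ik)).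
have {}H2 := H2 (fun i x ik => (e1 i x ik).1) (fun i x ik => (e2 i x ik).2).
apply: le_trans (lerD H1 H2) _; rewrite le_eqVlt; apply/orP; left; apply/eqP.
rewrite exprS -[in RHS](natr1 k.+1); ring.
Qed.

End estimates.
End error.

(** * The cubature error of a translated kernel *)

Section kernels.
Context {R : realType}.
Implicit Types (F G : R * R -> R) (lam : R -> R) (H : (R * R) * (R * R) -> R).

Lemma test1_uniform_bnd k f : test1 f -> exists2 M : R, 0 <= M & forall i x, (i <= k)%N ->
  `|derive1n i f x| <= M.
Proof.
move=> hf; elim: k => [|k [M M0 IH]].
  by have [M M0 h] := test1_bnd hf; exists M => // i x; rewrite leqn0 => /eqP ->.
have [M' M'0 h] := test1_bnd (test1_deriven k.+1 hf); exists (M + M'); first exact: addr_ge0.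
move=> i x; rewrite leq_eqVlt ltnS => /orP[/eqP ->|/(IH i x) h'].
  by apply: le_trans (h x) _; rewrite lerDr.
by apply: le_trans h' _; rewrite lerDl.
Qed.

Definition scaled_family lam0 lam (j : nat) := if j is k.+1 then dil k lam else lam0.

Lemma test1_scaled_family lam0 lam j : test1 lam0 -> test1 lam -> test1 (scaled_family lam0 lam j).
Proof. by case: j => [//|j] h0 h1; exact: test1_dil. Qed.

(** The estimates obeyed by L1-normalised dilates of a fixed bump: height 2^j, width 2^(-j), and a
    factor 2^j per derivative, with constants uniform in j. *)
Definition family_bounds (k : nat) (Lam : nat -> R -> R) (M r : R) :=
  [/\ 0 <= M, 0 <= r, (forall j, test1 (Lam j)),
    (forall j i x, (i <= k)%N -> `|derive1n i (Lam j) x| <= M * 2 ^+ j * (2 ^+ j) ^+ i) &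
    (forall j x, r / 2 ^+ j < `|x| -> Lam j x = 0)].

Lemma scaled_family_bounds k lam0 lam : test1 lam0 -> test1 lam ->
  exists M r, family_bounds k (scaled_family lam0 lam) M r.
Proof.
move=> h0 h1; have [M M0 hM] := test1_uniform_bnd k h0; have [M' M'0 hM'] := test1_uniform_bnd k h1.
have [_ [r0 hr0]] := h0; have [_ [r1 hr1]] := h1.
have r0n := ler_norm r0; have r1n := ler_norm r1; have p0 := normr_ge0 r0; have p1 := normr_ge0 r1.
(* Level j+1 of the family is a dilate by 2^j only, so its radius measured in units of 2^(-(j+1)) is
   doubled. *)
exists (M + M'), (`|r0| + 2 * `|r1|); split.
- by rewrite addr_ge0.
- by rewrite addr_ge0// mulr_ge0.
- by move=> j; exact: test1_scaled_family.
- move=> [|j] i x ik /=.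
    by rewrite !expr0 expr1n !mulr1; apply: le_trans (hM i x ik) _; rewrite lerDl.
  have -> : dil j lam = fun x => 2 ^+ j * lam (2 ^+ j * x + 0) by apply/funext => y; rewrite addr0.
  rewrite derive1n_affine; last exact: h1.1.
  have j0 : 0 <= (2 : R) ^+ j by rewrite exprn_ge0.
  have j01 : (2 : R) ^+ j <= 2 ^+ j.+1 by rewrite exprS ler_peMl// ler1n.
  rewrite !normrM !normrX (ger0_norm (ler0n R 2)) mulrC mulrA.
  apply: ler_pM; rewrite ?mulr_ge0 ?exprn_ge0//; last by rewrite lerXn2r ?nnegrE ?exprn_ge0.
  apply: ler_pM => //; apply: le_trans (hM' i _ ik) _; rewrite lerDr//.
- move=> [|j] x /=; first by rewrite expr0 divr1 => h; apply: hr0; lra.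
  rewrite /dil ltr_pdivrMr ?exprn_gt0// exprS => h; rewrite hr1 ?mulr0//.
  by rewrite normrM normrX (ger0_norm (ler0n R 2)); rewrite mulrCA in h; rewrite [2 ^+ j * _]mulrC;
    lra.
Qed.

Definition ker (Lam : nat -> R -> R) (m : nat * nat) (x : R * R) := Lam m.1 x.1 * Lam m.2 x.2.

Section errors.
Variables (N g K : nat).
Hypotheses (gN : (0 < g < N)%N) (cop : coprime g N) (hK : (max_quotient g N <= K)%N).
Variables (n : nat) (Lam : nat -> R -> R) (M r : R).
Hypothesis hL : family_bounds (2 * n) Lam M r.

Let N0 : (0 < N)%N. Proof. by case/andP: gN => _; exact: leq_ltn_trans. Qed.
Let NR0 : 0 < N%:R :> R. Proof. by rewrite ltr0n. Qed.
Let NR1 : 1 <= N%:R :> R. Proof. by rewrite ler1n. Qed.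
Let tL j : test1 (Lam j). Proof. by case: hL. Qed.
Let M0 : 0 <= M. Proof. by case: hL. Qed.
Let r0 : 0 <= r. Proof. by case: hL. Qed.

(* The number of dyadic boxes of level |m| per lattice point. *)
Definition box_density (m : nat * nat) : R := 2 ^+ (m.1 + m.2) / N%:R.

Lemma mc2_ker m : mc2 (ker Lam m).
Proof. by apply: mc2_tens; exact: test1_mc1. Qed.

Definition ker_err (m : nat * nat) (y : R * R) := err N g (fun x => ker Lam m (x - y)).

Let shiftL j (y : R) := fun x => Lam j (x - y).

Let tshift j y : test1 (shiftL j y).
Proof.
have -> : shiftL j y = fun x => 1 * Lam j (1 * x + - y) by apply/funext => x; rewrite !mul1r.
by apply: test1_affine => //; exact: oner_neq0.
Qed.

Let bshift j y i x : (i <= 2 * n)%N -> `|derive1n i (shiftL j y) x| <= M * 2 ^+ j * (2 ^+ j) ^+ i.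
Proof.
move=> ik; have -> : shiftL j y = fun x => 1 * Lam j (1 * x + - y) by apply/funext => z;
  rewrite !mul1r.
rewrite derive1n_affine; last exact: (tL j).1.
by rewrite expr1n !mul1r; case: hL => _ _ _ + _; exact.
Qed.

Let sshift j y x : r / 2 ^+ j < `|x - y| -> shiftL j y x = 0.
Proof. by case: hL => _ _ _ _; exact. Qed.

Let ker_tens m y : (fun x => ker Lam m (x - y)) = tens (shiftL m.1 y.1) (shiftL m.2 y.2).
Proof. by []. Qed.

Let P0 j : 0 < (2 : R) ^+ j. Proof. by rewrite exprn_gt0. Qed.
Let P1 j : 1 <= (2 : R) ^+ j. Proof. by rewrite exprn_ege1// ler1n. Qed.

(** The basis is chosen to be smaller than the support of the kernel by the factor sqrt(density) in
    both directions, up to constants. Each of the 2n differences gains this factor, together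
    density^n. *)
Lemma ker_err_low m y : box_density m <= 1 ->
  `|ker_err m y| <= (4 * K.+1%:R) ^+ (2 * n) * (8 * M ^+ 2) *
     (r + (2 * n).+1%:R * 2) * (r + (2 * n).+1%:R * (2 * K.+1%:R)) * box_density m ^+ n.
Proof.
move=> s1; have s0 : 0 < box_density m by rewrite divr_gt0.
pose h0 := Num.sqrt (box_density m); have h00 : 0 < h0 by rewrite sqrtr_gt0.
have hh : h0 * h0 = box_density m by rewrite -expr2 sqr_sqrtr// ltW.
have h01 : h0 <= 1 by rewrite -sqrtr1 ler_sqrt.
(* This value balances the two directions: [a1] 2^(m_1) = 2 [h0] and [a2] 2^(m_2) = 2(K + 1)
   [h0]. *)
pose t := N%:R / 2 ^+ m.1 * h0; have t0 : 0 < t by rewrite mulr_gt0// divr_gt0.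
have P12 := exprD (2 : R) m.1 m.2.
have sN : 2 ^+ m.1 * 2 ^+ m.2 = box_density m * N%:R by rewrite -P12 /box_density divfK// gt_eqF.
(* t^2 = N 2^(m_2) / 2^(m_1), and 2^(m_1) <= 2^|m| <= N on coarse levels. *)
have t1 : 1 <= t.
  have : 1 <= t * t.
    have -> : t * t = N%:R * 2 ^+ m.2 / 2 ^+ m.1.
      transitivity (N%:R / 2 ^+ m.1 * (N%:R / 2 ^+ m.1) * (h0 * h0)); first by rewrite /t; ring.
      by rewrite hh /box_density P12; field; rewrite !gt_eqF.
    rewrite ler_pdivlMr// mul1r; apply: (@le_trans _ _ (2 ^+ m.1 * 2 ^+ m.2)).
      by rewrite ler_peMr// ltW.
    rewrite sN; apply: (@le_trans _ _ (N%:R)); last by rewrite ler_peMr// ltW.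
    by rewrite ler_piMl// ltW.
  by rewrite leNgt (leNgt 1 t); apply: contra => h; rewrite -[ltRHS]mulr1 ltr_pM// ltW.
have tN : t <= N%:R.
  rewrite /t -mulrA ler_piMr ?(ltW NR0)// mulr_ile1 ?invr_ge0 ?(ltW h00) ?(ltW (P0 _))//.
  by rewrite invf_le1.
have [u [v [til u1 v1 u2 v2]]] := reduced_basis N0 gN cop hK t1 tN.
pose a1 := 2 * (t / N%:R); pose a2 := 2 * (K.+1%:R / t).
have e1 : a1 / 2 = t / N%:R by rewrite /a1; field; rewrite gt_eqF.
have e2 : a2 / 2 = K.+1%:R / t by rewrite /a2; field; rewrite gt_eqF.
rewrite -e1 in u1 v1; rewrite -e2 in u2 v2.
have ar1 : a1 * 2 ^+ m.1 = 2 * h0 by rewrite /a1 /t; field; rewrite !gt_eqF.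
have ar2 : a2 * 2 ^+ m.2 = 2 * K.+1%:R * h0.
  rewrite /a2 /t; apply: (@mulIf _ h0); first by rewrite gt_eqF.
  rewrite -[RHS]mulrA hh /box_density P12; field; rewrite !gt_eqF//.
pose h := 2 * K.+1%:R * h0.
have K1 : 1 <= K.+1%:R :> R by rewrite ler1n.
have hge0 : 0 <= h by rewrite /h !mulr_ge0// ltW.
have ar1' : a1 * 2 ^+ m.1 <= h by rewrite ar1 /h -mulrA ler_wpM2l// ler_peMl// ltW.
have ar2' : a2 * 2 ^+ m.2 <= h by rewrite ar2.
rewrite /ker_err ker_tens.
have B := err_tens N0 til u1 v1 u2 v2 (k := 2 * n) (ltW (P0 m.1)) (ltW (P0 m.2)) hge0 ar1' ar2'
  (c1 := y.1) (c2 := y.2) (b1 := r / 2 ^+ m.1) (b2 := r / 2 ^+ m.2) (M1 := M * 2 ^+ m.1)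
    (M2 := M * 2 ^+ m.2)
  (tshift m.1 y.1) (tshift m.2 y.2).
have {}B := B (divr_ge0 r0 (ltW (P0 _))) (divr_ge0 r0 (ltW (P0 _))) (mulr_ge0 M0 (ltW (P0 _)))
  (mulr_ge0 M0 (ltW (P0 _))) (@sshift m.1 y.1) (@sshift m.2 y.2) (@bshift m.1 y.1)
    (@bshift m.2 y.2).
apply: le_trans B _; set k := (2 * n)%N.
have E1 : 2 ^+ m.1 * (r / 2 ^+ m.1 + k.+1%:R * a1) = r + k.+1%:R * (2 * h0).
  by rewrite -ar1; field; rewrite gt_eqF.
have E2 : 2 ^+ m.2 * (r / 2 ^+ m.2 + k.+1%:R * a2) = r + k.+1%:R * (2 * K.+1%:R * h0).
  by rewrite -ar2; field; rewrite gt_eqF.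
have -> : 8 * (M * 2 ^+ m.1 * (M * 2 ^+ m.2)) * (r / 2 ^+ m.1 + k.+1%:R * a1)
  * (r / 2 ^+ m.2 + k.+1%:R * a2)
  = 8 * M ^+ 2 * (2 ^+ m.1 * (r / 2 ^+ m.1 + k.+1%:R * a1))
    * (2 ^+ m.2 * (r / 2 ^+ m.2 + k.+1%:R * a2)) by ring.
rewrite E1 E2.
have -> : (2 * h) ^+ k = (4 * K.+1%:R) ^+ k * box_density m ^+ n.
  by rewrite -hh -expr2 -exprM -exprMn /h; congr (_ ^+ _); ring.
have kk : 0 <= k.+1%:R :> R by [].
have X1 : r + k.+1%:R * (2 * h0) <= r + k.+1%:R * 2.
  by rewrite lerD2l ler_wpM2l// -[leRHS]mulr1 ler_wpM2l.
have X2 : r + k.+1%:R * (2 * K.+1%:R * h0) <= r + k.+1%:R * (2 * K.+1%:R).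
  by rewrite lerD2l ler_wpM2l// -[leRHS]mulr1 ler_wpM2l.
have Y1 : 0 <= r + k.+1%:R * (2 * h0) by rewrite addr_ge0// !mulr_ge0// ltW.
have Y2 : 0 <= r + k.+1%:R * (2 * K.+1%:R * h0) by rewrite addr_ge0// !mulr_ge0// ltW.
have -> : forall a b c d e : R, a * b * (c * d * e) = a * c * d * e * b by move=> *; ring.
rewrite ler_wpM2r// ?exprn_ge0 ?(ltW s0)//.
apply: ler_pM => //; first by rewrite !mulr_ge0// ?exprn_ge0// mulr_ge0.
apply: ler_wpM2l => //; by rewrite !mulr_ge0// ?exprn_ge0// mulr_ge0.
Qed.

Let M2 m : 0 <= M * 2 ^+ m.1 * (M * 2 ^+ m.2) :> R.
Proof. by rewrite !mulr_ge0// ltW. Qed.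

Let kb m y x : `|ker Lam m (x - y)| <= M * 2 ^+ m.1 * (M * 2 ^+ m.2).
Proof.
rewrite normrM ler_pM//.
  by have := @bshift m.1 y.1 0%N x.1 (leq0n _); rewrite expr0 mulr1.
by have := @bshift m.2 y.2 0%N x.2 (leq0n _); rewrite expr0 mulr1.
Qed.

Let ks m y x : r / 2 ^+ m.1 < `|x.1 - y.1| \/ r / 2 ^+ m.2 < `|x.2 - y.2| -> ker Lam m (x - y) = 0.
Proof. by case=> h; rewrite /ker -[Lam m.1 _]/(shiftL m.1 y.1 x.1) -[Lam m.2 _]/(shiftL m.2 y.2 x.2)
  (sshift h) ?mul0r ?mulr0. Qed.

Let ks' m y x : r / 2 ^+ m.1 < `|y.1 - x.1| \/ r / 2 ^+ m.2 < `|y.2 - x.2| -> ker Lam m (x - y) = 0.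
Proof. by rewrite distrC (distrC y.2); exact: ks. Qed.

Let rP j : 0 <= r / 2 ^+ j. Proof. by rewrite divr_ge0// ltW. Qed.

(** No cancellation is sought here, only a count of points. With t = N/2^(m_1) the basis is about as
    wide as the box; if the box is narrower than 1/N, t = 1 is the smallest admissible value. *)
Lemma ker_err_high m y : 1 <= box_density m ->
  `|ker_err m y| <= 8 * M ^+ 2 * (r + 2) * (r + 2 * K.+1%:R) * box_density m.
Proof.
move=> s1; pose t : R := Num.max 1 (N%:R / 2 ^+ m.1).
have K1 : 1 <= K.+1%:R :> R by rewrite ler1n.
have t1 : 1 <= t by rewrite le_max lexx.
have t0 : 0 < t by apply: lt_le_trans t1.
have tN : t <= N%:R by rewrite ge_max NR1 ler_pdivrMr// ler_peMr// ltW.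
have [u [v [til u1 v1 u2 v2]]] := reduced_basis N0 gN cop hK t1 tN.
pose a1 := 2 * (t / N%:R); pose a2 := 2 * (K.+1%:R / t).
have e1 : a1 / 2 = t / N%:R by rewrite /a1; field; rewrite gt_eqF.
have e2 : a2 / 2 = K.+1%:R / t by rewrite /a2; field; rewrite gt_eqF.
rewrite -e1 in u1 v1; rewrite -e2 in u2 v2.
have B := err_box N0 til u1 v1 u2 v2 (F := fun x => ker Lam m (x - y)) (M2 m) (rP m.1) (rP m.2)
  (mc2_shift (- y) (mc2_ker m)) (kb m y) (@ks m y).
apply: le_trans B _.
have -> : 8 * (M * 2 ^+ m.1 * (M * 2 ^+ m.2)) * (r / 2 ^+ m.1 + a1) * (r / 2 ^+ m.2 + a2) =
   8 * M ^+ 2 * ((r + 2 ^+ m.1 * a1) * (r + 2 ^+ m.2 * a2)).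
  by field; rewrite !gt_eqF.
have -> : 8 * M ^+ 2 * (r + 2) * (r + 2 * K.+1%:R) * box_density m =
  8 * M ^+ 2 * ((r + 2) * (r + 2 * K.+1%:R) * box_density m) by ring.
rewrite ler_wpM2l//; first by rewrite mulr_ge0// exprn_ge0.
have P12 := exprD (2 : R) m.1 m.2.
have rs : r <= r * box_density m by rewrite ler_peMr.
have K2 : 0 <= 2 * K.+1%:R :> R by rewrite mulr_ge0.
have [h|h] := leP (2 ^+ m.1 : R) N%:R.
  have tE : t = N%:R / 2 ^+ m.1 by apply: max_idPr; rewrite ler_pdivlMr// mul1r.
  have -> : 2 ^+ m.1 * a1 = 2 by rewrite /a1 tE; field; rewrite !gt_eqF.
  have -> : 2 ^+ m.2 * a2 = 2 * K.+1%:R * box_density m by rewrite /a2 tE /box_density P12; field;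
    rewrite !gt_eqF.
  rewrite -[leRHS]mulrA ler_wpM2l ?addr_ge0// [leRHS]mulrDl lerD2r//.
have tE : t = 1 by apply: max_idPl; rewrite ler_pdivrMr// mul1r ltW.
have -> : 2 ^+ m.1 * a1 = 2 * (2 ^+ m.1 / N%:R) by rewrite /a1 tE; field; rewrite !gt_eqF.
have -> : 2 ^+ m.2 * a2 = 2 * K.+1%:R * 2 ^+ m.2 by rewrite /a2 tE divr1 mulrC.
have -> : (r + 2) * (r + 2 * K.+1%:R) * box_density m = ((r + 2) * (2 ^+ m.1 / N%:R))
  * ((r + 2 * K.+1%:R) * 2 ^+ m.2).
  by rewrite /box_density P12; ring.
have q1 : 1 <= 2 ^+ m.1 / N%:R :> R by rewrite ler_pdivlMr// mul1r ltW.
apply: ler_pM.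
- by rewrite addr_ge0// mulr_ge0// (le_trans _ q1).
- by rewrite addr_ge0// mulr_ge0// ltW.
- by rewrite [leRHS]mulrDl lerD2r ler_peMr.
- by rewrite [leRHS]mulrDl lerD2r ler_peMr.
Qed.

Lemma lsum_I2_seq H : mc4 H -> exists s : seq (int * int), forall y,
  lsum N g (fun x => H (x, y)) = N%:R^-1 * \sum_(z <- s) H (lattice_pt N g z, y).
Proof.
move=> [_ [MM [rr hh]]]; have [s hs] := lsum_seq g N0 rr; exists s => y; rewrite hs// => x hx.
by have [_ ->//] := hh (x, y); rewrite /nm4 /pgauge lt_max hx.
Qed.

Lemma lsum_I2_out H : mc4 H -> exists s : seq (int * int),
  lsum N g (fun x => I2 (fun y => H (x, y))) = N%:R^-1 * \sum_(z <- s) I2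
    (fun y => H (lattice_pt N g z, y))
  /\ forall y, lsum N g (fun x => H (x, y)) = N%:R^-1 * \sum_(z <- s) H (lattice_pt N g z, y).
Proof.
move=> [_ [MM [rr hh]]]; have [s hs] := lsum_seq g N0 rr; exists s; split => [|y];
  rewrite hs// => x hx.
  rewrite -I20; apply: I2_ext => y; by have [_ ->//] := hh (x, y); rewrite /nm4 /pgauge lt_max hx.
by have [_ ->//] := hh (x, y); rewrite /nm4 /pgauge lt_max hx.
Qed.

Lemma mc2_lsum H : mc4 H -> mc2 (fun y => lsum N g (fun x => H (x, y))).
Proof.
move=> hH; have [s hs] := lsum_I2_seq hH.
rewrite (_ : (fun y => _) = fun y => N%:R^-1 * \sum_(z <- s) H (lattice_pt N g z, y));
  last exact/funext.
exact: (mcsZ _ (mcs_sum _ _ (fun z => mc2_xsec (lattice_pt N g z) hH))).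
Qed.

Lemma lsum_I2 H : mc4 H ->
  lsum N g (fun x => I2 (fun y => H (x, y))) = I2 (fun y => lsum N g (fun x => H (x, y))).
Proof.
move=> hH; have [s [-> hs]] := lsum_I2_out hH.
rewrite (I2_ext hs) I2Z; last exact: (mcs_sum _ _ (fun z => mc2_xsec (lattice_pt N g z) hH)).
by rewrite I2_sum// => z; exact: mc2_xsec.
Qed.

Lemma mc4_swap H : mc4 H -> mc4 (fun z => H (z.2, z.1)).
Proof.
move=> [mH [MM [rr hh]]]; split; first exact: (measurableT_comp mH (@measurable_swap _ _ _ _)).
by exists MM, rr => -[x y]; have := hh (y, x); rewrite /nm4 /pgauge /= maxC.
Qed.

Lemma mc2_err H : mc4 H -> mc2 (fun y => err N g (fun x => H (x, y))).
Proof. by move=> hH; apply: mcsB; [exact: (mc2_partial (mc4_swap hH))|exact: mc2_lsum]. Qed.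

Lemma err_I2 H : mc4 H ->
  err N g (fun x => I2 (fun y => H (x, y))) = I2 (fun y => err N g (fun x => H (x, y))).
Proof.
move=> hH; rewrite /err lsum_I2// I2_swap// -I2B//; last exact: mc2_lsum.
exact: (mc2_partial (mc4_swap hH)).
Qed.

(* The square [-2, 2]^2 contains the support of [Psi_m * f] if [f] is supported in
   the unit square. *)
Definition window (y : R * R) := tens (box_ind 0 2) (box_ind 0 2) y.

Lemma mc2_window : mc2 window.
Proof. by apply: mc2_tens; exact: mc1_box_ind. Qed.

Lemma window_ge0 y : 0 <= window y.
Proof. by rewrite mulr_ge0// box_ind_ge0. Qed.

Lemma I2_window : I2 window = 16.
Proof. rewrite I2_tens; [|exact: mc1_box_ind..]; rewrite I1_box_ind//; ring. Qed.

Lemma mc2_ker_err m F : mc2 F -> mc2 (fun y => F y * ker_err m y).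
Proof.
move=> hF; rewrite (_ : (fun y => _) = fun y => err N g (fun x => ker Lam m (x - y) * F y)).
  exact: (mc2_err (mc4_conv (mc2_ker m) hF)).
apply/funext => y; rewrite /ker_err -errZ//; last exact: (mc2_shift (- y) (mc2_ker m)).
by congr err; apply/funext => x; rewrite mulrC.
Qed.

(** The error functional commutes with the integral over y, which moves it from the block of f onto
    the kernel. What remains is a pairing of two functions, ready for Hoelder. *)
Lemma err_conv m F : mc2 F ->
  err N g (fun x => I2 (fun y => ker Lam m (x - y) * F y)) = I2 (fun y => F y * ker_err m y).
Proof.
move=> hF; rewrite (err_I2 (mc4_conv (mc2_ker m) hF)); apply: I2_ext => y.
rewrite /ker_err -errZ//; last exact: (mc2_shift (- y) (mc2_ker m)).
by congr err; apply/funext => x; rewrite mulrC.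
Qed.

Lemma window_out y : 2 < `|y.1| \/ 2 < `|y.2| -> window y = 0.
Proof.
have o (x : R) : 2 < `|x| -> box_ind 0 2 x = 0.
  move=> h; rewrite /box_ind indicE memNset//= in_itv /= => /andP[h1 h2].
  have h3 : `|x| <= 2 by rewrite ler_norml; apply/andP; split; lra.
  lra.
by move=> [] h; rewrite /window /tens (o _ h) ?mul0r ?mulr0.
Qed.

Lemma window_le1 y : window y <= 1.
Proof.
have b c d (x : R) : box_ind c d x <= 1 by rewrite /box_ind indicE; case: (_ \in _).
by rewrite /window /tens mulr_ile1// box_ind_ge0.
Qed.

(** Bound the error by integral plus lattice sum of |kernel| and integrate over y before summing:
    the inner integral is then at most 4 M^2 r^2 and lives in a box of fixed size, where the basis
    for t = 1 counts the points. The height of the kernel has disappeared. *)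
Lemma ker_err_L1 m : I2 (fun y => `|window y * ker_err m y|) <=
  (4 * M ^+ 2 * r ^+ 2) * 16 + (4 * M ^+ 2 * r ^+ 2) * (4 * (2 + r + 2) * (2 + r + 2 * K.+1%:R)).
Proof.
have [u [v [til u1 v1 u2 v2]]] := reduced_basis N0 gN cop hK (lexx 1) NR1.
pose a1 : R := 2; pose a2 : R := 2 * K.+1%:R.
have h1 : 1 / N%:R <= a1 / 2 :> R by rewrite /a1 divff// mul1r invf_le1.
have e2 : a2 / 2 = K.+1%:R / 1 by rewrite /a2 divr1 mulrC mulKf//.
have u1' := le_trans u1 h1; have v1' := le_trans v1 h1; rewrite -e2 in u2 v2.
pose c := 4 * M ^+ 2 * r ^+ 2; rewrite -/c.
have cE m' : M * 2 ^+ m'.1 * (M * 2 ^+ m'.2) * (4 * (r / 2 ^+ m'.1) * (r / 2 ^+ m'.2)) = c.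
  by rewrite /c; field; rewrite !gt_eqF.
have c0 : 0 <= c by rewrite /c !mulr_ge0 ?exprn_ge0.
pose H (z : (R * R) * (R * R)) := `|ker Lam m (z.1 - z.2) * window z.2|.
have hH : mc4 H := mcs_abs (mc4_conv (mc2_ker m) mc2_window).
have hI : mc2 (fun x => I2 (fun y => H (x, y))) := mc2_partial hH.
apply: (@le_trans _ _ (I2 (fun y => c * window y + lsum N g (fun x => H (x, y))))).
  apply: le_I2.
  - exact: (mcs_abs (mc2_ker_err m mc2_window)).
  - by apply: mcsD; [exact: (mcsZ c mc2_window)|exact: (mc2_lsum hH)].
  move=> y; have mk := mc2_shift (- y) (mc2_ker m); have [rr _ br] := mc2_bsupp mk.
  rewrite normrM (ger0_norm (window_ge0 _)) /ker_err.
  have -> : lsum N g (fun x => H (x, y)) = window y * lsum N g (fun x => `|ker Lam m (x - y)|).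
    rewrite -(@lsumZ _ N g N0 _ (window y) rr); last by move=> x /br ->; rewrite normr0.
    by apply: lsum_ext => x; rewrite /H normrM (ger0_norm (window_ge0 _)) mulrC.
  rewrite [c * _]mulrC -mulrDr ler_wpM2l ?window_ge0//.
  apply: le_trans (ler_normB _ _) _; apply: lerD; last exact: (norm_lsum g N0 br).
  by have := I2_box (M2 m) (rP m.1) (rP m.2) mk (kb m y) (@ks m y); rewrite cE.
rewrite I2D; [|exact: (mcsZ c mc2_window)|exact: (mc2_lsum hH)].
rewrite I2Z ?I2_window; last exact: mc2_window.
rewrite lerD2l -lsum_I2//.
have r2 j : r / 2 ^+ j <= r by rewrite ler_pdivrMr// ler_peMr.
have r20 : 0 <= 2 + r by rewrite addr_ge0.
have [rr _ br] := mc2_bsupp hI.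
have IP x : 0 <= I2 (fun y => H (x, y)) by apply: I2_ge0 => y; rewrite /H.
have -> : lsum N g (fun x => I2 (fun y => H (x, y))) =
  lsum N g (fun x => `|I2 (fun y => H (x, y))|).
  by apply: lsum_ext => x; rewrite ger0_norm.
apply: (lsum_box N0 til u1' v1' u2 v2 (c1 := 0) (c2 := 0) c0 r20 r20 (ex_intro _ rr br)).
- move=> x; rewrite ?normr_id; have := I2_box (M2 m) (rP m.1) (rP m.2) (mc2_xsec x hH)
  (c1 := x.1) (c2 := x.2).
  rewrite cE; apply => y.
    rewrite /H normr_id normrM (ger0_norm (window_ge0 _)) -[leRHS]mulr1 ler_pM ?window_ge0//.
    exact: window_le1.
  by move=> /ks' /= h; rewrite /H /= h mul0r normr0.
move=> x hx; rewrite -I20; apply: I2_ext => y; rewrite /H /=.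
have [h|/not_orP[/negP h /negP h']] := pselect (r / 2 ^+ m.1 < `|x.1 - y.1| \/ r / 2 ^+ m.2 <
  `|x.2 - y.2|).
  by rewrite ks// mul0r normr0.
rewrite -!leNgt in h h'; rewrite window_out ?mulr0 ?normr0//.
have q1 := ler_normD (x.1 - y.1) y.1; have q2 := ler_normD (x.2 - y.2) y.2; rewrite !subrK in q1 q2.
have s1 := r2 m.1; have s2 := r2 m.2; rewrite !subr0 in hx.
by case: hx => hx; [left|right]; lra.
Qed.

End errors.
End kernels.

(** * Expanding the cubature error over all blocks *)

Section decomposition.
Context {R : realType}.
Implicit Types (F G f : R * R -> R) (q : R -> R).

Definition conv2 F f (x : R * R) := I2 (fun y => F (x - y) * f y).

Lemma conv2_int F f x : mc2 F -> mc2 f -> mc2 (fun y => F (x - y) * f y).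
Proof. by move=> hF hf; apply: mc2_mul => //; exact: mc2_sub. Qed.

Lemma mc2_conv2 F f : mc2 F -> mc2 f -> mc2 (conv2 F f).
Proof. by move=> hF hf; exact: (mc2_partial (mc4_conv hF hf)). Qed.

Lemma I2_conv2 F f : mc2 F -> mc2 f -> I2 (conv2 F f) = I2 F * I2 f.
Proof.
move=> hF hf; rewrite /conv2 (I2_swap (mc4_conv hF hf)) /= -I2Z//; apply: I2_ext => y.
under I2_ext do rewrite mulrC.
by rewrite I2Z 1?mulrC ?I2_shift//; exact: (mc2_shift (- y) hF).
Qed.

Lemma mc2_ker_family (Lam : nat -> R -> R) m : (forall j, test1 (Lam j)) -> mc2 (ker Lam m).
Proof. by move=> h; apply: mc2_tens; exact: test1_mc1. Qed.

Lemma I2_tens_abs (a b : R -> R) : mc1 a -> mc1 b ->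
  I2 (fun x => `|tens a b x|) = I1 (fun x => `|a x|) * I1 (fun x => `|b x|).
Proof.
move=> ha hb; rewrite -(I2_tens (mcs_abs ha) (mcs_abs hb)); apply: I2_ext => x.
by rewrite /tens normrM.
Qed.

Lemma dil_abs k q : (fun x => `|dil k q x|) = dil k (fun x => `|q x|).
Proof. by apply/funext => x; rewrite /dil normrM normrX ger0_norm. Qed.

(** Since [q] may change sign, the L1 norm c of [q] enters the tolerance through c^2 + 1. Continuity
    is asked at the single point x so that the lemma also covers functions cut off to a box. *)
Lemma mollifier_cvg q f x e : test1 q -> I1 q = 1 -> mc2 f -> {for x, continuous f} -> 0 < e ->
  exists J0 : nat, forall J, (J0 <= J)%N -> `|conv2 (tens (dil J q) (dil J q)) f x - f x| <= e.
Proof.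
move=> hq iq hf cf e0; have mq := test1_mc1 hq; have [_ [r0 hr0]] := hq.
pose c := I1 (fun t => `|q t|); have c0 : 0 <= c by apply: I1_ge0.
pose e' := e / (c * c + 1); have cc0 : 0 < c * c + 1 by rewrite ltr_wpDl// mulr_ge0.
have e'0 : 0 < e' by rewrite divr_gt0.
have [d d0 hd] : exists2 d : R, 0 < d & forall y : R * R, `|y.1| < d -> `|y.2| < d ->
  `|f (x - y) - f x| <= e'.
  have := cf; move=> /cvgrPdist_le /(_ e' e'0) /nbhs_ballP[d /= d0 hd].
  exists d => // y y1 y2; rewrite distrC; apply: hd; split; rewrite /= /ball /=.
    by rewrite subKr.
  by rewrite subKr.
have [J0 hJ0] := nat_bound (`|r0| / d + 1).
exists J0 => J JJ0; have md := mc1_dil J mq; have mk := mc2_tens md md.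
set k := tens _ _; have ik : I2 k = 1 by rewrite I2_tens// I1_dil// iq mulr1.
have ksupp y : k y != 0 -> `|y.1| < d /\ `|y.2| < d.
  have hs (t : R) : dil J q t != 0 -> `|t| < d.
    move=> h; rewrite ltNge; apply: contra h => h; rewrite /dil hr0 ?mulr0//.
    rewrite normrM normrX (ger0_norm (ler0n R 2)).
    have J2 : (J%:R : R) <= 2 ^+ J.
      by rewrite -natrX ler_nat ltnW// ltn_expl.
    have JJ : (J0%:R : R) <= J%:R by rewrite ler_nat.
    have : (`|r0| / d + 1) * d <= 2 ^+ J * `|t|.
      apply: ler_pM => //; rewrite ?addr_ge0// ?divr_ge0// ?(ltW d0)//.
      exact: le_trans hJ0 (le_trans JJ J2).
    rewrite mulrDl mul1r divfK ?gt_eqF//; have := ler_norm r0; lra.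
  by rewrite /k /tens mulf_eq0 negb_or => /andP[/hs ? /hs].
have mf' : mc2 (fun y => k y * (f (x - y) - f x)).
  apply: mcsMr => //.
    apply: measurable_funB => //; exact: (mf_sub2 x (mc2_meas hf)).
  have [M fM] := mc2_bnd hf; exists (M + `|f x|) => y.
  by apply: le_trans (ler_normB _ _) _; rewrite lerD2r.
have -> : conv2 k f x - f x = I2 (fun y => k y * (f (x - y) - f x)).
  have h1 := conv2_int x mk hf; have h2 := mc2_sub x h1.
  have -> : conv2 k f x = I2 (fun y => k y * f (x - y)).
    rewrite /conv2 -(I2_sub x h1); apply: I2_ext => y.
    by rewrite subKr.
  have E : f x = I2 (fun y => f x * k y) by rewrite I2Z// ik mulr1.
  rewrite [X in _ - X]E.
  rewrite -I2B; last 2 first.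
  - rewrite (_ : (fun y => k y * f (x - y)) = (fun y => k (x - (x - y)) * f (x - y)))//.
    by apply/funext => y; rewrite subKr.
  - exact: mcsZ.
  by apply: I2_ext => y; ring.
apply: (@le_trans _ _ (I2 (fun y => e' * `|k y|))).
  apply: norm_I2 => //; first exact: (mcsZ e' (mcs_abs mk)).
  move=> y; rewrite normrM mulrC; have [->|ky] := eqVneq (k y) 0; first by rewrite normr0 !mulr0.
  by have [y1 y2] := ksupp y ky; rewrite ler_wpM2r// hd.
rewrite I2Z; last exact: (mcs_abs mk).
rewrite I2_tens_abs// dil_abs I1_dil; last exact: mcs_abs.
rewrite -/c /e' mulrAC ler_pdivrMr// ler_wpM2l ?(ltW e0)//.
by rewrite lerDl.
Qed.

Section reproduced.
Variables (Lam Psi : nat -> R -> R) (q : R -> R) (f : R * R -> R).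
Hypotheses (hL : forall j, test1 (Lam j)) (hP : forall j, test1 (Psi j)) (hq : test1 q)
  (iq : I1 q = 1)
  (hf : mc2 f).
Hypothesis rep : forall J x, \sum_(j < J.+1) convol (Lam j) (Psi j) x = dil J q x.

(** Associativity of convolution in two variables: applying the kernel [Lam] after the kernel [Psi]
    is convolving with the tensor of their one-dimensional convolutions. *)
Lemma conv2_pair m x :
  I2 (fun y => convol (Lam m.1) (Psi m.1) (x.1 - y.1) * convol (Lam m.2) (Psi m.2)
    (x.2 - y.2) * f y) =
  I2 (fun z => ker Lam m (x - z) * conv2 (ker Psi m) f z).
Proof.
have mL := mc2_ker_family m hL; have mP := mc2_ker_family m hP.
pose H (z : (R * R) * (R * R)) := ker Lam m (x - z.1) * (ker Psi m (z.1 - z.2) * f z.2).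
have hH : mc4 H.
  have h4 := mc4_conv mP hf.
  have m4 : measurable_fun setT (fun z : (R * R) * (R * R) => ker Lam m (x - z.1)).
    exact: (measurableT_comp (mf_sub2 x (mc2_meas mL)) measurable_fst).
  apply: (mcsM h4 m4).
  by have [M LM] := mc2_bnd mL; exists M => z.
transitivity (I2 (fun y => I2 (fun z => H (z, y)))).
  apply: I2_ext => y.
  have m1 := conv_int (x.1 - y.1) (test1_mc1 (hL m.1)) (test1_mc1 (hP m.1)).
  have m2 := conv_int (x.2 - y.2) (test1_mc1 (hL m.2)) (test1_mc1 (hP m.2)).
  have n1 := mc1_shift (- y.1) m1; have n2 := mc1_shift (- y.2) m2.
  rewrite /convol -(I1_shift (- y.1) m1) -(I1_shift (- y.2) m2) -I2_tens// mulrC -I2Z;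
    last exact: mc2_tens.
  apply: I2_ext => z; rewrite /H /tens /ker /=.
  have E (a b c : R) : a - b - (c - b) = a - c by ring.
  by rewrite !E; ring.
rewrite -(I2_swap hH); apply: I2_ext => z; rewrite /H /= I2Z//.
exact: conv2_int.
Qed.

(** The one-dimensional identity [rep] is used in each variable and multiplied out, so the
    truncation is a square of indices rather than a set of levels. *)
Lemma conv2_dil_sum J x : conv2 (tens (dil J q) (dil J q)) f x =
  \sum_(i < J.+1) \sum_(j < J.+1) I2 (fun z => ker Lam (i : nat, j : nat) (x - z) * conv2
    (ker Psi (i : nat, j : nat)) f z).
Proof.
have mc j := mc1_convolution (test1_mc1 (hL j)) (test1_mc1 (hP j)).
have mcc i j : mc2 (fun y => convol (Lam i) (Psi i) (x.1 - y.1) * convol (Lam j) (Psi j)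
  (x.2 - y.2) * f y).
  exact: (conv2_int x (mc2_tens (mc i) (mc j)) hf).
rewrite /conv2; transitivity (I2 (fun y => \sum_(i < J.+1) \sum_(j < J.+1)
   (convol (Lam i) (Psi i) (x.1 - y.1) * convol (Lam j) (Psi j) (x.2 - y.2) * f y))).
  apply: I2_ext => y; rewrite /tens -!rep big_distrlr /= mulr_suml; apply: eq_bigr => i _.
  by rewrite mulr_suml.
rewrite I2_sum; last by move=> i; exact: (mcs_sum _ _ (fun j : 'I_J.+1 => mcc i j)).
apply: eq_bigr => i _; rewrite I2_sum; last by move=> j.
apply: eq_bigr => j _.
exact: (conv2_pair (i : nat, j : nat)).
Qed.

Variables (N g : nat).
Hypothesis N0 : (0 < N)%N.

Lemma err_sum (J : nat) (F : 'I_J -> R * R -> R) : (forall i, mc2 (F i)) ->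
  err N g (fun x => \sum_(i < J) F i x) = \sum_(i < J) err N g (F i).
Proof.
elim: J F => [|J IH] F hF.
  rewrite big_ord0 /err -[RHS](subrr 0); congr (_ - _).
    by rewrite -[RHS]I20; apply: I2_ext => x; rewrite big_ord0.
  have [s hs] := lsum_seq g N0 (0 : R); rewrite hs; last by move=> x _; rewrite big_ord0.
  by rewrite big1 ?mulr0// => i _; rewrite big_ord0.
rewrite big_ord_recr /= -IH; last by move=> i.
rewrite -errD//; last exact: (mcs_sum _ _ (fun i : 'I_J => hF (widen_ord (leqnSn J) i))).
by congr err; apply/funext => x; rewrite big_ord_recr.
Qed.

Lemma err_mollified n M r J : (0 < g)%N -> (g < N)%N -> family_bounds (2 * n) Lam M r ->
  err N g (conv2 (tens (dil J q) (dil J q)) f) =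
  \sum_(i < J.+1) \sum_(j < J.+1)
    I2 (fun z => conv2 (ker Psi (i : nat, j : nat)) f z * ker_err N g Lam (i : nat, j : nat) z).
Proof.
move=> g0 gN hLb; have mh m : mc2 (conv2 (ker Psi m) f) by apply: mc2_conv2 => //;
  exact: mc2_ker_family.
have mt m : mc2 (fun x => I2 (fun z => ker Lam m (x - z) * conv2 (ker Psi m) f z)).
  by apply: mc2_conv2 => //; exact: mc2_ker_family.
rewrite (_ : conv2 _ f = fun x => \sum_(i < J.+1) \sum_(j < J.+1)
   I2 (fun z => ker Lam (i : nat, j : nat) (x - z) * conv2 (ker Psi (i : nat, j : nat)) f z));
     last first.
  by apply/funext => x; exact: conv2_dil_sum.
rewrite err_sum; last by move=> i; exact: (mcs_sum _ _ (fun j : 'I_J.+1 => mt (i : nat, j : nat))).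
apply: eq_bigr => i _; rewrite err_sum; last by move=> j.
apply: eq_bigr => j _; apply: (err_conv _ hLb) => //; by rewrite g0.
Qed.

(** Mollifying with I1 q = 1 leaves the integral unchanged, and the lattice sum involves finitely
    many points, the same for all J. Hence pointwise convergence suffices, with tolerance e N /
    (size + 1) at each point. *)
Lemma err_mollified_cvg e : continuous f -> 0 < e ->
  exists J0, forall J, (J0 <= J)%N -> `|err N g (conv2 (tens (dil J q) (dil J q)) f) - err N g f| <=
    e.
Proof.
move=> cf e0; have mq := test1_mc1 hq.
have [r r0 br] := mc2_bsupp hf.
have [_ [rq hrq]] := hq.
pose r' := r + `|rq|; have [s hs] := lsum_seq g N0 r'.
have [J0 hJ0] : exists J0, forall J, (J0 <= J)%N -> forall z, z \in s ->
   `|conv2 (tens (dil J q) (dil J q)) f (lattice_pt N g z) - f (lattice_pt N g z)| <=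
     e * N%:R / (size s).+1%:R.
  have e1 : 0 < e * N%:R / (size s).+1%:R by rewrite divr_gt0// mulr_gt0// ltr0n.
  elim: s {hs} (e * N%:R / (size s).+1%:R) e1 => [|z s IH] e1 e10; first by exists 0%N.
  have [J1 h1] := IH _ e10; have [J2 h2] := mollifier_cvg (x := lattice_pt N g z) hq iq
    hf (cf _) e10.
  exists (maxn J1 J2) => J; rewrite geq_max => /andP[q1 q2] z'; rewrite inE => /orP[/eqP ->|];
    first exact: h2.
  exact: h1.
exists J0 => J JJ; have md := mc1_dil J mq; have mk := mc2_tens md md.
have mc := mc2_conv2 mk hf.
rewrite /err I2_conv2// I2_tens// I1_dil// iq !mul1r.
set A := lsum _ _ (conv2 _ _); set B := lsum _ _ f.
have -> : I2 f - A - (I2 f - B) = B - A by ring.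
rewrite /A /B {A B}.
have bf : bsupp r' f by apply: bsuppW br; rewrite lerDl.
have bc : bsupp r' (conv2 (tens (dil J q) (dil J q)) f).
  move=> x; rewrite nm2_gt => hx; rewrite -I20; apply: I2_ext => y.
  have [h|h] := ltP r (nm2 y); first by rewrite br// mulr0.
  move: h; rewrite nm2_le => /andP[y1 y2].
  have dq (t : R) : `|rq| < `|t| -> dil J q t = 0.
    move=> ht; rewrite /dil hrq ?mulr0// normrM normrX (ger0_norm (ler0n R 2)).
    apply: (le_lt_trans (ler_norm _)); apply: (lt_le_trans ht); rewrite ler_peMl//.
    by rewrite exprn_ege1// ler1n.
  have q1 := ler_normD (x.1 - y.1) y.1; have q2 := ler_normD (x.2 - y.2) y.2;
    rewrite !subrK in q1 q2.
  rewrite /tens; case/orP: hx => hx; first by rewrite dq ?mul0r//= ltNge; apply/negP => h;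
    rewrite /r' in hx; lra.
  by rewrite [dil J q (x - y).2]dq ?mulr0 ?mul0r//= ltNge; apply/negP => h; rewrite /r' in hx; lra.
rewrite (hs _ bf) (hs _ bc) -mulrBr -sumrB normrM ger0_norm ?invr_ge0//.
rewrite mulrC ler_pdivrMr ?ltr0n//.
apply: le_trans (ler_norm_sum _ _ _) _.
rewrite big_seq; apply: (@le_trans _ _ (\sum_(z <- s | z \in s) (e * N%:R / (size s).+1%:R))).
  by apply: ler_sum => z zs; rewrite distrC; exact: hJ0.
rewrite -big_seq big_const_seq count_predT iter_addr_0 -[leLHS]mulr_natr -[leLHS]mulrA ler_piMr//.
  by rewrite mulr_ge0// ltW.
by rewrite mulrC ler_pdivrMr ?ltr0n// mul1r ler_nat.
Qed.

End reproduced.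
End decomposition.

(** * Summation over the levels *)

Section analysis_bounds.
Context {R : realType}.
Implicit Types (h E : R * R -> R).

(* A linear substitute for Hoelder: optimise over [k] after summation. *)
Lemma young_kappa (a k q : R) : 0 <= a -> 0 < k -> 1 <= q -> a <= k `^ (q - 1) * a `^ q + k^-1.
Proof.
move=> a0 k0 q1; have q0 : 0 < q by apply: lt_le_trans q1.
have [h|h] := leP a k^-1; first by apply: le_trans h _; rewrite lerDr mulr_ge0// powR_ge0.
have ap : 0 < a by apply: lt_trans h; rewrite invr_gt0.
apply: (@le_trans _ _ (k `^ (q - 1) * a `^ q)); last by rewrite lerDl invr_ge0 ltW.
rewrite -(mulr_powRB1 a0 q0) mulrCA -powRM ?(ltW k0)// ler_peMr//.
have ka : 1 <= k * a by rewrite mulrC -ler_pdivrMr// mul1r ltW.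
have q10 : 0 <= q - 1 by rewrite subr_ge0.
by have := ler_powR ka q10; rewrite powRr0.
Qed.

(** The bound ||h||_p <= H, raised to the power p so that it concerns a real integral. For p = oo it
    is an almost-everywhere bound, which is all that an essential supremum provides. *)
Definition lp_le (p : \bar R) h (H : R) : Prop := match p return Prop with
  | q%:E => I2 (fun x => `|h x| `^ q) <= H `^ q
  | _ => {ae (@leb2 R), forall x, `|h x| <= H} end.

Lemma mc2_powR h q : 0 < q -> mc2 h -> mc2 (fun x => `|h x| `^ q).
Proof.
move=> q0 [mh [M [r hM]]]; split.
  by apply: (measurableT_comp (measurable_powR _)); exact: measurableT_comp.
exists (M `^ q), r => x; have [h1 h2] := hM x; split.
  rewrite ger0_norm ?powR_ge0//; apply: ge0_ler_powR; rewrite ?nnegrE ?(ltW q0)//.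
  exact: le_trans h1.
by move=> /h2 ->; rewrite normr0 powR0// gt_eqF.
Qed.

Lemma I2_ae_le h E (H : R) : mc2 h -> mc2 E -> 0 <= H -> {ae (@leb2 R), forall x, `|h x| <= H} ->
  I2 (fun x => `|h x * E x|) <= H * I2 (fun x => `|E x|).
Proof.
move=> mh mE H0 hH; rewrite -I2Z; last exact: (mcs_abs mE).
have i1 := mcs_integrable gauge2 (mcs_abs (mc2_mul mh mE)).
have i2 := mcs_integrable gauge2 (mcsZ H (mcs_abs mE)).
apply: fine_le; [exact: integrable_fin_num i1|exact: integrable_fin_num i2|].
apply: ae_ge0_le_integral => //.
- by case/integrableP: i1.
- by move=> x _; rewrite lee_fin mulr_ge0.
- by case/integrableP: i2.
move: hH; apply: (@filterS _ _ (ae_filter_ringOfSetsType _)) => x hx _;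
  rewrite lee_fin normrM ler_wpM2r//.
Qed.

Lemma fine_inv_bounds (p : \bar R) : (1 <= p)%E -> 0 <= fine (p^-1)%E <= 1.
Proof.
case: p => [q| |]//; last by rewrite invey /= lexx ler01.
rewrite lee_fin => q1; have q0 : 0 < q by apply: lt_le_trans q1.
by rewrite inver gt_eqF//= invr_ge0 (ltW q0) invf_le1.
Qed.

Lemma fine_inv_lt (p : \bar R) (s : R) : (1 <= p)%E -> (p^-1 < s%:E)%E -> fine (p^-1)%E < s.
Proof.
case: p => [q| |]//= p1; rewrite ?invey//.
by rewrite inver gt_eqF// -lte_fin (lt_le_trans _ p1).
Qed.

Lemma lp_le_mono p h (H H' : R) : (1 <= p)%E -> 0 <= H -> H <= H' -> lp_le p h H -> lp_le p h H'.
Proof.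
case: p => [q| |]//= p1 H0 HH; last by apply: (@filterS _ _ (ae_filter_ringOfSetsType _)) => x hx;
  exact: le_trans hx HH.
move=> hl; apply: le_trans hl _; apply: ge0_ler_powR; rewrite ?nnegrE//; last exact: le_trans H0 HH.
by move: p1; rewrite lee_fin => p1; exact: le_trans ler01 p1.
Qed.

(** A sup bound a and an L1 bound b give a^(1/p) b^(1-1/p) for the dual norm of E, so neither a dual
    exponent nor an integral of a power of E appears. The factor 2 comes from [young_kappa]. *)
Lemma holder_pair p h E (a b H : R) : (1 <= p)%E -> mc2 h -> mc2 E -> 0 <= H -> 0 < a -> 0 < b ->
  (forall x, `|E x| <= a) -> I2 (fun x => `|E x|) <= b -> lp_le p h H ->
  `|I2 (fun x => h x * E x)| <= 2 * (a `^ fine (p^-1)%E * b `^ (1 - fine (p^-1)%E)) * H.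
Proof.
move=> p1 mh mE H0 a0 b0 Ea Eb hp.
set X := a `^ fine (p^-1)%E * b `^ (1 - fine (p^-1)%E).
have X0 : 0 < X by rewrite mulr_gt0// powR_gt0.
have XE : X = a `^ fine (p^-1)%E * b `^ (1 - fine (p^-1)%E) by [].
clearbody X.
(* The parameter k below has H in its denominator, so H is first made positive. *)
suff main : forall e, 0 < e -> `|I2 (fun x => h x * E x)| <= 2 * X * (H + e).
  apply/ler_addgt0Pr => e e0.
  have X2 : 0 < 2 * X by rewrite mulr_gt0.
  have := main _ (divr_gt0 e0 X2).
  by rewrite mulrDr [2 * X * (e / _)]mulrC divfK// gt_eqF.
move=> e e0; have He : 0 < H + e by rewrite ltr_wpDl.
have {hp} hp : lp_le p h (H + e) by apply: lp_le_mono hp => //; rewrite lerDl ltW.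
move: (H + e) He hp => {e e0 H0}H' H'0; move: XE; case: p p1 => [q| |]// p1 XE.
  have q1 : 1 <= q by rewrite -lee_fin.
  have q0 : 0 < q by apply: lt_le_trans q1.
  rewrite inver gt_eqF//= in XE; move=> hp.
  have Xq : X `^ q = a * b `^ (q - 1).
    rewrite XE powRM ?powR_ge0// -!powRrM mulVf ?gt_eqF// powRr1 ?(ltW a0)//.
    by rewrite mulrBl mul1r mulVf ?gt_eqF.
  (* With this k both terms of [young_kappa] integrate to at most X H'. *)
  pose k := b / (X * H'); have k0 : 0 < k by rewrite divr_gt0// mulr_gt0.
  have mm := mc2_mul mh mE; have mp := mc2_powR q0 mh.
  have mpE : mc2 (fun x => k `^ (q - 1) * a * (`|h x| `^ q) + k^-1 * `|E x|).
    by apply: mcsD; [exact: mcsZ|exact: (mcsZ _ (mcs_abs mE))].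
  have h1 : `|I2 (fun x => h x * E x)| <= I2 (fun x => k `^ (q - 1) * a * (`|h x| `^ q) +
    k^-1 * `|E x|).
    apply: norm_I2 => // x; rewrite normrM.
    have y := young_kappa (normr_ge0 (h x)) k0 q1.
    apply: (@le_trans _ _ ((k `^ (q - 1) * `|h x| `^ q + k^-1) * `|E x|));
      first by rewrite ler_wpM2r.
    rewrite mulrDl lerD2r -mulrA -mulrA ler_wpM2l ?powR_ge0// mulrC ler_wpM2r ?powR_ge0//.
  apply: le_trans h1 _; rewrite I2D; [|exact: mcsZ|exact: (mcsZ _ (mcs_abs mE))].
  rewrite I2Z// I2Z; last exact: (mcs_abs mE).
  have e1 : k^-1 * b = X * H' by rewrite /k invf_div divfK// gt_eqF.
  have kq : k `^ q * (a * H' `^ q) = b.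
    rewrite /k powRM ?invr_ge0 ?mulr_ge0 ?(ltW b0) ?(ltW X0) ?(ltW H'0)//.
    rewrite -(powR_inv1 (mulr_ge0 (ltW X0) (ltW H'0))) -powRrM mulN1r powRN.
    rewrite powRM ?(ltW X0) ?(ltW H'0)// Xq -(mulr_powRB1 (ltW b0) q0); field.
    by rewrite !gt_eqF// ?powR_gt0.
  have e2 : k `^ (q - 1) * a * H' `^ q = X * H'.
    rewrite -e1 -kq -(mulr_powRB1 (ltW k0) q0); field; rewrite gt_eqF//.
  apply: (@le_trans _ _ (k `^ (q - 1) * a * H' `^ q + k^-1 * b)).
    apply: lerD; first by rewrite ler_wpM2l// mulr_ge0 ?powR_ge0 ?(ltW a0).
    by rewrite ler_wpM2l// invr_ge0 ltW.
  by rewrite e2 e1 le_eqVlt; apply/orP; left; apply/eqP; ring.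
rewrite invey /= subr0 powRr0 mul1r powRr1 ?(ltW b0)// in XE; rewrite XE => hp.
have h1 := I2_ae_le mh mE (ltW H'0) hp.
apply: (@le_trans _ _ (H' * b)); last by rewrite mulrC ler_pM2r// ler_peMl ?(ltW b0)// ler1n.
have mm := mc2_mul mh mE.
apply: le_trans (norm_I2 mm (mcs_abs mm) (fun x => lexx _)) _.
by apply: le_trans h1 _; rewrite ler_wpM2l// ltW.
Qed.

(* On fine levels this interpolates between the sup norm and the L1 norm of the
   error kernel. *)
Definition damping (n : nat) (pi sg : R) := if sg <= 1 then sg ^+ n else sg `^ pi.

Lemma damping_ge0 n pi sg : 0 <= sg -> 0 <= damping n pi sg.
Proof. by rewrite /damping; case: ifP => _ s0; [rewrite exprn_ge0|rewrite powR_ge0]. Qed.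

(** On coarse levels the L1 norm over the window, of area 16, is at most 16 times the sup bound, so
    [holder_pair] returns density^n. On fine levels the sup bound is proportional to the density
    while the L1 norm is bounded, which leaves density^(1/p). *)
Lemma err_block (K n : nat) Lam M r : family_bounds (2 * n) Lam M r -> exists2 C : R, 0 < C &
  forall N g, (0 < g < N)%N -> coprime g N -> (max_quotient g N <= K)%N ->
  forall p m h H, (1 <= p)%E -> mc2 h -> (forall z, 2 < `|z.1| \/ 2 < `|z.2| -> h z = 0) -> 0 <=
    H ->
  lp_le p h H -> `|I2 (fun z => h z * ker_err N g Lam m z)| <= C * damping n (fine (p^-1)%E)
    (box_density N m) * H.
Proof.
move=> hL; have [M0 r0 _ _ _] := hL.
pose A1 : R := (4 * K.+1%:R) ^+ (2 * n) * (8 * M ^+ 2) *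
     (r + (2 * n).+1%:R * 2) * (r + (2 * n).+1%:R * (2 * K.+1%:R)).
pose A2 : R := 8 * M ^+ 2 * (r + 2) * (r + 2 * K.+1%:R).
pose A3 : R := (4 * M ^+ 2 * r ^+ 2) * 16 + (4 * M ^+ 2 * r ^+ 2)
  * (4 * (2 + r + 2) * (2 + r + 2 * K.+1%:R)).
have A10 : 0 <= A1 by rewrite /A1;
  repeat first [apply: mulr_ge0|apply: addr_ge0|apply: exprn_ge0] => //.
have A20 : 0 <= A2 by rewrite /A2;
  repeat first [apply: mulr_ge0|apply: addr_ge0|apply: exprn_ge0] => //.
have A30 : 0 <= A3 by rewrite /A3;
  repeat first [apply: mulr_ge0|apply: addr_ge0|apply: exprn_ge0] => //.
exists (32 * (A1 + 1) + 2 * (A2 + A3 + 1));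
  first by rewrite addr_gt0// mulr_gt0// ltr_wpDl// addr_ge0.
move=> N g gN cop hK p m h H p1 mh hs H0 hp.
have N0 : (0 < N)%N by case/andP: gN => _; exact: leq_ltn_trans.
have s0 : 0 < box_density N m :> R by rewrite divr_gt0 ?ltr0n// exprn_gt0.
have [pi0 pi1] := andP (fine_inv_bounds p1).
pose E z := window z * ker_err N g Lam m z.
have mE : mc2 E := mc2_ker_err gN hL m (@mc2_window R).
have -> : I2 (fun z => h z * ker_err N g Lam m z) = I2 (fun z => h z * E z).
  apply: I2_ext => z; have [h0|/not_orP[/negP h1 /negP h2]] := pselect (2 < `|z.1| \/ 2 < `|z.2|).
    by rewrite hs// !mul0r.
  rewrite -!leNgt in h1 h2; rewrite /E /window /tens !box_ind_in ?subr0// !mul1r//.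
have wE z c : `|ker_err N g Lam m z| <= c -> `|E z| <= c * window z.
  by move=> hc; rewrite normrM ger0_norm ?window_ge0// mulrC ler_wpM2r ?window_ge0.
have wE' z c : `|ker_err N g Lam m z| <= c -> `|E z| <= c.
  move=> hc; apply: le_trans (wE z c hc) _; rewrite ler_piMr ?window_le1//.
  exact: le_trans (normr_ge0 _) hc.
rewrite /damping; case: ifPn => [s1|]; last rewrite -ltNge => s1.
  pose a := (A1 + 1) * box_density N m ^+ n.
  have a0 : 0 < a by rewrite mulr_gt0 ?exprn_gt0// ltr_wpDl.
  have ka z : `|ker_err N g Lam m z| <= a.
    apply: le_trans (ker_err_low gN cop hK hL z s1) _.
    by rewrite -/A1 ler_wpM2r ?exprn_ge0 ?(ltW s0)// lerDl.
  have b1 : I2 (fun z => `|E z|) <= 16 * a.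
    rewrite -(@I2_window R) mulrC -I2Z; last exact: mc2_window.
    by apply: le_I2 (mcs_abs mE) (mcsZ a (@mc2_window R)) _ => z; exact: wE.
  have a16 : 0 < 16 * a by rewrite mulr_gt0.
  have := holder_pair p1 mh mE H0 a0 a16 (fun z => wE' z a (ka z)) b1 hp.
  move=> /le_trans; apply; rewrite ler_wpM2r//.
  have P : a `^ fine (p^-1)%E * (16 * a) `^ (1 - fine (p^-1)%E) <= 16 * a.
    apply: (@le_trans _ _ ((16 * a) `^ fine (p^-1)%E * (16 * a) `^ (1 - fine (p^-1)%E))).
      rewrite ler_wpM2r ?powR_ge0//; apply: ge0_ler_powR; rewrite ?nnegrE ?(ltW a0) ?(ltW a16)//.
      by rewrite ler_peMl ?(ltW a0)// ler1n.
    rewrite -powRD; last by apply/implyP => _; rewrite gt_eqF.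
    by rewrite addrCA subrr addr0 powRr1// ltW.
  apply: (@le_trans _ _ (2 * (16 * a))); first by rewrite ler_wpM2l.
  rewrite /a mulrA mulrA ler_wpM2r ?exprn_ge0 ?(ltW s0)//.
  have -> : 2 * 16 * (A1 + 1) = 32 * (A1 + 1) by ring.
  by rewrite lerDl mulr_ge0// addr_ge0// addr_ge0.
pose B := A2 + A3 + 1; have B0 : 0 < B by rewrite /B ltr_wpDl// addr_ge0.
have Bs : 0 < B * box_density N m by rewrite mulr_gt0.
have ka z : `|ker_err N g Lam m z| <= B * box_density N m.
  apply: le_trans (ker_err_high gN cop hK hL z (ltW s1)) _.
  by rewrite -/A2 ler_wpM2r ?(ltW s0)// /B -addrA lerDl addr_ge0.
have b1 : I2 (fun z => `|E z|) <= B.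
  apply: le_trans (ker_err_L1 gN cop hK hL m) _; rewrite -/A3 /B; lra.
have := holder_pair p1 mh mE H0 Bs B0 (fun z => wE' z _ (ka z)) b1 hp.
move=> /le_trans; apply; rewrite ler_wpM2r//.
rewrite powRM ?(ltW B0) ?(ltW s0)// mulrAC -powRD; last by apply/implyP => _; rewrite gt_eqF.
rewrite addrCA subrr addr0 powRr1 ?(ltW B0)// mulrA ler_wpM2r ?powR_ge0//.
by rewrite lerDr mulr_ge0// addr_ge0.
Qed.

End analysis_bounds.

Section sums.
Context {R : realType}.

(** Multiplied by 1 - rho the sum telescopes along [Phi], which starts at a nonnegative value and
    never exceeds 2. With truncated subtraction the exponent is |l - k|. *)
Lemma geometric_nat (rho : R) (k n : nat) : 0 < rho < 1 ->
  \sum_(l < n) rho ^+ ((l - k) + (k - l)) <= 2 / (1 - rho).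
Proof.
move=> /andP[r0 r1]; have r1' : 0 < 1 - rho by rewrite subr_gt0.
pose Phi l : R := if (l <= k)%N then rho ^+ (k - l).+1 else 1 + rho - rho ^+ (l - k).
have PhiS l : (1 - rho) * rho ^+ ((l - k) + (k - l)) = Phi l.+1 - Phi l.
  rewrite /Phi; have [lk|kl|->] := ltngtP l k.
  - by rewrite (eqP (ltnW lk)) add0n -(subnSK lk) !exprS; ring.
  - by rewrite (eqP (ltnW kl)) addn0 subSn ?(ltnW kl)// exprS; ring.
  - by rewrite subnn addn0 subSnn expr0 !expr1; ring.
have : (1 - rho) * \sum_(l < n) rho ^+ ((l - k) + (k - l)) = Phi n - Phi 0%N.
  elim: n => [|n IH]; first by rewrite big_ord0 mulr0 subrr.
  by rewrite big_ord_recr /= mulrDr IH PhiS; ring.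
have P0 : 0 <= Phi 0%N by rewrite /Phi /= exprn_ge0// ltW.
have P2 : Phi n <= 2.
  rewrite /Phi; case: ifP => _.
    by apply: (@le_trans _ _ 1); [rewrite exprn_ile1// ltW|rewrite ler1n].
  have : 0 <= rho ^+ (n - k) by rewrite exprn_ge0// ltW.
  lra.
move=> E; rewrite ler_pdivlMr// mulrC E; lra.
Qed.

(** Rounding the centre x down to an integer changes each exponent by at most 1, at the cost of a
    factor 1/rho. *)
Lemma geometric_real (rho : R) : 0 < rho < 1 -> exists2 G : R, 0 < G &
  forall (x : R) (n : nat), 0 <= x -> \sum_(l < n) rho `^ `|l%:R - x| <= G.
Proof.
move=> r01; have /andP[r0 r1] := r01; have r1' : 0 < 1 - rho by rewrite subr_gt0.
exists (rho^-1 * (2 / (1 - rho))); first by rewrite mulr_gt0 ?invr_gt0// divr_gt0.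
move=> x n x0; pose k := Num.trunc x.
apply: (@le_trans _ _ (\sum_(l < n) rho^-1 * rho ^+ ((l - k) + (k - l)))); last first.
  by rewrite -mulr_sumr ler_wpM2l ?invr_ge0 ?(ltW r0)//; exact: geometric_nat.
apply: ler_sum => l _.
have kx : k%:R <= x < k.+1%:R by apply: truncn_itv.
have D : (((l - k) + (k - l))%N%:R : R) = `|(l : nat)%:R - k%:R|.
  have [lk|kl] := leqP l k.
    rewrite (eqP lk) add0n distrC natrB// ger0_norm// subr_ge0 ler_nat//.
  by rewrite (eqP (ltnW kl)) addn0 natrB ?(ltnW kl)// ger0_norm// subr_ge0 ler_nat ltnW.
rewrite -(powR_mulrn _ (ltW r0)) D.
have -> : rho^-1 = rho `^ (-1) by rewrite powR_inv1// ltW.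
rewrite -powRD; last by apply/implyP => _; rewrite gt_eqF.
apply: ger_powR; first by rewrite r0 ltW.
have := ler_normD ((l : nat)%:R - x) (x - k%:R); rewrite addrA subrK => h.
have : `|x - k%:R| <= 1 by rewrite ger0_norm ?subr_ge0; move: kx => /andP[h1 h2]; rewrite ?h1//;
  move: h2; rewrite -natr1; lra.
lra.
Qed.

Lemma pow2_ge_linear (d : R) : 0 < d -> exists2 C : R, 0 < C & forall y, 0 <= y -> 2 + y <=
  C * 2 `^ (d * y).
Proof.
move=> d0; have l2 : 0 < ln (2 : R) by rewrite ln_gt0// ltr1n.
have c0 : 0 < d * ln 2 by rewrite mulr_gt0.
exists (2 + (d * ln 2)^-1); first by rewrite addr_gt0// invr_gt0.
move=> y y0; rewrite /powR gt_eqF//.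
apply: (@le_trans _ _ ((2 + (d * ln 2)^-1) * (1 + d * y * ln 2))); last first.
  by rewrite ler_wpM2l ?expR_ge1Dx// addr_ge0// invr_ge0 ltW.
have -> : (2 + (d * ln 2)^-1) * (1 + d * y * ln 2) = 2 + (d * ln 2)^-1 + 2 * (d * y * ln 2) + y.
  by field; rewrite !gt_eqF.
rewrite lerD2r -addrA lerDl addr_ge0// ?invr_ge0 ?(ltW c0)// !mulr_ge0//; exact: ltW.
Qed.

Definition level_weight (n : nat) (pi s tau : R) (N l : nat) : R :=
  damping n pi (2 ^+ l / N%:R) * 2 `^ (- (s * l%:R)) * (l.+1%:R `^ tau).

Lemma log2_pow (N : nat) : (0 < N)%N -> N%:R = 2 `^ (log2 N%:R) :> R.
Proof.
move=> N0; rewrite /log2 /powR gt_eqF// divfK ?lnK ?posrE ?ltr0n//.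
by rewrite gt_eqF// ln_gt0// ltr1n.
Qed.

Lemma log2_ge1 (N : nat) : (2 <= N)%N -> 1 <= log2 N%:R :> R.
Proof.
move=> N2; have l2 : 0 < ln (2 : R) by rewrite ln_gt0// ltr1n.
by rewrite /log2 ler_pdivlMr// mul1r ler_ln ?posrE ?ltr0n ?ler_nat//; exact: leq_trans N2.
Qed.

(** The weights peak at x = log2 N. With y = l - x, damping against 2^(-sl) leaves N^(-s) 2^(-d|y|),
    where n - s provides the decay for y <= 0 and s - pi for y > 0. Half of this decay absorbs the
    factor 2 + |y| lost when (l + 1)^tau is replaced by x^tau. *)
Lemma level_weight_bound (n : nat) (pi s tau : R) : 0 <= pi -> pi < s -> s < n%:R ->
  0 <= tau <= 1 ->
  exists2 C : R, 0 < C & forall (N J : nat), (2 <= N)%N ->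
    \sum_(l < J) level_weight n pi s tau N l <= C * (log2 N%:R `^ tau / N%:R `^ s).
Proof.
move=> pi0 pis sn /andP[t0 t1].
pose d := Num.min (n%:R - s) (s - pi).
have d0 : 0 < d by rewrite lt_min !subr_gt0 pis sn.
have d20 : 0 < d / 2 by rewrite divr_gt0.
have [C1 C10 hC1] := pow2_ge_linear d20.
pose rho : R := 2 `^ (- (d / 2)).
have r0 : 0 < rho by rewrite powR_gt0.
have r1 : rho < 1.
  have l2 : 0 < ln (2 : R) by rewrite ln_gt0// ltr1n.
  rewrite /rho /powR gt_eqF// -[ltRHS]expR0 ltr_expR mulNr oppr_lt0.
  exact: mulr_gt0.
have [G G0 hG] := @geometric_real rho (introT andP (conj r0 r1)).
exists (C1 * G); first exact: mulr_gt0.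
move=> N J N2; have N0 : (0 < N)%N by apply: leq_trans N2.
pose x : R := log2 N%:R; have x1 : 1 <= x := log2_ge1 N2; have x0 : 0 <= x by apply: le_trans x1.
have NE : N%:R = 2 `^ x :> R := log2_pow N0.
have P0 (y : R) : 0 < 2 `^ y :> R by rewrite powR_gt0.
have PD (y z : R) : 2 `^ y * 2 `^ z = 2 `^ (y + z) :> R by rewrite powRD//; apply/implyP => _;
  rewrite gt_eqF.
have Pm (y z : R) : y <= z -> 2 `^ y <= 2 `^ z :> R by move=> h; apply: ler_powR => //;
  rewrite ler1n.
have step l : level_weight n pi s tau N l <= (log2 N%:R `^ tau / N%:R `^ s)
  * (C1 * rho `^ `|l%:R - x|).
  rewrite /level_weight -/x; set y := l%:R - x.
  have sE : 2 ^+ l / N%:R = 2 `^ y :> R.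
    by rewrite -powR_mulrn// NE -powRN PD.
  have A : damping n pi (2 ^+ l / N%:R) * 2 `^ (- (s * l%:R)) <= (N%:R `^ s)^-1 * 2 `^
    (- (d * `|y|)).
    have -> : (N%:R `^ s)^-1 = 2 `^ (- (s * x)) :> R by rewrite powRN mulrC powRrM -NE.
    have -> : 2 `^ (- (s * l%:R)) = 2 `^ (- (s * x)) * 2 `^ (- (s * y)) :> R.
      by rewrite PD /y; congr (_ `^ _); ring.
    rewrite mulrCA ler_wpM2l ?(ltW (P0 _))// sE /damping.
    have [y0|y0] := leP y 0.
      rewrite (_ : (2 `^ y <= 1 :> R) = true); last by rewrite -[leRHS](powRr0 2) Pm.
      rewrite -(powR_mulrn _ (ltW (P0 _))) -powRrM PD; apply: Pm.
      have hd : d <= n%:R - s by rewrite /d ge_min lexx.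
      by rewrite ler0_norm//; have := ler_wnM2l y0 hd; lra.
    rewrite (_ : (2 `^ y <= 1 :> R) = false); last first.
      have l2 : 0 < ln (2 : R) by rewrite ln_gt0// ltr1n.
      apply/negbTE; rewrite -ltNge /powR gt_eqF// -[ltLHS]expR0 ltr_expR; exact: mulr_gt0.
    rewrite -powRrM PD; apply: Pm; rewrite gtr0_norm//.
    have hd : d <= s - pi by rewrite /d ge_min lexx orbT.
    by have := ler_wpM2l (ltW y0) hd; lra.
  (* l + 1 = x + y + 1 <= x(2 + |y|) because x >= 1, and tau <= 1 lets the power be dropped on the
     factor 2 + |y| >= 1. *)
  have B : l.+1%:R `^ tau <= x `^ tau * (2 + `|y|).
    apply: (@le_trans _ _ ((x * (2 + `|y|)) `^ tau)).
      apply: ge0_ler_powR => //; rewrite ?nnegrE//; first by rewrite mulr_ge0// addr_ge0.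
      have h1 := ler_norm y; have h2 := normr_ge0 y.
      have h3 : 1 * `|y| <= x * `|y| by rewrite ler_wpM2r.
      rewrite -natr1 (_ : l%:R = x + y :> R); last by rewrite /y addrC subrK.
      by rewrite mulrDr; lra.
    rewrite powRM ?addr_ge0// ler_wpM2l ?powR_ge0//.
    by apply: ler1_powR => //; have := normr_ge0 y; lra.
  apply: (@le_trans _ _ (((N%:R `^ s)^-1 * 2 `^ (- (d * `|y|))) * (x `^ tau * (2 + `|y|)))).
    by apply: ler_pM => //; rewrite ?powR_ge0// mulr_ge0 ?powR_ge0// damping_ge0//
      divr_ge0// exprn_ge0.
  have -> : (N%:R `^ s)^-1 * 2 `^ (- (d * `|y|)) * (x `^ tau * (2 + `|y|)) =
     (x `^ tau / N%:R `^ s) * (2 `^ (- (d * `|y|)) * (2 + `|y|)) by ring.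
  rewrite ler_wpM2l//; first by rewrite divr_ge0 ?powR_ge0.
  apply: (@le_trans _ _ (2 `^ (- (d * `|y|)) * (C1 * 2 `^ (d / 2 * `|y|)))).
    by rewrite ler_wpM2l ?powR_ge0// hC1.
  rewrite mulrCA PD ler_wpM2l ?(ltW C10)// /rho -powRrM.
  by apply: Pm; rewrite le_eqVlt; apply/orP; left; apply/eqP; field.
apply: (@le_trans _ _ (\sum_(l < J) (log2 N%:R `^ tau / N%:R `^ s)
  * (C1 * rho `^ `|(l : nat)%:R - x|))).
  by apply: ler_sum => l _; exact: step.
rewrite -mulr_sumr -mulr_sumr mulrC ler_wpM2r//; first by rewrite divr_ge0 ?powR_ge0.
by rewrite ler_wpM2l ?(ltW C10)// hG.
Qed.

Definition besov_seq (theta : \bar R) (s : R) (H : nat * nat -> R) : Prop :=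
  match theta return Prop with
  | t%:E => forall l : nat, \sum_(i < l.+1) (2 `^ (s * l%:R) * H (i : nat, (l - i)%N)) `^ t <= 1
  | _ => forall m, 2 `^ (s * (m.1 + m.2)%:R) * H m <= 1 end.

(** For finite theta, [young_kappa] with k = (l + 1)^(1/theta) makes both contributions at most (l +
    1)^(1-1/theta), hence the factor 2. For theta = oo each of the l + 1 weighted terms is at most
    1. *)
Lemma level_sum theta s H l : (1 <= theta)%E -> (forall m, 0 <= H m) -> besov_seq theta s H ->
  \sum_(i < l.+1) H (i : nat, (l - i)%N) <= 2 `^ (- (s * l%:R))
    * (2 * l.+1%:R `^ (1 - fine (theta^-1)%E)).
Proof.
move=> t1 H0 hs; have P0 (y : R) : 0 < 2 `^ y :> R by rewrite powR_gt0.
have PV : 2 `^ (- (s * l%:R)) = (2 `^ (s * l%:R))^-1 :> R by rewrite powRN.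
suff : \sum_(i < l.+1) 2 `^ (s * l%:R) * H (i : nat, (l - i)%N) <= 2 * l.+1%:R `^
  (1 - fine (theta^-1)%E).
  by rewrite -mulr_sumr PV -ler_pdivlMl.
case: theta t1 hs => [t| |]//= t1 hs; last first.
  rewrite subr0 powRr1//; apply: (@le_trans _ _ (\sum_(i < l.+1) 1)).
    apply: ler_sum => i _; have := hs (i : nat, (l - i)%N); rewrite /= subnKC// -ltnS//.
  by rewrite sumr_const card_ord ler_peMl// ler1n.
have {}t1 : 1 <= t by rewrite -lee_fin.
have t0 : 0 < t by apply: lt_le_trans t1.
rewrite ?inver ?gt_eqF//=.
have L0 : 0 < l.+1%:R :> R by rewrite ltr0n.
pose k : R := l.+1%:R `^ t^-1; have k0 : 0 < k by rewrite powR_gt0.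
have kt : k `^ (t - 1) = l.+1%:R `^ (1 - t^-1) by rewrite /k -powRrM; congr (_ `^ _); field;
  rewrite gt_eqF.
apply: (@le_trans _ _ (\sum_(i < l.+1) (k `^ (t - 1) * (2 `^ (s * l%:R) * H (i : nat, (l - i)%N))
  `^ t + k^-1))).
  by apply: ler_sum => i _; apply: young_kappa => //; rewrite mulr_ge0// ltW.
rewrite big_split /= -mulr_sumr sumr_const card_ord.
have -> : k^-1 *+ l.+1 = l.+1%:R `^ (1 - t^-1).
  rewrite powRB; last by apply/implyP => _; rewrite gt_eqF.
  by rewrite powRr1 ?(ltW L0)// -/k mulr_natl.
rewrite kt mulrDl mul1r lerD2r ler_piMr ?powR_ge0//.
Qed.

(** The truncation is a square whereas the weights depend on i + j. The terms being nonnegative, the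
    square is completed to full antidiagonals. *)
Lemma triangular_sum (J : nat) (F : nat -> nat -> R) : (forall i j, 0 <= F i j) ->
  \sum_(i < J) \sum_(j < J) F i j <= \sum_(l < J + J) \sum_(i < l.+1) F i (l - i)%N.
Proof.
move=> F0.
have shift (a : nat) (G : nat -> R) : \sum_(a <= l < a + J) G l = \sum_(j < J) G (j + a)%N.
  by rewrite -{1}(add0n a) big_addn addKn big_mkord.
have row (i : 'I_J) : \sum_(j < J) F i j <= \sum_(l < J + J)
  (if (i <= l)%N then F i (l - i)%N else 0).
  rewrite -(big_mkord xpredT (fun l => if (i <= l)%N then F i (l - i)%N else 0)).
  rewrite (@big_cat_nat _ _ _ i)//=; last by rewrite (leq_trans (ltnW (ltn_ord i)))// leq_addr.
  rewrite (@big_cat_nat _ _ _ (i + J)%N i)//=; [|exact: leq_addr|by rewrite leq_add2r ltnW].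
  rewrite [X in _ <= _ + (X + _)](_ : _ = \sum_(j < J) F i j); last first.
    by rewrite shift; apply: eq_bigr => j _; rewrite leq_addl addnK.
  rewrite addrCA lerDl addr_ge0// big_nat_cond; apply: sumr_ge0 => l _; by case: ifP.
apply: le_trans (ler_sum _ (fun i _ => row i)) _.
rewrite exchange_big /=; apply: ler_sum => l _.
rewrite -big_mkcond /=.
rewrite [leRHS](eq_bigr (fun i : 'I_l.+1 => (fun i => F i (l - i)%N) i))//.
rewrite -(big_mkord (fun i => (i <= l)%N) (fun i => F i (l - i)%N)).
rewrite -(big_mkord xpredT (fun i => F i (l - i)%N)).
have [Jl|lJ] := leqP J l.+1.
  rewrite [leRHS](@big_cat_nat _ _ _ J)//=.
  rewrite big_nat_cond [X in _ <= X + _]big_nat_cond.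
  rewrite (eq_bigl (fun i => (0 <= i < J)%N && true)); last first.
    by move=> i /=; case: ltnP => //= iJ; rewrite -ltnS (leq_trans iJ).
  by rewrite lerDl; apply: sumr_ge0.
rewrite (@big_cat_nat _ _ _ l.+1)//=; last exact: ltnW.
have -> : \sum_(l.+1 <= i < J | (i <= l)%N) F i (l - i)%N = 0.
  rewrite big_nat_cond big_pred0// => i; apply/negP => /andP[/andP[h _] h'].
  by move: h; rewrite ltnNge h'.
rewrite addr0 big_nat_cond [leRHS]big_nat_cond le_eqVlt; apply/orP; left; apply/eqP.
by apply: eq_bigl => i /=; rewrite ltnS; case: (leqP i l).
Qed.

End sums.

(** * The upper bound for real functions with given block norms *)

Section upper_core.
Context {R : realType}.

Section blocks.
Variables (Psi0 : R -> R) (L : nat).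
Hypotheses (h0 : test1 Psi0) (s0 : forall x, 1 < `|x| -> Psi0 x = 0).

Lemma Psi1E : Psi1 L Psi0 = derive1n L (fun x => dil 1 Psi0 x - Psi0 x).
Proof. by congr derive1n; apply/funext => x; rewrite /dil expr1. Qed.

Lemma test1_Psi1 : test1 (Psi1 L Psi0).
Proof. by rewrite Psi1E; apply: test1_deriven; apply: test1B => //; exact: test1_dil. Qed.

Lemma test1_Psi j : test1 (Psi L Psi0 j).
Proof. by case: j => [|j]//=; exact: (test1_dil j test1_Psi1). Qed.

Lemma Psi_out j x : 1 < `|x| -> Psi L Psi0 j x = 0.
Proof.
case: j => [|j] hx /=; first exact: s0.
have pj : 1 <= (2 : R) ^+ j by rewrite exprn_ege1// ler1n.
rewrite (_ : Psi1 L Psi0 _ = 0) ?mulr0//; apply: (@derive1n_out _ _ 0 1).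
  move=> y; rewrite subr0 => hy; rewrite !s0 ?mulr0 ?subrr// normrM ger0_norm//.
  by apply: lt_le_trans hy _; rewrite ler_peMl// ler1n.
by rewrite subr0 normrM ger0_norm ?(le_trans _ pj)//; apply: (lt_le_trans hx); rewrite ler_peMl.
Qed.

Lemma mc2_Psi m : mc2 (ker (Psi L Psi0) m).
Proof. exact: (mc2_ker_family m test1_Psi). Qed.

End blocks.

Definition square_supp (f : R * R -> R) := forall z, ~ unit_square z -> f z = 0.

Lemma unit_squareP (z : R * R) : unit_square z <-> (0 <= z.1 <= 1) /\ (0 <= z.2 <= 1).
Proof. by split => -[h1 h2]; split; move: h1 h2; rewrite /= ?in_itv. Qed.

Lemma upper_core (Psi0 : R -> R) (L K : nat) (s : R) (p theta : \bar R) :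
  test1 Psi0 -> (forall x, 1 < `|x| -> Psi0 x = 0) -> I1 Psi0 = 1 ->
  (1 <= p)%E -> (1 <= theta)%E -> fine (p^-1)%E < s ->
  exists2 C : R, 0 < C & forall N g, (0 < g < N)%N -> coprime g N -> (max_quotient g N <= K)%N ->
  forall (f : R * R -> R) (H : nat * nat -> R), continuous f -> mc2 f -> square_supp f ->
  (forall m, 0 <= H m) -> (forall m, lp_le p (conv2 (ker (Psi L Psi0) m) f) (H m)) ->
  besov_seq theta s H ->
  `|err N g f| <= C * (log2 N%:R `^ (1 - fine (theta^-1)%E) / N%:R `^ s).
Proof.
move=> h0 s0 i0 p1 t1 ps.
have [lam0 [lam [q [hl0 hl hq iq [e0 e1]]]]] := reproducing_formula L h0 i0.
have [pi0 _] := andP (fine_inv_bounds p1).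
have [tt0 tt1] := andP (fine_inv_bounds t1).
(* The order of cancellation must exceed the smoothness s for the coarse levels to decay. It costs
   2n derivatives of the smooth kernels [Lam_j]. *)
have [n sn] : exists n : nat, s < n%:R.
  by exists (Num.trunc s).+1; exact: truncnS_gt.
have [M [r hL]] := scaled_family_bounds (2 * n) hl0 hl.
have [C C0 hC] := err_block K hL.
have tau01 : 0 <= 1 - fine (theta^-1)%E <= 1 by apply/andP; split; lra.
have [C' C'0 hC'] := level_weight_bound pi0 ps sn tau01.
exists (2 * C * C'); first by rewrite !mulr_gt0.
move=> N g gN cop hK f H cf mf sf H0 hp hb.
have /andP[g0 gN'] := gN; have N0 : (0 < N)%N by apply: leq_ltn_trans gN'.
have N2 : (2 <= N)%N by apply: leq_ltn_trans gN'.
pose Lam := scaled_family lam0 lam.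
have tL j : test1 (Lam j) by exact: test1_scaled_family.
have tP := test1_Psi L h0.
(* The sum telescopes: level 0 gives q, and level j+1 gives [dil j] of [dil 1 q] - q. *)
have rep J x : \sum_(j < J.+1) convol (Lam j) (Psi L Psi0 j) x = dil J q x.
  elim: J x => [|J IH] x; first by rewrite big_ord_recl big_ord0 addr0 /= e0 dil0.
  rewrite big_ord_recr /= IH.
  have mP1 := test1_mc1 (test1_Psi1 L h0); have ml := test1_mc1 hl.
  have -> : convol (dil J lam) (fun x0 => 2 ^+ J * Psi1 L Psi0 (2 ^+ J * x0)) =
    dil J (fun x => dil 1 q x - q x).
    by rewrite -e1 -Psi1E (dil_conv J ml mP1).
  by rewrite dilB dil_dil add1n addrC subrK.
apply/ler_addgt0Pr => e ep.
have [J hJ] := err_mollified_cvg hq iq mf g N0 cf ep.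
have {hJ} hJ := hJ J (leqnn J).
apply: (@le_trans _ _ (`|err N g (conv2 (tens (dil J q) (dil J q)) f)| + e)).
  have := ler_normB (err N g (conv2 (tens (dil J q) (dil J q)) f))
    (err N g (conv2 (tens (dil J q) (dil J q)) f) - err N g f).
  by rewrite subKr; lra.
rewrite lerD2r (err_mollified tL tP mf rep N0 J g0 gN' hL).
pose F (i j : nat) : R := C * damping n (fine (p^-1)%E) (box_density N (i, j)) * H (i, j).
have sig0 m : 0 <= box_density N m :> R by rewrite divr_ge0// exprn_ge0.
have F0 i j : 0 <= F i j by rewrite /F !mulr_ge0 ?(ltW C0) ?damping_ge0.
have blk (i j : nat) : `|I2 (fun z => conv2 (ker (Psi L Psi0) (i, j)) f z * ker_err N g Lam
  (i, j) z)| <= F i j.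
  apply: (hC N g gN cop hK p (i, j) _ (H (i, j)) p1) => //;
    first exact: (mc2_conv2 (mc2_Psi L h0 _) mf).
  move=> z hz; rewrite -I20; apply: I2_ext => y.
  have [/unit_squareP[/andP[y1 y2] /andP[y3 y4]]|hy] := pselect (unit_square y);
    last by rewrite sf// mulr0.
  have key (a b : R) : 2 < `|a| -> 0 <= b -> b <= 1 -> 1 < `|a - b|.
    move=> ha hb0 hb1; have := ler_normD (a - b) b; rewrite subrK (ger0_norm hb0); lra.
  by rewrite /ker; case: hz => hz; rewrite (Psi_out _ s0 _ (key _ _ hz _ _))//= ?mulr0 ?mul0r.
apply: (@le_trans _ _ (\sum_(i < J.+1) \sum_(j < J.+1) F i j)).
  apply: le_trans (ler_norm_sum _ _ _) _; apply: ler_sum => i _.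
  apply: le_trans (ler_norm_sum _ _ _) _; apply: ler_sum => j _; exact: blk.
apply: le_trans (triangular_sum J.+1 F0) _.
apply: (@le_trans _ _ (\sum_(l < J.+1 + J.+1) 2 * C * level_weight n (fine (p^-1)%E) s
  (1 - fine (theta^-1)%E) N l)).
  apply: ler_sum => l _.
  have -> : \sum_(i < l.+1) F i (l - i)%N =
     C * damping n (fine (p^-1)%E) (2 ^+ l / N%:R) * \sum_(i < l.+1) H (i : nat, (l - i)%N).
    rewrite mulr_sumr; apply: eq_bigr => i _; rewrite /F /box_density /= subnKC//.
    by rewrite -ltnS.
  have w0 : 0 <= C * damping n (fine (p^-1)%E) (2 ^+ l / N%:R).
    by rewrite mulr_ge0 ?(ltW C0)// damping_ge0// divr_ge0// exprn_ge0.
  apply: le_trans (ler_wpM2l w0 (level_sum l t1 H0 hb)) _.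
  by rewrite /level_weight le_eqVlt; apply/orP; left; apply/eqP; ring.
rewrite -mulr_sumr -[2 * C * C' * _]mulrA ler_wpM2l ?mulr_ge0 ?(ltW C0)//.
exact: hC'.
Qed.

End upper_core.

(** * Tempered distributions and the upper bound *)

Section schwartz_tensors.
Context {R : realType}.
Local Notation plane := (R * R)%type.
Implicit Types (a b : R -> R).

Definition ctens a b : plane -> R[i] := fun y => (tens a b y)%:C%C.

Lemma tens_derive_fst a b (x : plane) : (forall t : R, derivable a t 1) ->
  derivable (tens a b) x (axis false) /\ 'D_(axis false) (tens a b) x = tens a^`()%classic b x.
Proof.
move=> da; have [d e] : is_derive x.1 1 (fun t : R => b x.2 * a t) (b x.2 * a^`()%classic x.1).
  have : is_derive x.1 1 a (a^`()%classic x.1) by split; [exact: da|rewrite derive1E].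
  by move=> h; exact: (is_deriveZ (b x.2) h).
have E : (fun h : R => h^-1 *: ((tens a b \o shift x) (h *: axis false) - tens a b x)) =
         (fun h : R => h^-1 *: (((fun t : R => b x.2 * a t) \o shift x.1) (h *: (1 : R)) - b
           x.2 * a x.1)).
  apply/funext => h; rewrite /tens /axis /= scaler0 add0r mulrC.
  by rewrite [X in _ *: (_ - X)]mulrC.
by split; [rewrite /derivable E; exact: d|rewrite /derive E /tens [RHS]mulrC; exact: e].
Qed.

Lemma tens_derive_snd a b (x : plane) : (forall t : R, derivable b t 1) ->
  derivable (tens a b) x (axis true) /\ 'D_(axis true) (tens a b) x = tens a b^`()%classic x.
Proof.
move=> db; have [d e] : is_derive x.2 1 (fun t : R => a x.1 * b t) (a x.1 * b^`()%classic x.2).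
  have : is_derive x.2 1 b (b^`()%classic x.2) by split; [exact: db|rewrite derive1E].
  by move=> h; exact: (is_deriveZ (a x.1) h).
have E : (fun h : R => h^-1 *: ((tens a b \o shift x) (h *: axis true) - tens a b x)) =
         (fun h : R => h^-1 *: (((fun t : R => a x.1 * b t) \o shift x.2) (h *: (1 : R)) - a
           x.1 * b x.2)).
  by apply/funext => h; rewrite /tens /axis /= scaler0 add0r.
by split; [rewrite /derivable E; exact: d|rewrite /derive E; exact: e].
Qed.

Lemma partial_real_axis i (F : plane -> R) : partial i (fun y => (F y)%:C%C) =
  (fun y => ('D_(axis i) F y)%:C%C).
Proof.
apply/funext => x; rewrite /partial /cre /cim /=.
by rewrite (_ : 'D_(axis i) (fun=> 0) x = 0)// derive_cst.
Qed.

Lemma partial_ctens a b : test1 a -> test1 b ->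
  partial false (ctens a b) = ctens a^`()%classic b /\ partial true (ctens a b) =
    ctens a b^`()%classic.
Proof.
move=> [sa _] [sb _]; split; rewrite [partial _ _]partial_real_axis; apply/funext => x;
  rewrite /ctens; congr (_%:C%C).
  by have [_ ->] := tens_derive_fst b x (sa 0%N).
by have [_ ->] := tens_derive_snd a x (sb 0%N).
Qed.

Lemma tens_continuous a b : test1 a -> test1 b -> continuous (tens a b).
Proof.
move=> ha hb x; apply: cvgM.
  by apply: (@continuous_comp _ _ _ (fst : plane -> R) a); [exact: cvg_fst|exact: test1_continuous].
by apply: (@continuous_comp _ _ _ (snd : plane -> R) b); [exact: cvg_snd|exact: test1_continuous].
Qed.

(** Partial derivatives of a tensor of test functions are such tensors again, so every word of
    derivatives is reduced to a single step for an arbitrary tensor. *)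
Lemma smooth_ctens a b : test1 a -> test1 b -> smooth (ctens a b).
Proof.
move=> ha hb w h; have [a' [b' [ha' hb' ->]]] : exists a' b',
  [/\ test1 a', test1 b' & h = ctens a' b'].
  rewrite {}/h; elim: w => [|i w [a' [b' [ha' hb' /= ->]]]]; first by exists a, b.
  have [e1 e2] := partial_ctens ha' hb'; case: i; rewrite ?e1 ?e2.
    by exists a', b'^`()%classic; split => //; exact: test1_derive.
  by exists a'^`()%classic, b'; split => //; exact: test1_derive.
split; first by split; [exact: tens_continuous|exact: cst_continuous].
move=> i x; split; last exact: derivable_cst.
case: i; first by have [] := tens_derive_snd a' x (hb'.1 0%N).
by have [] := tens_derive_fst b' x (ha'.1 0%N).
Qed.

Lemma pderiv_ctens n a b : test1 a -> test1 b -> pderiv n (ctens a b) = ctens (derive1n n.1 a)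
  (derive1n n.2 b).
Proof.
move=> ha hb; rewrite /pderiv.
have -> : iter n.2 (partial true) (ctens a b) = ctens a (derive1n n.2 b).
  elim: n.2 => [//|k IH]; rewrite iterS IH derive1nS.
  by have [_ ->] := partial_ctens ha (test1_deriven k hb).
elim: n.1 => [//|k IH]; rewrite iterS IH derive1nS.
by have [-> _] := partial_ctens (test1_deriven k ha) (test1_deriven n.2 hb).
Qed.

Lemma test1_weighted_bnd k a : test1 a ->
  exists2 M : R, 0 <= M & forall i j x, (i <= k)%N -> (j <= k)%N -> `|x| ^+ i * `|derive1n j a x| <=
    M.
Proof.
move=> ha; have [M M0 hM] := test1_uniform_bnd k ha.
have [r hr] : exists r : R, forall j x, r < `|x| -> derive1n j a x = 0.
  have [_ [r hr]] := ha; exists r => j x rx.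
  by apply: (@derive1n_out _ _ 0 r) => [y|]; rewrite subr0//; exact: hr.
exists ((1 + `|r|) ^+ k * M) => [|i j x ik jk]; first by rewrite mulr_ge0// exprn_ge0// addr_ge0.
have [xr|xr] := ltP r `|x|; first by rewrite hr// normr0 mulr0 mulr_ge0// exprn_ge0// addr_ge0.
rewrite ler_pM ?exprn_ge0//; last exact: hM.
have b1 : 1 <= 1 + `|r| by rewrite lerDl.
apply: (@le_trans _ _ ((1 + `|r|) ^+ i)); last exact: ler_weXn2l.
have b0 : 0 <= 1 + `|r| by exact: le_trans b1.
by apply: lerXn2r; rewrite ?nnegrE//; have := ler_norm r; lra.
Qed.

Lemma cabs_real (t : R) : cabs t%:C%C = `|t|.
Proof. by rewrite /cabs /= expr0n addr0 sqrtr_sqr. Qed.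

Lemma schwartz_ctens a b : test1 a -> test1 b -> schwartz (ctens a b).
Proof.
move=> ha hb; split; first exact: smooth_ctens.
move=> k; have [M M0 hM] := test1_weighted_bnd k ha; have [M' M'0 hM'] := test1_weighted_bnd k hb.
apply: (@le_lt_trans _ _ (M * M')%:E); last exact: ltry.
apply: ge_ereal_sup => _ [i [j [x [ik jk ->]]]];
  rewrite lee_fin pderiv_ctens// /ctens cabs_real /tens normrM mulrACA.
have [i1 i2] : (i.1 <= k)%N /\ (i.2 <= k)%N by split;
  [exact: leq_trans (leq_addr _ _) ik|exact: leq_trans (leq_addl _ _) ik].
have [j1 j2] : (j.1 <= k)%N /\ (j.2 <= k)%N by split;
  [exact: leq_trans (leq_addr _ _) jk|exact: leq_trans (leq_addl _ _) jk].
by apply: ler_pM; rewrite ?mulr_ge0 ?exprn_ge0//; [exact: hM|exact: hM'].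
Qed.

End schwartz_tensors.

(** * From the distribution to its continuous representative *)

Section vanishing.
Context {R : realType}.
Local Notation plane := (R * R)%type.

(** The integral is the Fourier transform at 0, where every factor of the product equals 1. *)
Lemma up_function_facts (Psi0 : R -> R) : up_function Psi0 ->
  [/\ test1 Psi0, (forall x, 1 < `|x| -> Psi0 x = 0) & I1 Psi0 = 1].
Proof.
move=> [sm cl fo].
have out x : 1 < `|x| -> Psi0 x = 0.
  move=> hx; apply/eqP/negPn/negP => nz.
  have : closure [set x | Psi0 x != 0] x by exact: subset_closure.
  by rewrite cl /= in_itv /= -ler_norml leNgt hx.
split => //; first by split => //; exists 1.
have [h _] := fo 0; have <- : complex.Re (fourier Psi0 0) = I1 Psi0.
  by rewrite /fourier /=; apply: I1_ext => y; rewrite mul0r mulr0 cos0 mulr1.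
rewrite (_ : (fun n => _) = (fun=> 1)) in h; last first.
  by apply/funext => n; rewrite big1// => i _; rewrite mulr0 /sinc eqxx.
by rewrite -(cvg_lim _ h)// lim_cst.
Qed.

Lemma closed_box_compact (c1 c2 r : R) :
  compact (`[c1 - r, c1 + r]%classic `*` `[c2 - r, c2 + r]%classic : set plane).
Proof. by apply: compact_setX; exact: segment_compact. Qed.

Lemma continuous_box_mc2 (F : plane -> R) (c1 c2 r : R) : continuous F ->
  mc2 (fun y => F y * tens (box_ind c1 r) (box_ind c2 r) y).
Proof.
move=> cF; have cpt : compact (F @` (`[c1 - r, c1 + r]%classic `*` `[c2 - r, c2 + r]%classic)).
  by apply: continuous_compact; [exact: continuous_subspaceT|exact: closed_box_compact].
have [M [_ hM]] := compact_bounded cpt.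
have [_ [M' [r' hB]]] := mc2_tens (mc1_box_ind c1 r) (mc1_box_ind c2 r).
split.
  apply: measurable_funM; first exact: continuous_plane_measurable.
  exact: (mc2_meas (mc2_tens (mc1_box_ind c1 r) (mc1_box_ind c2 r))).
exists (`|M| + 1), r' => y; split; last by move=> /(hB y).2 ->; rewrite mulr0.
have M0 : 0 <= `|M| + 1 by rewrite addr_ge0.
rewrite /tens /box_ind !indicE.
case: (boolP (y.1 \in _)) => y1; last by rewrite mul0r mulr0 normr0.
case: (boolP (y.2 \in _)) => y2; last by rewrite mulr0 mulr0 normr0.
rewrite !mulr1; apply: hM; last by exists y => //; split; [exact: set_mem y1|exact: set_mem y2].
by rewrite (le_lt_trans (ler_norm M))// ltrDl.
Qed.

Lemma dil_out J (q : R -> R) (d : R) t : (forall t, 1 < `|t| -> q t = 0) -> 1 <= 2 ^+ J * d ->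
  d < `|t| -> dil J q t = 0.
Proof.
move=> hq Jd dt; rewrite /dil hq ?mulr0// normrM ger0_norm ?exprn_ge0//.
by apply: le_lt_trans Jd _; rewrite ltr_pM2l// exprn_gt0.
Qed.

(** F need not have bounded support, so it is cut off to a box around x. This keeps continuity at x
    and does not alter the mollified values there, which converge to F(x). *)
Lemma mollified_zero (q : R -> R) (F : plane -> R) x (J1 : nat) : test1 q -> I1 q = 1 ->
  (forall t, 1 < `|t| -> q t = 0) -> continuous F ->
  (forall J, (J1 <= J)%N -> I2 (fun y => F y * tens (dil J q) (dil J q) (x - y)) = 0) -> F x = 0.
Proof.
move=> tq iq oq cF hz.
pose B : plane -> R := tens (box_ind x.1 1) (box_ind x.2 1); pose F1 y := F y * B y.
have mF1 : mc2 F1 by exact: continuous_box_mc2.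
have B1 y : `|x.1 - y.1| <= 1 -> `|x.2 - y.2| <= 1 -> B y = 1.
  by move=> h1 h2; rewrite /B /tens !box_ind_in ?mulr1// distrC.
have F1x : F1 x = F x by rewrite /F1 B1 ?mulr1// subrr normr0.
have cF1 : {for x, continuous F1}.
  have nx : \forall y \near x, F y = F1 y.
    by apply/nbhs_ballP; exists 1 => //= y [/ltW y1 /ltW y2]; rewrite /F1 B1 ?mulr1.
  by rewrite /prop_for /continuous_at F1x; apply: cvg_trans (cF x); exact: near_eq_cvg.
apply/eqP; rewrite -normr_le0; apply/ler_addgt0Pr => e e0; rewrite add0r -F1x.
have [J0 hJ] := mollifier_cvg tq iq mF1 cF1 e0.
have {hJ} := hJ (maxn J0 J1) (leq_maxl _ _).
rewrite (_ : conv2 _ _ _ = 0) ?sub0r ?normrN//.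
rewrite -(hz (maxn J0 J1) (leq_maxr _ _)); apply: I2_ext => y; rewrite /F1 mulrCA /tens /=.
have pw : 1 <= (2 : R) ^+ maxn J0 J1 * 1 by rewrite mulr1 exprn_ege1// ler1n.
have [h1|h1] := ltP 1 `|x.1 - y.1|; first by rewrite (dil_out oq pw h1) !mul0r !mulr0.
have [h2|h2] := ltP 1 `|x.2 - y.2|; first by rewrite (dil_out oq pw h2) mulr0 !mul0r !mulr0.
by rewrite B1// mulr1.
Qed.

Lemma ctens_test a b (c : plane) (r : R) (U : set plane) : test1 a -> test1 b ->
  (forall t, r < `|c.1 - t| -> a t = 0) -> (forall t, r < `|c.2 - t| -> b t = 0) ->
  (forall y, `|c.1 - y.1| <= r -> `|c.2 - y.2| <= r -> U y) -> test_function U (ctens a b).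
Proof.
move=> ta tb oa ob hU.
pose B : set plane := `[c.1 - r, c.1 + r]%classic `*` `[c.2 - r, c.2 + r]%classic.
have cB : compact B by exact: closed_box_compact.
have clB : closed B by apply: compact_closed => //; exact: norm_hausdorff.
have sB : fsupport (ctens a b) `<=` B.
  rewrite /fsupport [X in _ `<=` X](_ : B = closure B); last by apply/closure_id.
  apply: closure_subset => y /=; rewrite /ctens /tens => h.
  have itv (z t : R) (h' : R -> R) : (forall t, r < `|z - t| -> h' t = 0) -> h' t != 0 ->
    z - r <= t <= z + r.
    move=> hh; have [k|k _] := ltP r `|z - t|; first by rewrite hh// eqxx.
    by move: k; rewrite ler_norml => /andP[k1 k2]; apply/andP; split; lra.
  split; rewrite /= in_itv /=.
    by apply: (itv _ _ _ oa); apply: contraNneq h => ->; rewrite mul0r.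
  by apply: (itv _ _ _ ob); apply: contraNneq h => ->; rewrite mulr0.
split; first exact: smooth_ctens.
  by apply: (subclosed_compact _ cB sB); exact: closed_closure.
move=> y /sB[]; rewrite /= !in_itv /= => /andP[h1 h2] /andP[h3 h4]; apply: hU; rewrite ler_norml;
  apply/andP; split; lra.
Qed.

Lemma cre_mul_real (f : plane -> R[i]) (k : plane -> R) : cre (fun y => f y * (k y)%:C%C) = fun y =>
  cre f y * k y.
Proof. by apply/funext => y; rewrite /cre; case: (f y) => u v /=; rewrite mulr0 subr0. Qed.

Lemma cim_mul_real (f : plane -> R[i]) (k : plane -> R) : cim (fun y => f y * (k y)%:C%C) = fun y =>
  cim f y * k y.
Proof. by apply/funext => y; rewrite /cim; case: (f y) => u v /=; rewrite mulr0 add0r. Qed.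

Lemma represents_ctens T (f : plane -> R[i]) a b : represents f T -> test1 a -> test1 b ->
  T (ctens a b) = (I2 (fun y => cre f y * tens a b y) +i* I2 (fun y => cim f y * tens a b y))%C.
Proof.
move=> h ta tb; rewrite h; last exact: schwartz_ctens.
by rewrite /cintegral cre_mul_real cim_mul_real.
Qed.

Lemma test1_reflect (a : R -> R) (x : R) : test1 a -> test1 (fun t => a (x - t)).
Proof.
move=> ta; have n1 : (-1 : R) != 0 by rewrite oppr_eq0 oner_neq0.
have := test1_affine x 1 n1 ta; congr test1; apply/funext => t; rewrite mul1r; congr a; ring.
Qed.

Lemma dconv_conv2 T (f : plane -> R[i]) L Psi0 m x : test1 Psi0 -> represents f T ->
  dconv (Psi2 L Psi0 m) T x = (conv2 (ker (Psi L Psi0) m) (cre f) x +i* conv2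
    (ker (Psi L Psi0) m) (cim f) x)%C.
Proof.
move=> t0 h; have tP j := test1_reflect _ (test1_Psi L t0 j).
rewrite /dconv [LHS](represents_ctens h (tP x.1 m.1) (tP x.2 m.2)).
by congr (_ +i* _)%C; apply: I2_ext => y; rewrite mulrC.
Qed.

(** Off the support T kills all test functions near x, in particular the narrow reflected dilates of
    [Psi0] centred at x, and those recover f(x) in the limit. *)
Lemma dsupport_vanish T (f : plane -> R[i]) (Psi0 : R -> R) : up_function Psi0 -> represents f T ->
  ccontinuous f -> forall x, ~ dsupport T x -> f x = 0.
Proof.
move=> /up_function_facts[t0 o0 i0] h [cf1 cf2] x nd.
have [U [oU Ux hU]] : exists U, [/\ open U, U x & forall phi, test_function U phi -> T phi = 0].
  apply: contra_notP nd => nU U oU Ux; apply: contra_notP nU => nphi; exists U;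
    split => // phi hphi.
  by apply: contra_notP nphi => /eqP nz; exists phi.
have [d d0 hd] : exists2 d : R, 0 < d & ball x d `<=` U by apply/nbhs_ballP; exact: open_nbhs_nbhs.
have [J1 hJ1] := nat_bound (2 / d).
have key J : (J1 <= J)%N -> T (ctens (fun t => dil J Psi0 (x.1 - t))
  (fun t => dil J Psi0 (x.2 - t))) = 0.
  move=> J1J; have Jd : 1 <= 2 ^+ J * (d / 2).
    rewrite -ler_pdivrMr ?divr_gt0// invf_div mul1r (le_trans hJ1)// -natrX ler_nat.
    exact/(leq_trans J1J)/ltnW/ltn_expl.
  apply: hU; apply: (@ctens_test _ _ x (d / 2)).
  - exact: test1_reflect (test1_dil J t0).
  - exact: test1_reflect (test1_dil J t0).
  - by move=> t; exact: (dil_out o0 Jd).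
  - by move=> t; exact: (dil_out o0 Jd).
  - by move=> y y1 y2; apply: hd; split; rewrite /ball /=; lra.
have key1 J : (J1 <= J)%N -> I2 (fun y => cre f y * tens (dil J Psi0) (dil J Psi0) (x - y)) = 0 /\
                            I2 (fun y => cim f y * tens (dil J Psi0) (dil J Psi0) (x - y)) = 0.
  by move=> /key; rewrite (represents_ctens h (test1_reflect _ (test1_dil J t0))
    (test1_reflect _ (test1_dil J t0))) => -[].
have e1 : cre f x = 0 by apply: (mollified_zero t0 i0 o0 cf1) => J /key1[].
have e2 : cim f x = 0 by apply: (mollified_zero t0 i0 o0 cf2) => J /key1[].
by move: e1 e2; rewrite /cre /cim; case: (f x) => u v /= -> ->.
Qed.

End vanishing.

(** * Translating the norm and the cubature sum *)

Section upper_interface.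
Context {R : realType}.
Local Notation plane := (R * R)%type.

(** Points outside the closed square lie arbitrarily close to z. This is needed since the lattice
    meets the sides x = 1 and y = 1, whereas the cubature points lie in [0, 1[^2. *)
Lemma boundary_zero (F : plane -> R) z : continuous F -> square_supp F -> z.1 =
  1 \/ z.2 = 1 -> F z = 0.
Proof.
move=> cF sF hz; apply/eqP/negPn/negP => nz.
have : \forall y \near z, 0 < `|F y|.
  have : `|F y| @[y --> z] --> `|F z| by apply: cvg_norm; exact: cF.
  by move=> /cvgr_gt; apply; rewrite normr_gt0.
move=> /nbhs_ballP[d /= d0 hd].
have d2 : `|- (d / 2)| < d by rewrite normrN ger0_norm ?divr_ge0 ?ltW//; lra.
have d20 : 0 < d / 2 by rewrite divr_gt0.
have key (y : plane) : ball z d y -> ~ unit_square y -> False.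
  by move=> /hd h /sF h'; move: h; rewrite /= h' normr0 ltxx.
case: hz => hz.
  apply: (key (z.1 + d / 2, z.2)).
    by split; rewrite /ball /= ?subrr ?normr0// opprD addNKr.
  by move=> /unit_squareP /= [/andP[_ h] _]; lra.
apply: (key (z.1, z.2 + d / 2)).
  by split; rewrite /ball /= ?subrr ?normr0// opprD addNKr.
by move=> /unit_squareP /= [_ /andP[_ h]]; lra.
Qed.

Lemma lsum_unit_square (F : plane -> R) N g : (0 < N)%N -> continuous F -> square_supp F ->
  lsum N g F = N%:R^-1 * \sum_(n < N) F (@lattice_points R N g n).
Proof.
move=> N0 cF sF; congr (_ * _).
have N0R : 0 < N%:R :> R by rewrite ltr0n.
(* Subtracting the floor is the unique integer translation bringing the second coordinate into [0,
   1[, so these indices list every lattice point of the half-open square once. *)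
pose h (n : nat) : int * int := (n%:Z, - Num.floor ((n * g)%:R / N%:R : R)).
have hE n : lattice_pt N g (h n) = (n%:R / N%:R, Defs.frac ((n * g)%:R / N%:R)) :> plane.
  by rewrite /lattice_pt /h /Defs.frac /= rmorphN natrM.
rewrite (@fsbigE _ _ _ _ _ [seq h n | n <- iota 0 N])//.
- rewrite big_mkcond big_map -(big_mkord xpredT
  (fun n => F (n%:R / N%:R, Defs.frac ((n * g)%:R / N%:R)))).
  rewrite /index_iota subn0; apply: eq_bigr => n _.
  by rewrite in_setT hE.
- by rewrite map_inj_uniq ?iota_uniq// => a b [].
move=> [i j] _ /negP hij; have [/unit_squareP|] :=
  pselect (unit_square (lattice_pt N g (i, j) : plane)); last exact: sF.
rewrite /= => -[/andP[x0 x1] /andP[y0 y1]].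
have [e1|n1] := eqVneq (i%:~R / N%:R : R) 1; first by apply: boundary_zero => //; left.
have [e2|n2] := eqVneq (i%:~R * g%:R / N%:R + j%:~R : R) 1; first by apply: boundary_zero => //;
  right.
exfalso; apply: hij.
have {x1 n1} x1 : i%:~R / N%:R < 1 :> R by rewrite lt_neqAle n1.
have {y1 n2} y1 : i%:~R * g%:R / N%:R + j%:~R < 1 :> R by rewrite lt_neqAle n2.
have i0 : (0 <= i)%R by rewrite -(ler0z R); move: x0; rewrite pmulr_lge0// invr_gt0.
have iN : (i < N%:Z)%R by move: x1; rewrite ltr_pdivrMr// mul1r -(ltr_int R).
case: i i0 iN x0 x1 y0 y1 => [n|//] _ nN x0 x1 y0 y1.
apply/mapP; exists n; first by rewrite mem_iota add0n.
rewrite /h; congr (_, _); rewrite natrM (@floor_def _ _ (- j)) ?opprK//.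
rewrite rmorphD rmorphN /= ; apply/andP; split; move: y0 y1; rewrite -!pmulrn; lra.
Qed.

Lemma mc2_cabs (u v : plane -> R) : mc2 u -> mc2 v -> mc2 (fun x => cabs (u x +i* v x)%C).
Proof.
move=> [mu [Mu [ru hu]]] [mv [Mv [rv hv]]]; split.
  have ms : measurable_fun setT (@Num.sqrt R) by apply: continuous_measurable_fun;
    exact: sqrt_continuous.
  rewrite /cabs /=; apply: (measurableT_comp ms).
  by apply: measurable_funD; exact: measurable_funX.
exists (Num.sqrt (Mu ^+ 2 + Mv ^+ 2)), (Num.max ru rv) => x; rewrite /cabs /=.
have [u1 u2] := hu x; have [v1 v2] := hv x; split.
  rewrite ger0_norm ?sqrtr_ge0// ler_sqrt ?addr_ge0 ?sqr_ge0// lerD//.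
    by rewrite -(real_normK (num_real (u x))) lerXn2r// nnegrE (le_trans _ u1).
  by rewrite -(real_normK (num_real (v x))) lerXn2r// nnegrE (le_trans _ v1).
by rewrite gt_max => /andP[/u2 -> /v2 ->]; rewrite expr0n addr0 sqrtr0.
Qed.

Lemma cabs_ge (a b : R) : `|a| <= cabs (a +i* b)%C /\ `|b| <= cabs (a +i* b)%C.
Proof. by rewrite /cabs /= -!sqrtr_sqr; split;
  rewrite ler_sqrt ?addr_ge0 ?sqr_ge0// ?lerDl ?lerDr sqr_ge0. Qed.

Lemma cabs_le (a b : R) : cabs (a +i* b)%C <= `|a| + `|b|.
Proof.
rewrite /cabs /= -(ger0_norm (addr_ge0 (normr_ge0 a) (normr_ge0 b))) -sqrtr_sqr.
rewrite ler_sqrt ?sqr_ge0// sqrrD !real_normK ?num_real//.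
by rewrite addrAC lerDl mulrn_wge0// mulr_ge0.
Qed.

Lemma lp_le_LpC (p : \bar R) (h : plane -> R) (F : plane -> R[i]) : (1 <= p)%E -> mc2 h ->
  mc2 (fun x => cabs (F x)) -> (forall x, `|h x| <= cabs (F x)) ->
  (LpC p F < +oo)%E -> lp_le p h (fine (LpC p F)).
Proof.
move=> p1 mh mF hF fin.
have L0 : (0 <= LpC p F)%E by exact: Lnorm_ge0.
have fn : LpC p F \is a fin_num by rewrite ge0_fin_numE.
case: p p1 L0 fin fn => [q| |]//= p1 L0 fin fn; last first.
  have : LpC +oo%E F = (fine (LpC +oo%E F))%:E by rewrite fineK.
  (* For p = oo the norm is an essential supremum only when the whole space has positive measure; in
     the other branch any statement holds almost everywhere. *)
  set H := fine _; rewrite /LpC unlock; case: ifPn => [_ e|m0 _].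
    have := ess_sup_ge (@leb2 R) (abse \o (fun x => (cabs (F x))%:E)); rewrite e.
    apply: (@filterS _ _ (ae_filter_ringOfSetsType _)) => x /=; rewrite lee_fin; apply: le_trans.
    by apply: le_trans (hF x) _; exact: ler_norm.
  exists setT; split => //; apply/eqP; rewrite eq_le measure_ge0 andbT leNgt; exact: m0.
have {}p1 : 1 <= q by rewrite -lee_fin.
have q0 : 0 < q by apply: lt_le_trans p1.
rewrite -lee_fin.
have := powR_Lnorm (@leb2 R) (fun x => (cabs (F x))%:E) (lt0r_neq0 q0).
rewrite -/(LpC q%:E F) -[LpC _ _ in X in X -> _](fineK fn) poweR_EFin => ->.
have i2 := mcs_integrable gauge2 (mc2_powR q0 mF).
apply: (@le_trans _ _ (I2 (fun x => `|cabs (F x)| `^ q))%:E).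
  rewrite lee_fin; apply: le_I2; [exact: mc2_powR|exact: mc2_powR|move=> x].
  by apply: ge0_ler_powR; rewrite ?nnegrE ?(ltW q0)//; apply: le_trans (hF x) (ler_norm _).
rewrite /I2 /Rintegral fineK; last exact: integrable_fin_num i2.
by rewrite le_eqVlt; apply/orP; left; apply/eqP; apply: eq_integral => x _.
Qed.

(** A single weighted block is controlled by the whole norm, so no block is infinite and [fine]
    loses nothing. The antidiagonals are then finite parts of a nonnegative sum. *)
Lemma besov_norm_seq (L : nat) (Psi0 : R -> R) (s : R) (p theta : \bar R) T : (1 <= theta)%E ->
  let b m := LpC p (dconv (Psi2 L Psi0 m) T) in
  (besov_norm L Psi0 s p theta T <= 1)%E ->
  (forall m, (b m < +oo)%E) /\ besov_seq theta s (fun m => fine (b m)).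
Proof.
move=> t1 b; rewrite /besov_norm -/b.
have b0 m : (0 <= b m)%E by exact: Lnorm_ge0.
case: theta t1 => [t| |]//= t1 hn; last first.
  have h m : ((2 `^ (s * (m.1 + m.2)%:R))%:E * b m <= 1)%E.
    by apply: le_trans hn; apply: ereal_sup_ubound; exists m.
  have bf m : (b m < +oo)%E.
    rewrite ltey; apply/eqP => e; have := h m.
    by rewrite e gt0_muley ?lte_fin ?powR_gt0// leye_eq.
  by split => // m; have := h m; rewrite -[b m]fineK ?ge0_fin_numE//= lee_fin.
have {}t1 : 1 <= t by rewrite -lee_fin.
have t0 : 0 < t by apply: lt_le_trans t1.
pose a m := ((2 `^ (s * (m.1 + m.2)%:R * t))%:E * b m `^ t)%E.
have a0 m : (0 <= a m)%E by rewrite mule_ge0 ?poweR_ge0// lee_fin powR_ge0.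
have {}hn : (\esum_(m in [set: nat * nat]) a m <= 1)%E.
  have e0 : (0 <= \esum_(m in [set: nat * nat]) a m)%E by exact: esum_ge0.
  have := @gt0_ler_poweR R t (ltW t0) ((\esum_(m in [set: nat * nat]) a m) `^ t^-1)%E 1%E.
  rewrite -poweRrM mulVf ?gt_eqF// poweRe1// poweR1r => h; apply: h => //.
    by rewrite in_itv /= poweR_ge0 leey.
  by rewrite in_itv /= lee01 leey.
have hseq (r : seq (nat * nat)) : uniq r -> (\sum_(m <- r) a m <= 1)%E.
  move=> ur; apply: le_trans hn; apply: esum_ge; exists [set` r]; first by split => //;
    exact: finite_seq.
  by rewrite -fsbig_seq.
have bf m : (b m < +oo)%E.
  rewrite ltey; apply/eqP => e; have := hseq [:: m] isT.
  by rewrite big_seq1 /a e poweRyr ?gt_eqF// gt0_muley ?lte_fin ?powR_gt0// leye_eq.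
have aE m : a m = ((2 `^ (s * (m.1 + m.2)%:R) * fine (b m)) `^ t)%:E.
  by rewrite /a -[b m]fineK ?ge0_fin_numE// poweR_EFin -EFinM /= powRM ?fine_ge0//
    ?powR_ge0// -powRrM.
split => // l.
have ur : uniq [seq (i, (l - i)%N) | i <- iota 0 l.+1] by rewrite map_inj_uniq ?iota_uniq// =>
  i j [].
have := hseq _ ur; rewrite big_map (eq_bigr _ (fun i _ => aE _)) sumEFin lee_fin.
rewrite (_ : iota 0 l.+1 = index_iota 0 l.+1)// big_mkord; apply: le_trans.
by rewrite le_eqVlt; apply/orP; left; apply/eqP; apply: eq_bigr => i _; rewrite /= subnKC// -ltnS.
Qed.

End upper_interface.

Section upper_bound.
Context {R : realType}.
Local Notation plane := (R * R)%type.

Lemma complex_mean (N : nat) (z : 'I_N -> R[i]) :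
  N%:R^-1 * \sum_(n < N) z n =
  (N%:R^-1 * (\sum_(n < N) complex.Re (z n)) +i* (N%:R^-1 * (\sum_(n < N) complex.Im (z n))))%C.
Proof.
have -> : \sum_(n < N) z n = ((\sum_(n < N) complex.Re (z n)) +i*
  (\sum_(n < N) complex.Im (z n)))%C.
  elim: N z => [|N IH] z; first by rewrite !big_ord0.
  by rewrite !big_ord_recl IH; case: (z ord0) => a b; apply/eqP; rewrite eq_complex /= !eqxx.
have -> : N%:R^-1 = (N%:R^-1 : R)%:C%C by rewrite fmorphV rmorph_nat.
by apply/eqP; rewrite eq_complex /= !mul0r subr0 addr0 !eqxx.
Qed.

Lemma square_supp_mc2 (F : plane -> R) : continuous F -> square_supp F -> mc2 F.
Proof.
move=> cF sF; have := continuous_box_mc2 2^-1 2^-1 2^-1 cF; congr mc2; apply/funext => y.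
have [/unit_squareP[/andP[h1 h2] /andP[h3 h4]]|h] := pselect (unit_square y);
  last by rewrite sF// mul0r.
rewrite /tens !box_ind_in ?mulr1// ler_norml; apply/andP; split; lra.
Qed.

Lemma Rintegral_square (F : plane -> R) : square_supp F -> Rintegral leb2 unit_square F = I2 F.
Proof.
move=> sF; rewrite Rintegral_mkcond; apply: I2_ext => y; rewrite patchE.
by case: ifPn => // /negP h; rewrite sF// => h'; apply: h; rewrite inE.
Qed.

(** Convolution with the real [Psi] respects real and imaginary parts, and each is dominated by the
    modulus. The real estimate is thus applied twice, whence 2C. *)
Lemma upper_half (L K : nat) (Psi0 : R -> R) (s : R) (p theta : \bar R) :
  up_function Psi0 -> (1 <= p)%E -> (1 <= theta)%E -> (p^-1 < s%:E)%E ->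
  exists2 c : R, 0 < c & forall N g, (0 < g < N)%N -> coprime g N -> (max_quotient g N <= K)%N ->
  (wce L Psi0 s p theta (@lattice_points R N g) <=
     (c * (log2 N%:R `^ (1 - fine (theta^-1)%E) / N%:R `^ s))%:E)%E.
Proof.
move=> up p1 t1 ps; have [t0 o0 i0] := up_function_facts up.
have [C C0 hC] := upper_core L K t0 o0 i0 p1 t1 (fine_inv_lt p1 ps).
exists (2 * C); first by rewrite mulr_gt0.
move=> N g gN cop gK; apply: ge_ereal_sup => _ [T [f [[bT dT cf rep] nT ->]]]; rewrite lee_fin.
have N0 : (0 < N)%N by case/andP: gN => _; exact: leq_ltn_trans.
have f0 z : ~ unit_square z -> f z = 0 by move=> nz; apply: (dsupport_vanish up rep cf) => /dT.
have [sq1 sq2] : square_supp (cre f) /\ square_supp (cim f).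
  by split=> z /f0; rewrite /cre /cim => ->.
have [cf1 cf2] := cf.
have m1 := square_supp_mc2 cf1 sq1; have m2 := square_supp_mc2 cf2 sq2.
have [fin bs] := besov_norm_seq t1 nT.
pose b m := LpC p (dconv (Psi2 L Psi0 m) T).
have b0 m : 0 <= fine (b m) by rewrite fine_ge0// Lnorm_ge0.
have dE m : dconv (Psi2 L Psi0 m) T = fun x =>
  (conv2 (ker (Psi L Psi0) m) (cre f) x +i* conv2 (ker (Psi L Psi0) m) (cim f) x)%C.
  by apply/funext => x; exact: dconv_conv2.
have mk m := mc2_Psi L t0 m.
have lp m : lp_le p (conv2 (ker (Psi L Psi0) m) (cre f)) (fine (b m)) /\
  lp_le p (conv2 (ker (Psi L Psi0) m) (cim f)) (fine (b m)).
  have fm := fin m; rewrite dE in fm; rewrite /b dE.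
  have c1 := mc2_conv2 (mk m) m1; have c2 := mc2_conv2 (mk m) m2; have mc := mc2_cabs c1 c2.
  by split; apply: lp_le_LpC => // x; have [] := cabs_ge (conv2 (ker (Psi L Psi0) m) (cre f) x)
    (conv2 (ker (Psi L Psi0) m) (cim f) x).
have e1 := hC N g gN cop gK (cre f) (fun m => fine (b m)) cf1 m1 sq1 b0 (fun m => (lp m).1) bs.
have e2 := hC N g gN cop gK (cim f) (fun m => fine (b m)) cf2 m2 sq2 b0 (fun m => (lp m).2) bs.
rewrite complex_mean /cintegral !Rintegral_square//.
have -> u v u' v' : ((u +i* v) - (u' +i* v') = (u - u') +i* (v - v') :> R[i])%C.
  by apply/eqP; rewrite eq_complex /= !eqxx.
by apply: le_trans (cabs_le _ _) _; move: e1 e2; rewrite /err !(lsum_unit_square g N0)// => e1 e2;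
  apply: le_trans (lerD e1 e2) _; rewrite -mulrA mulr2n mulrDl mul1r.
Qed.

End upper_bound.

(** * A fooling function and the lower bound *)

Section cells.
Context {R : realType}.
Implicit Types (w P : R -> R).

Definition cell (a k : nat) w (x : R) := w (2 ^+ a * x - k%:R).

(** Support in the middle half of [0, 1]: bumps on neighbouring dyadic intervals are disjoint with a
    gap, so at most one of them is nonzero at any point, endpoints included. *)
Definition narrow w := forall t, 4^-1 < `|t - 2^-1| -> w t = 0.

Lemma narrow_sum w (M Y : R) n : 0 <= M -> (forall t, `|w t| <= M) -> narrow w ->
  \sum_(k < n) `|w (Y - k%:R)| <= M.
Proof.
move=> M0 hM nw.
case: (pickP (fun k : 'I_n => w (Y - k%:R) != 0)) => [k hk|h]; last first.
  by rewrite big1// => k _; have /negbFE/eqP -> := h k; rewrite normr0.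
rewrite (bigD1 k)//= big1 ?addr0// => i ik.
have near_half (j : 'I_n) : w (Y - j%:R) != 0 -> `|Y - j%:R - 2^-1| <= 4^-1.
  by move=> hj; rewrite leNgt; apply/negP => /nw h; rewrite h eqxx in hj.
have [->|hi] := eqVneq (w (Y - i%:R)) 0; first exact: normr0.
have := near_half _ hk; have := near_half _ hi; rewrite !ler_norml => /andP[a1 a2] /andP[b1 b2].
exfalso; case/eqP: ik; apply/val_inj/eqP; rewrite /= eqn_leq.
by apply/andP; split; rewrite -ltnS -(ltr_nat R) -[_.+1%:R]natr1; lra.
Qed.

Lemma cell_affine a k w : cell a k w = (fun x => 1 * w (2 ^+ a * x + - k%:R)).
Proof. by apply/funext => x; rewrite mul1r. Qed.

Lemma test1_cell a k w : test1 w -> test1 (cell a k w).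
Proof. by move=> hw; rewrite cell_affine; exact: (test1_affine _ _ (pow2_neq0 a) hw). Qed.

Lemma mc1_cell a k w : mc1 w -> mc1 (cell a k w).
Proof. by move=> hw; exact: (mc1_affine (- k%:R) (pow2_neq0 a) hw). Qed.

Lemma I1_cell a k w : mc1 w -> I1 (cell a k w) = 2 ^- a * I1 w.
Proof.
by move=> hw; have := I1_affine (- k%:R) (pow2_neq0 a) hw; rewrite ger0_norm ?exprn_ge0.
Qed.

Lemma derive1n_cell n a k w : smooth1 w ->
  derive1n n (cell a k w) = cell a k (fun t => (2 ^+ a) ^+ n * derive1n n w t).
Proof. by move=> sw; rewrite cell_affine derive1n_affine//; apply/funext => x; rewrite mul1r. Qed.

(** The sum is taken inside the integral, where at each y at most one bump is alive. The bound
    therefore does not grow with the number of bumps. *)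
Lemma conv_cells_le P w (M x : R) a n : mc1 P -> mc1 w -> 0 <= M -> (forall t, `|w t| <= M)
  -> narrow w ->
  \sum_(k < n) `|convol P (cell a k w) x| <= M * I1 (fun y => `|P y|).
Proof.
move=> mP mw M0 hM nw.
have mk (k : nat) : mc1 (fun y => `|P (x - y) * cell a k w y|) :=
  mcs_abs (conv_int x mP (mc1_cell a k mw)).
apply: (@le_trans _ _ (\sum_(k < n) I1 (fun y => `|P (x - y) * cell a k w y|))).
  by apply: ler_sum => k _; apply: norm_I1 => //; exact: conv_int x mP (mc1_cell a k mw).
rewrite -(I1_sum (index_enum 'I_n) xpredT (fun k : 'I_n => mk k)).
rewrite -(I1_sub x (mcs_abs mP)) -I1Z; last exact: (mc1_sub x (mcs_abs mP)).
apply: le_I1; [exact: (mcs_sum _ _ (fun k : 'I_n => mk k))|exact: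
  (mcsZ M (mc1_sub x (mcs_abs mP)))|move=> y].
under eq_bigr do rewrite normrM.
by rewrite -mulr_sumr mulrC ler_wpM2r//; exact: narrow_sum.
Qed.

(** If [Psi] oscillates on a finer scale than the bumps, L+1 derivatives are moved onto them: each
    costs 2^a and gains the inverse scale of [Psi]. For mu <= a the truncated exponent is 0 and the
    plain bound suffices. *)
Lemma conv_cells_decay (L : nat) (Psi0 beta : R -> R) : test1 Psi0 -> test1 beta -> narrow beta ->
  exists2 C : R, 0 < C & forall a mu n x,
    \sum_(k < n) `|convol (Psi L Psi0 mu) (cell a k beta) x| <= C * 2 ^- (L.+1 * (mu - a)).
Proof.
move=> t0 tb nb; have [M M0 hM] := test1_bnd tb;
  have [M1 M10 hM1] := test1_bnd (test1_deriven L.+1 tb).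
have m0 := test1_mc1 t0; have mb := test1_mc1 tb; have m1 := test1_mc1 (test1_Psi1 L t0).
(* The difference of two dilates of [Psi0] has mean zero, so it contains one more derivative. This
   raises the order from L to L+1, as required by s < L+1. *)
have [Th tT eT] : exists2 W, test1 W & W^`()%classic = (fun x => dil 1 Psi0 x - Psi0 x).
  apply: test1_antiderivative; first by apply: test1B => //; exact: test1_dil.
  by rewrite I1B ?I1_dil ?subrr//; exact: mc1_dil.
have eP : Psi1 L Psi0 = derive1n L.+1 Th by rewrite Psi1E derive1Sn eT.
pose A := I1 (fun y => `|Psi0 y|) + I1 (fun y => `|Psi1 L Psi0 y|).
pose B := I1 (fun y => `|Th y|).
have A0 : 0 <= A by rewrite addr_ge0// I1_ge0.
have B0 : 0 <= B by exact: I1_ge0.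
pose C := 1 + M * A + 2 ^+ L.+1 * (M1 * B).
have C0 : 0 < C by rewrite ltr_wpDr ?mulr_ge0 ?exprn_ge0// ltr_wpDr ?mulr_ge0.
exists C => // a mu n x.
have easy : \sum_(k < n) `|convol (Psi L Psi0 mu) (cell a k beta) x| <= M * A.
  apply: le_trans (conv_cells_le x a n (test1_mc1 (test1_Psi L t0 mu)) mb M0 hM nb) _.
  rewrite ler_wpM2l// /A; case: mu => [|j] /=; first by rewrite lerDl I1_ge0.
  rewrite [X in X <= _](_ : _ = I1 (fun y => `|Psi1 L Psi0 y|)) ?lerDr ?I1_ge0//.
  rewrite -(I1_dil j (mcs_abs m1)); apply: I1_ext => y.
  by rewrite /dil normrM normrX ger0_norm.
have [ma|am] := leqP mu a.
  rewrite (eqP ma) muln0 expr0 invr1 mulr1; apply: le_trans easy _.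
  by rewrite /C -addrA addrCA lerDl addr_ge0// mulr_ge0// ?exprn_ge0// mulr_ge0.
case: mu am {easy} => [//|j]; rewrite ltnS => aj.
(* The antiderivative of order L+1 of level j+1. Its scale is 2^j rather than 2^(j+1), which
   accounts for the factor 2^(L+1) in C. *)
pose G := fun x => (2 ^+ j) ^- L.+1 * dil j Th x.
have tG : test1 G by apply: test1Z; exact: test1_dil.
have -> : Psi L Psi0 j.+1 = derive1n L.+1 G.
  have -> : G = fun x => ((2 ^+ j) ^- L.+1 * 2 ^+ j) * Th (2 ^+ j * x + 0).
    by apply/funext => y; rewrite /G /dil addr0 mulrA.
  rewrite (derive1n_affine _ _ _ _ tT.1) -eP; apply/funext => y /=.
  by rewrite addr0; congr (_ * _); rewrite mulrAC mulVf ?mul1r// expf_neq0// pow2_neq0.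
pose w t := (2 ^+ a) ^+ L.+1 * derive1n L.+1 beta t.
have mw : mc1 w by apply: test1_mc1; apply: test1Z; exact: test1_deriven.
have nw : narrow w by move=> t ht; rewrite /w (derive1n_out _ nb ht) mulr0.
have p0 : 0 <= (2 ^+ a) ^+ L.+1 :> R by rewrite !exprn_ge0.
have hw t : `|w t| <= (2 ^+ a) ^+ L.+1 * M1 by rewrite /w normrM ger0_norm// ler_wpM2l.
rewrite (eq_bigr (fun k : 'I_n => `|convol G (cell a k w) x|)); last first.
  by move=> k _; rewrite (conv_deriven L.+1 tG (test1_cell a k tb)) (derive1n_cell _ _ _ tb.1).
apply: le_trans (conv_cells_le x a n (test1_mc1 tG) mw (mulr_ge0 p0 M10) hw nw) _.
have -> : I1 (fun y => `|G y|) = (2 ^+ j) ^- L.+1 * B.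
  rewrite /B -(I1_dil j (mcs_abs (test1_mc1 tT))) -I1Z;
    last exact: (mc1_dil j (mcs_abs (test1_mc1 tT))).
  have q1 : 0 <= (2 ^+ j) ^- L.+1 :> R by rewrite invr_ge0 !exprn_ge0.
  have q2 : 0 <= 2 ^+ j :> R by rewrite exprn_ge0.
  by apply: I1_ext => y; rewrite /G /dil !normrM (ger0_norm q1) (ger0_norm q2).
have -> : (2 ^+ a) ^+ L.+1 * M1 * ((2 ^+ j) ^- L.+1 * B) = 2 ^+ L.+1 * (M1 * B) * 2 ^-
  (L.+1 * (j.+1 - a)).
  rewrite -{1}(subnK aj) (subSn aj); move: (j - a)%N => d.
  have e1 : (2 ^+ (d + a)) ^+ L.+1 = 2 ^+ (L.+1 * d) * (2 ^+ a) ^+ L.+1 :> R.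
    by rewrite -!exprM -exprD mulnDl (mulnC d).
  have e2 : 2 ^+ (L.+1 * d.+1) = 2 ^+ L.+1 * 2 ^+ (L.+1 * d) :> R by rewrite -exprD -mulnS.
  rewrite e1 e2; have : (2 ^+ a) ^+ L.+1 != 0 :> R by rewrite !expf_neq0.
  have := pow2_neq0 (L.+1 * d) : _ != 0 :> R; have := pow2_neq0 L.+1 : _ != 0 :> R.
  move: (2 ^+ L.+1) (2 ^+ (L.+1 * d)) ((2 ^+ a) ^+ L.+1) => u v z u0 v0 z0; field.
  by apply/and3P; split.
by rewrite ler_wpM2r ?invr_ge0 ?exprn_ge0// /C lerDr addr_ge0// mulr_ge0.
Qed.

End cells.

(** * Tensor bumps on the empty boxes *)

Section fooling_function.
Context {R : realType}.
Local Notation plane := (R * R)%type.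
Variables (beta : R -> R) (N l : nat) (X : 'I_N -> plane).
Hypotheses (tb : test1 beta) (nb : narrow beta).

Lemma continuous_sum (I : Type) (r : seq I) (F : I -> plane -> R) :
  (forall i, continuous (F i)) -> continuous (fun x => \sum_(i <- r) F i x).
Proof.
move=> cF; elim: r => [|i r IH].
  by under eq_fun do rewrite big_nil; exact: cst_continuous.
by under eq_fun do rewrite big_cons; move=> x; apply: cvgD; [exact: cF|exact: IH].
Qed.

(* 1 if the bump on the box (k1, k2) of shape (a, l - a) misses all the points. *)
Definition empty_box (a k1 k2 : nat) : R :=
  ([forall n : 'I_N, tens (cell a k1 beta) (cell (l - a) k2 beta) (X n) == 0] : nat)%:R.

Definition fooling (x : plane) : R := \sum_(a < l.+1) \sum_(k1 < 2 ^ a) \sum_(k2 < 2 ^ (l - a))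
  empty_box a k1 k2 * tens (cell a k1 beta) (cell (l - a) k2 beta) x.

Lemma empty_box_le1 a k1 k2 : 0 <= empty_box a k1 k2 <= 1.
Proof. by rewrite /empty_box; case: [forall _, _]; rewrite ?lexx ?ler01. Qed.

Lemma fooling_vanish n : fooling (X n) = 0.
Proof.
rewrite /fooling big1// => a _; rewrite big1// => k1 _; rewrite big1// => k2 _; rewrite /empty_box.
by case: forallP => [/(_ n)/eqP ->|]; rewrite ?mulr0 ?mul0r.
Qed.

Lemma tens_cell_mc2 a b k1 k2 : mc2 (tens (cell a k1 beta) (cell b k2 beta)).
Proof. by apply: mc2_tens; apply: test1_mc1; exact: test1_cell. Qed.

Lemma fooling_term_mc2 a k1 k2 : mc2 (fun x => empty_box a k1 k2 * tens (cell a k1 beta)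
  (cell (l - a) k2 beta) x).
Proof. exact: (mcsZ _ (tens_cell_mc2 a (l - a) k1 k2)). Qed.

Let row_mc2 a k1 : mc2 (fun x => \sum_(k2 < 2 ^ (l - a)) empty_box a k1 k2 * tens (cell a k1 beta)
  (cell (l - a) k2 beta) x).
Proof. exact: (mcs_sum _ _ (fun k2 : 'I_(2 ^ (l - a)) => fooling_term_mc2 a k1 k2)). Qed.

Let level_mc2 a : mc2 (fun x => \sum_(k1 < 2 ^ a) \sum_(k2 < 2 ^ (l - a)) empty_box a k1 k2 * tens
  (cell a k1 beta) (cell (l - a) k2 beta) x).
Proof. exact: (mcs_sum _ _ (fun k1 : 'I_(2 ^ a) => row_mc2 a k1)). Qed.

Lemma fooling_mc2 : mc2 fooling.
Proof. exact: (mcs_sum _ _ (fun a : 'I_l.+1 => level_mc2 a)). Qed.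

Lemma fooling_continuous : continuous fooling.
Proof.
apply: continuous_sum => a; apply: continuous_sum => k1; apply: continuous_sum => k2 x.
apply: cvgM; first exact: cvg_cst.
by apply: tens_continuous; exact: test1_cell.
Qed.

Lemma cell_supp a (k : 'I_(2 ^ a)) (t : R) : cell a k beta t != 0 -> 0 <= t <= 1.
Proof.
move=> nz; have : `|2 ^+ a * t - k%:R - 2^-1| <= 4^-1.
  by rewrite leNgt; apply/negP => /nb h; rewrite /cell h eqxx in nz.
have k0 : 0 <= k%:R :> R by [].
have k1 : k%:R + 1 <= 2 ^+ a :> R by rewrite natr1 -natrX ler_nat.
rewrite ler_norml => /andP[h1 h2]; have pa := @pow2_gt0 R a.
rewrite -(pmulr_rge0 t pa) -[t <= 1](ler_pM2l pa) mulr1; apply/andP; split; lra.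
Qed.

Lemma fooling_supp : square_supp fooling.
Proof.
move=> z hz; rewrite /fooling big1// => a _; rewrite big1// => k1 _; rewrite big1// => k2 _;
  rewrite /tens.
have [->|n1] := eqVneq (cell a k1 beta z.1) 0; first by rewrite mul0r mulr0.
have [->|n2] := eqVneq (cell (l - a) k2 beta z.2) 0; first by rewrite !mulr0.
by exfalso; apply: hz; apply/unit_squareP; split; [exact: cell_supp n1|exact: cell_supp n2].
Qed.

(** Within one shape each point lies under at most one bump, since [narrow_sum] applies to the
    indicator [nz] in each coordinate. So at most N of the 2^l boxes are lost. *)
Lemma empty_box_count a : (a <= l)%N ->
  2 ^+ l - N%:R <= \sum_(k1 < 2 ^ a) \sum_(k2 < 2 ^ (l - a)) empty_box a k1 k2.
Proof.
move=> al; pose nz (t : R) : R := (t != 0 : nat)%:R.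
have nzM u v : nz (u * v) = nz u * nz v by rewrite /nz mulf_eq0 negb_or -natrM mulnb.
have step (k1 : 'I_(2 ^ a)) (k2 : 'I_(2 ^ (l - a))) :
    1 - \sum_(n < N) nz (cell a k1 beta (X n).1) * nz (cell (l - a) k2 beta (X n).2) <=
      empty_box a k1 k2.
  rewrite /empty_box; case: (boolP [forall _, _]) => [_|/forallPn[n hn]].
    by rewrite gerBl sumr_ge0// => n _; rewrite mulr_ge0// /nz.
  rewrite subr_le0 (bigD1 n)//= -nzM /tens in hn *.
  by rewrite /nz hn lerDl sumr_ge0// => i _; rewrite mulr_ge0.
have sum1 (b : nat) (t : R) : \sum_(k < 2 ^ b) nz (cell b k beta t) <= 1.
  have := @narrow_sum _ (fun u => nz (beta u)) 1 (2 ^+ b * t) (2 ^ b) ler01 _ _.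
  rewrite (eq_bigr (fun k : 'I_(2 ^ b) => nz (cell b k beta t))); last first.
    by move=> k _; rewrite ger0_norm.
  apply => [u|u /nb ->]; last by rewrite /nz eqxx.
  by rewrite /nz; case: (_ != 0); rewrite ?normr1 ?normr0.
apply: (@le_trans _ _ (\sum_(k1 < 2 ^ a) \sum_(k2 < 2 ^ (l - a))
    (1 - \sum_(n < N) nz (cell a k1 beta (X n).1) * nz (cell (l - a) k2 beta (X n).2))));
      last first.
  by apply: ler_sum => k1 _; apply: ler_sum => k2 _; exact: step.
under eq_bigr do rewrite sumrB sumr_const card_ord.
rewrite sumrB sumr_const card_ord -mulrnA -expnD subnK// natrX lerB//.
under eq_bigr do rewrite exchange_big /=.
rewrite exchange_big /=.
have -> : N%:R = \sum_(n < N) 1 :> R by rewrite sumr_const card_ord.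
apply: ler_sum => n _; under eq_bigr do rewrite -mulr_sumr.
by rewrite -mulr_suml; apply: mulr_ile1; [exact: sumr_ge0|exact: sumr_ge0|exact: sum1|exact: sum1].
Qed.

(** At least half of the 2^l boxes survive at each of the l+1 shapes, and every bump has integral
    2^(-l) (I1 beta)^2 whatever its shape. *)
Lemma fooling_integral : (2 * N <= 2 ^ l)%N -> l.+1%:R * (2^-1 * I1 beta ^+ 2) <= I2 fooling.
Proof.
move=> hN.
have iterm a k1 k2 : (a <= l)%N -> I2 (fun x => empty_box a k1 k2 * tens (cell a k1 beta)
  (cell (l - a) k2 beta) x) =
    empty_box a k1 k2 * (2 ^- l * I1 beta ^+ 2).
  move=> al; have mb := test1_mc1 tb.
  rewrite I2Z; last exact: tens_cell_mc2.
  rewrite I2_tens; [|exact: mc1_cell|exact: mc1_cell]; rewrite !I1_cell//.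
  have -> : (2 : R) ^- l = 2 ^- a * 2 ^- (l - a) by rewrite -invfM -exprD subnKC.
  by congr (_ * _); ring.
have -> : I2 fooling = \sum_(a < l.+1) \sum_(k1 < 2 ^ a) \sum_(k2 < 2 ^ (l - a)) empty_box a k1 k2
  * (2 ^- l * I1 beta ^+ 2).
  rewrite (I2_sum _ _ (fun a : 'I_l.+1 => level_mc2 a)); apply: eq_bigr => a _.
  rewrite (I2_sum _ _ (fun k1 : 'I_(2 ^ a) => row_mc2 a k1)); apply: eq_bigr => k1 _.
  rewrite (I2_sum _ _ (fun k2 : 'I_(2 ^ (l - a)) => fooling_term_mc2 a k1 k2));
    apply: eq_bigr => k2 _.
  by apply: iterm; rewrite -ltnS.
rewrite mulr_natl -[X in _ *+ X](card_ord l.+1) -sumr_const; apply: ler_sum => a _.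
under eq_bigr do rewrite -mulr_suml.
rewrite -mulr_suml [leRHS]mulrA ler_wpM2r ?sqr_ge0//.
have al : (a <= l)%N by rewrite -ltnS.
apply: le_trans (ler_wpM2r _ (empty_box_count al)); rewrite ?invr_ge0 ?exprn_ge0//.
have hN' : 2 * N%:R <= 2 ^+ l :> R by rewrite -natrX -natrM ler_nat.
by rewrite ler_pdivlMr ?pow2_gt0//; lra.
Qed.

Lemma conv2_tens P m (u v : R -> R) x : (forall j, mc1 (P j)) -> mc1 u -> mc1 v ->
  conv2 (ker P m) (tens u v) x = convol (P m.1) u x.1 * convol (P m.2) v x.2.
Proof.
move=> mP mu mv; rewrite /convol -(I2_tens (conv_int x.1 (mP m.1) mu) (conv_int x.2 (mP m.2) mv)).
by apply: I2_ext => y; rewrite /ker /tens mulrACA.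
Qed.

(** Deleting boxes cannot increase a sum of absolute values, so all boxes may be kept, and the
    double sum then factors into two one-dimensional ones. *)
Lemma conv2_fooling (P : nat -> R -> R) (C : R) n m x : (forall j, test1 (P j)) ->
  (forall a mu j x, \sum_(k < j) `|convol (P mu) (cell a k beta) x| <= C * 2 ^- (n * (mu - a))) ->
  `|conv2 (ker P m) fooling x| <= C ^+ 2 * \sum_(a < l.+1) 2 ^- (n * (m.1 - a)) * 2 ^-
    (n * (m.2 - (l - a))).
Proof.
move=> tP hC; have mP j := test1_mc1 (tP j); have mb := test1_mc1 tb.
have mK : mc2 (ker P m) by exact: mc2_ker_family.
have E : conv2 (ker P m) fooling x = \sum_(a < l.+1) \sum_(k1 < 2 ^ a) \sum_(k2 < 2 ^ (l - a))
    empty_box a k1 k2 * (convol (P m.1) (cell a k1 beta) x.1 * convol (P m.2)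
      (cell (l - a) k2 beta) x.2).
  have mx := mc2_sub x mK.
  have t3 a k1 k2 := mc2_mul mx (fooling_term_mc2 a k1 k2).
  have t2 a k1 := mc2_mul mx (row_mc2 a k1); have t1 a := mc2_mul mx (level_mc2 a).
  rewrite /conv2 /fooling; under I2_ext do rewrite mulr_sumr.
  rewrite (I2_sum _ _ (fun a : 'I_l.+1 => t1 a)); apply: eq_bigr => a _.
  under I2_ext do rewrite mulr_sumr.
  rewrite (I2_sum _ _ (fun k1 : 'I_(2 ^ a) => t2 a k1)); apply: eq_bigr => k1 _.
  under I2_ext do rewrite mulr_sumr.
  rewrite (I2_sum _ _ (fun k2 : 'I_(2 ^ (l - a)) => t3 a k1 k2)); apply: eq_bigr => k2 _.
  rewrite -(conv2_tens m x mP (mc1_cell a k1 mb) (mc1_cell (l - a) k2 mb)).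
  rewrite /conv2 -I2Z; last exact: (mc2_mul mx (tens_cell_mc2 a (l - a) k1 k2)).
  by apply: I2_ext => y; rewrite mulrCA.
rewrite E mulr_sumr; apply: le_trans (ler_norm_sum _ _ _) _; apply: ler_sum => a _.
apply: (@le_trans _ _ (\sum_(k1 < 2 ^ a) \sum_(k2 < 2 ^ (l - a))
    `|convol (P m.1) (cell a k1 beta) x.1| * `|convol (P m.2) (cell (l - a) k2 beta) x.2|)).
  apply: le_trans (ler_norm_sum _ _ _) _; apply: ler_sum => k1 _.
  apply: le_trans (ler_norm_sum _ _ _) _; apply: ler_sum => k2 _.
  have /andP[g0 g1] := empty_box_le1 a k1 k2.
  by rewrite !normrM (ger0_norm g0) ler_piMl// mulr_ge0.
under eq_bigr do rewrite -mulr_sumr.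
rewrite -mulr_suml expr2 mulrACA.
by apply: ler_pM; rewrite ?sumr_ge0.
Qed.

End fooling_function.

(** * Weighted sums of the block bounds *)

Section besov_weights.
Context {R : realType}.

Definition besov_le (theta : \bar R) (s : R) (B : nat * nat -> R) : Prop :=
  match theta return Prop with
  | t%:E => forall n : nat, \sum_(i < n) \sum_(j < n) (2 `^ (s * (i + j)%:R) * B (i : nat, j : nat))
    `^ t <= 1
  | _ => forall m, 2 `^ (s * (m.1 + m.2)%:R) * B m <= 1 end.

Lemma sum_subseq_square (r : seq (nat * nat)) (f : nat * nat -> R) n : uniq r ->
  (forall m, 0 <= f m) ->
  (forall m, m \in r -> (m.1 < n)%N && (m.2 < n)%N) ->
  \sum_(m <- r) f m <= \sum_(i < n) \sum_(j < n) f (i : nat, j : nat).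
Proof.
move=> ur f0 hr; pose q := [seq (i, j) | i <- iota 0 n, j <- iota 0 n].
have uq : uniq q by apply: allpairs_uniq; rewrite ?iota_uniq// => -[a b] [c d].
have mq m : (m.1 < n)%N && (m.2 < n)%N -> m \in q.
  by case: m => i j /= /andP[i1 j1]; apply/allpairsP; exists (i, j); rewrite !mem_iota !add0n i1 j1.
have -> : \sum_(i < n) \sum_(j < n) f (i : nat, j : nat) = \sum_(m <- q) f m.
  rewrite big_allpairs -(big_mkord xpredT (fun i => \sum_(j < n) f (i, j : nat))) /index_iota subn0.
  by apply: eq_bigr => i _; rewrite -(big_mkord xpredT (fun j => f (i, j))) /index_iota subn0.
rewrite (perm_big [seq m <- q | m \in r]); last first.
  apply: uniq_perm => //; first exact: filter_uniq.
  by move=> m; rewrite mem_filter; case: (boolP (m \in r)) => //= /hr /mq ->.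
by rewrite big_filter [leRHS](bigID (mem r)) /= lerDl sumr_ge0.
Qed.

(** Every finite set of indices lies in a square, so square partial sums control the extended
    sum. *)
Lemma besov_norm_le1 (L : nat) (Psi0 : R -> R) (s : R) (p theta : \bar R) T (B : nat * nat -> R) :
  (1 <= theta)%E ->
  (forall m, 0 <= B m) -> (forall m, (LpC p (dconv (Psi2 L Psi0 m) T) <= (B m)%:E)%E) ->
    besov_le theta s B ->
  (besov_norm L Psi0 s p theta T <= 1)%E.
Proof.
move=> t1 B0 hB; rewrite /besov_norm.
pose b m := LpC p (dconv (Psi2 L Psi0 m) T); rewrite -/b.
have b0 m : (0 <= b m)%E by exact: Lnorm_ge0.
case: theta t1 => [t| |]//= t1 hs; last first.
  apply: ge_ereal_sup => _ [m _ <-].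
  apply: (@le_trans _ _ ((2 `^ (s * (m.1 + m.2)%:R))%:E * (B m)%:E)%E);
    last by rewrite -EFinM lee_fin.
  by apply: lee_wpmul2l; rewrite ?lee_fin ?powR_ge0//; exact: hB.
have {}t1 : 1 <= t by rewrite -lee_fin.
have t0 : 0 < t by apply: lt_le_trans t1.
pose a m := ((2 `^ (s * (m.1 + m.2)%:R * t))%:E * b m `^ t)%E.
have aB m : (a m <= ((2 `^ (s * (m.1 + m.2)%:R) * B m) `^ t)%:E)%E.
  rewrite powRM ?powR_ge0// -powRrM EFinM; apply: lee_wpmul2l; first by rewrite lee_fin powR_ge0.
  rewrite -poweR_EFin; apply: gt0_ler_poweR; rewrite ?(ltW t0)//; last exact: hB.
    by rewrite in_itv /= b0 leey.
  by rewrite in_itv /= lee_fin B0 leey.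
suff h : (\esum_(m in [set: nat * nat]) a m <= 1)%E.
  have a0 : (0 <= \esum_(m in [set: nat * nat]) a m)%E.
    by apply: esum_ge0 => m _; rewrite mule_ge0 ?poweR_ge0// lee_fin powR_ge0.
  rewrite -(@poweR1r R t^-1); apply: gt0_ler_poweR => //; first by rewrite invr_ge0 ltW.
    by rewrite in_itv /= a0 leey.
  by rewrite in_itv /= lee01 leey.
apply: ge_ereal_sup => _ [A [finA _] <-].
rewrite fsbig_finite//=; have := finmap.fset_uniq (fset_set A).
move: (finmap.enum_fset _) => r ur.
apply: le_trans (lee_sum _ (fun m _ => aB m)) _.
rewrite sumEFin lee_fin.
pose n := (\max_(m <- r) (m.1 + m.2)).+1.
apply: le_trans (hs n).
apply: (@sum_subseq_square _ (fun m => (2 `^ (s * (m.1 + m.2)%:R) * B m) `^ t)) => // [m|m hm].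
  exact: powR_ge0.
have hm' : (m.1 + m.2 <= \max_(m <- r) (m.1 + m.2))%N.
  exact: (@leq_bigmax_seq _ _ xpredT (fun m : nat * nat => (m.1 + m.2)%N) m).
by rewrite !ltnS (leq_trans (leq_addr _ _) hm') (leq_trans (leq_addl _ _) hm').
Qed.

(** Below the scale a of the bump the weight 2^(si) itself decays at rate s; above it the
    cancellation of order n leaves the rate n - s. The smaller of the two rates defines rho. *)
Lemma decay_weight (s : R) (n : nat) : 0 < s -> s < n%:R ->
  exists2 rho : R, 0 < rho < 1 & forall i a : nat,
    2 `^ (s * i%:R) * 2 ^- (n * (i - a)) <= 2 `^ (s * a%:R) * rho ^+ ((i - a) + (a - i)) :> R.
Proof.
move=> s0 sn; pose d : R := Num.min s (n%:R - s).
have d0 : 0 < d by rewrite lt_min s0 subr_gt0.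
have ds : d <= s by rewrite ge_min lexx.
have dn : d <= n%:R - s by rewrite ge_min lexx orbT.
have r0 : 0 < 2 `^ (- d) :> R by rewrite powR_gt0.
have rE (k : nat) : (2 `^ (- d)) ^+ k = 2 `^ (- (d * k%:R)) :> R.
  by rewrite -powR_mulrn ?(ltW r0)// -powRrM mulNr.
exists (2 `^ (- d)).
  rewrite r0 /= powRN invf_lt1 ?powR_gt0//.
  have := @gt0_ltr_powR R d d0 1 2; rewrite powR1; apply; rewrite ?nnegrE//.
  exact: ltr1n.
move=> i a; rewrite rE.
have -> : 2 ^- (n * (i - a)) = 2 `^ (- (n%:R * (i - a)%:R)) :> R.
  by rewrite powRN -natrM powR_mulrn.
rewrite -!powRD; try by apply/implyP => _; rewrite gt_eqF.
rewrite ler_powR ?ler1n//.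
have [ia|ai] := leqP i a.
  rewrite (eqP ia) add0n natrB// mulr0 oppr0 addr0.
  have : 0 <= (s - d) * (a%:R - i%:R) by rewrite mulr_ge0 ?subr_ge0 ?ler_nat.
  lra.
rewrite (eqP (ltnW ai)) addn0 natrB ?(ltnW ai)//.
have : 0 <= (n%:R - s - d) * (i%:R - a%:R) by rewrite mulr_ge0 ?subr_ge0 ?ler_nat ?(ltnW ai).
lra.
Qed.

(** After weighting, the blocks are dominated by [G], a sum over shapes of products of two geometric
    profiles: [G] is at most g at each index and has total mass at most (l + 1) g^2. As [G]/g <= 1
    and theta >= 1, the sum of theta-th powers is at most the plain sum, of order l + 1, and its
    root is of order (l + 1)^(1/theta). *)
Lemma besov_le_levels (s : R) (n : nat) : 0 < s -> s < n%:R ->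
  exists2 A : R, 0 < A & forall (l : nat) (theta : \bar R), (1 <= theta)%E ->
  besov_le theta s (fun m => (A * 2 `^ (s * l%:R) * l.+1%:R `^ fine (theta^-1)%E)^-1 *
     \sum_(a < l.+1) 2 ^- (n * (m.1 - a)) * 2 ^- (n * (m.2 - (l - a)))).
Proof.
move=> s0 sn; have [rho rho01 hrho] := decay_weight s0 sn; have [r0 r1] := andP rho01.
pose e (i a : nat) : R := rho ^+ ((i - a) + (a - i)).
pose g : R := 1 + 2 / (1 - rho).
have g1 : 1 <= g by rewrite lerDl divr_ge0// subr_ge0 ltW.
have g0 : 0 < g by apply: lt_le_trans g1.
have e0 i a : 0 <= e i a by rewrite exprn_ge0// ltW.
have e1 i a : e i a <= 1 by rewrite exprn_ile1// ltW.
have sg (k N : nat) : \sum_(i < N) e i k <= g.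
  by apply: le_trans (geometric_nat k N rho01) _; rewrite lerDr.
exists (g * g) => [|l theta t1]; first exact: mulr_gt0.
pose W m : R := \sum_(a < l.+1) 2 ^- (n * (m.1 - a)) * 2 ^- (n * (m.2 - (l - a))).
pose G m : R := \sum_(a < l.+1) e m.1 a * e m.2 (l - a)%N.
have W0 m : 0 <= W m by apply: sumr_ge0 => a _; rewrite mulr_ge0 ?invr_ge0 ?exprn_ge0.
have G0 m : 0 <= G m by apply: sumr_ge0 => a _; rewrite mulr_ge0.
have P0 x : 0 < 2 `^ x :> R by rewrite powR_gt0.
have WG m : 2 `^ (s * (m.1 + m.2)%:R) * W m <= 2 `^ (s * l%:R) * G m.
  rewrite /W /G !mulr_sumr; apply: ler_sum => a _.
  have al : (a <= l)%N by rewrite -ltnS.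
  have -> : 2 `^ (s * (m.1 + m.2)%:R) = 2 `^ (s * m.1%:R) * 2 `^ (s * m.2%:R) :> R.
    by rewrite natrD mulrDr powRD//; apply/implyP => _; rewrite gt_eqF.
  have -> : 2 `^ (s * l%:R) = 2 `^ (s * a%:R) * 2 `^ (s * (l - a)%:R) :> R.
    by rewrite -powRD -?mulrDr -?natrD ?subnKC//; apply/implyP => _; rewrite gt_eqF.
  rewrite mulrACA [leRHS]mulrACA.
  by apply: ler_pM; rewrite ?mulr_ge0 ?invr_ge0 ?exprn_ge0 ?(ltW (P0 _))//; exact: hrho.
have Gg m : G m <= g.
  apply: le_trans (sg m.1 l.+1); apply: ler_sum => a _.
  by rewrite (_ : e m.1 a = e a m.1) ?ler_piMr// /e addnC.
have SG N : \sum_(i < N) \sum_(j < N) G (i : nat, j : nat) <= l.+1%:R * (g * g).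
  under eq_bigr do rewrite exchange_big /=.
  rewrite exchange_big /= -[X in X%:R](card_ord l.+1) mulr_natl -sumr_const; apply: ler_sum => a _.
  under eq_bigr do rewrite -mulr_sumr.
  by rewrite -mulr_suml; apply: ler_pM; [exact: sumr_ge0|exact: sumr_ge0|exact: sg|exact: sg].
have L1 : 1 <= l.+1%:R :> R by rewrite ler1n.
have key (tau : R) m : 0 <= tau -> 2 `^ (s * (m.1 + m.2)%:R)
  * ((g * g * 2 `^ (s * l%:R) * l.+1%:R `^ tau)^-1 * W m)
    <= (G m / g) * (g * l.+1%:R `^ tau)^-1.
  move=> tau0; have q0 : 0 < l.+1%:R `^ tau :> R by rewrite powR_gt0.
  rewrite mulrCA ler_pdivrMl ?mulr_gt0//; apply: le_trans (WG m) _.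
  by rewrite le_eqVlt; apply/orP; left; apply/eqP; field; rewrite !gt_eqF.
have Gg1 m : G m / g <= 1 by rewrite ler_pdivrMr// mul1r.
have Gg0 m : 0 <= G m / g by rewrite divr_ge0// ltW.
case: theta t1 => [t| |]//= t1; last first.
  move=> m; apply: le_trans (key 0 m (lexx 0)) _; rewrite powRr0 mulr1.
  by rewrite mulr_ile1 ?invr_ge0 ?(ltW g0)// invf_le1.
have {}t1 : 1 <= t by rewrite -lee_fin.
have t0 : 0 < t by apply: lt_le_trans t1.
have ti0 : 0 <= t^-1 by rewrite invr_ge0 ltW.
move=> N; rewrite inver gt_eqF//=.
apply: (@le_trans _ _ (\sum_(i < N) \sum_(j < N) G (i : nat, j : nat) * (l.+1%:R * (g * g))^-1));
  last first.
  under eq_bigr do rewrite -mulr_suml.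
  by rewrite -mulr_suml ler_pdivrMr ?mul1r// !mulr_gt0.
apply: ler_sum => i _; apply: ler_sum => j _; set m := (_, _).
have p0 : 0 <= 2 `^ (s * (i + j)%:R) * ((g * g * 2 `^ (s * l%:R) * l.+1%:R `^ t^-1)^-1 * W m).
  by rewrite !mulr_ge0 ?invr_ge0 ?mulr_ge0 ?powR_ge0 ?(ltW g0)//; exact: W0.
apply: (@le_trans _ _ (((G m / g) * (g * l.+1%:R `^ t^-1)^-1) `^ t)).
  have q0 : 0 <= (G m / g) * (g * l.+1%:R `^ t^-1)^-1.
    by apply: mulr_ge0 => //; rewrite invr_ge0 mulr_ge0 ?powR_ge0// ltW.
  exact: (ge0_ler_powR (ltW t0) p0 q0 (key t^-1 m ti0)).
have vi0 : 0 <= (g * l.+1%:R `^ t^-1)^-1 by rewrite invr_ge0 mulr_ge0 ?powR_ge0// ltW.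
rewrite (powRM t (Gg0 m) vi0).
have -> : G m * (l.+1%:R * (g * g))^-1 = (G m / g) * (g * l.+1%:R)^-1.
  by field; rewrite !gt_eqF// ltr0n.
have gl0 : 0 < g * l.+1%:R `^ t^-1 by rewrite mulr_gt0 ?powR_gt0.
apply: ler_pM; rewrite ?powR_ge0//.
  have [->|nz] := eqVneq (G m / g) 0; first by rewrite powR0 ?gt_eqF.
  by apply: ge1r_powR => //; rewrite lt_neqAle eq_sym nz Gg0 Gg1.
rewrite -powR_inv1 ?(ltW gl0)// -powRrM mulN1r powRN lef_pV2 ?posrE ?powR_gt0 ?mulr_gt0//.
rewrite powRM ?(ltW g0) ?powR_ge0// -powRrM mulVf ?gt_eqF// powRr1// ler_wpM2r//.
exact: le1r_powR.
Qed.

End besov_weights.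

(** * A continuous function as a tempered distribution *)

Section lower_bound.
Context {R : realType}.
Local Notation plane := (R * R)%type.

(** The function lives on [-2, 2]^2, of area 16, and 16^(1/p) <= 16 gives one constant for all p. *)
Lemma LpC_le (p : \bar R) (f : plane -> R[i]) (M : R) : (1 <= p)%E -> 0 <= M ->
  mc2 (fun x => cabs (f x)) -> (forall x, `|cabs (f x)| <= M) ->
    (forall x, 2 < nm2 x -> cabs (f x) = 0) ->
  (LpC p f <= (16 * M)%:E)%E.
Proof.
move=> p1 M0 mf hM hs; have M16 : M <= 16 * M by rewrite ler_peMl// ler1n.
rewrite /LpC unlock; case: p p1 => [q| |]//= p1; last first.
  case: ifPn => _; last by rewrite lee_fin (le_trans M0).
  by apply/ess_supP; apply: aeW => x /=; rewrite lee_fin (le_trans (hM x)).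
have {}p1 : 1 <= q by rewrite -lee_fin.
have q0 : 0 < q by apply: lt_le_trans p1.
have mq := mc2_powR q0 mf; have iq := mcs_integrable gauge2 mq.
have mB := mc2_tens (mc1_box_ind (0 : R) 2) (mc1_box_ind (0 : R) 2).
have h : I2 (fun x => `|cabs (f x)| `^ q) <= M `^ q * 16.
  have <- : I2 (fun x => M `^ q * tens (box_ind 0 2) (box_ind 0 2) x) = M `^ q * 16 :> R.
    by rewrite I2Z// (I2_tens (mc1_box_ind (0 : R) 2) (mc1_box_ind (0 : R) 2)) !I1_box_ind//;
      congr (_ * _); ring.
  apply: le_I2 => //; first exact: (mcsZ _ mB).
  move=> x; have [hx|hx] := ltP 2 (nm2 x).
    by rewrite hs// normr0 powR0 ?gt_eqF// mulr_ge0 ?powR_ge0// /tens mulr_ge0 ?box_ind_ge0.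
  move: hx; rewrite nm2_le => /andP[h1 h2]; rewrite /tens !box_ind_in ?subr0//.
  by rewrite !mulr1; apply: ge0_ler_powR; rewrite ?nnegrE ?(ltW q0).
have E : (\int[leb2]_x `|(cabs (f x))%:E| `^ q = (I2 (fun x => `|cabs (f x)| `^ q))%:E)%E.
  by rewrite /I2 /Rintegral fineK; last exact: integrable_fin_num iq.
rewrite E poweR_EFin lee_fin.
have I0 : 0 <= I2 (fun x => `|cabs (f x)| `^ q) by apply: I2_ge0 => x; exact: powR_ge0.
have Mq0 : 0 <= M `^ q * 16 by rewrite mulr_ge0// powR_ge0.
have qi0 : 0 <= q^-1 by rewrite invr_ge0 ltW.
apply: le_trans (ge0_ler_powR qi0 I0 Mq0 h) _.
rewrite powRM ?powR_ge0// -powRrM mulfV ?gt_eqF// powRr1// mulrC ler_wpM2r//.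
by apply: ler1_powR; rewrite ?ler1n// invf_le1.
Qed.

Section distribution.
Variable F : plane -> R.
Hypotheses (cF : continuous F) (sF : square_supp F).

Definition rdens : plane -> R[i] := fun x => (F x)%:C%C.
Definition rdist (phi : plane -> R[i]) : R[i] := cintegral setT (fun x => rdens x * phi x).

Let mF : mc2 F. Proof. exact: square_supp_mc2. Qed.

Lemma rdistE phi : rdist phi = (I2 (fun x => F x * cre phi x) +i* I2 (fun x => F x * cim phi x))%C.
Proof.
rewrite /rdist /cintegral; congr (_ +i* _)%C; apply: I2_ext => x; rewrite /cre /cim /rdens;
  case: (phi x) => u v /=.
  by rewrite mul0r subr0.
by rewrite mul0r addr0.
Qed.

Lemma schwartz_bnd phi : schwartz phi -> exists S : R,
  [/\ 0 <= S, schwartz_norm 0 phi = S%:E & forall x, cabs (phi x) <= S].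
Proof.
move=> [_ /(_ 0%N) fin].
have ub x : ((cabs (phi x))%:E <= schwartz_norm 0 phi)%E.
  by apply: ereal_sup_ubound; exists (0, 0)%N, (0, 0)%N, x; split => //; rewrite !expr0 !mul1r.
have c0 x : 0 <= cabs (phi x) by rewrite /cabs; case: (phi x) => u v /=; exact: sqrtr_ge0.
have ge0 : (0 <= schwartz_norm 0 phi)%E by apply: le_trans (ub (0, 0)); rewrite lee_fin.
have fn : schwartz_norm 0 phi \is a fin_num by rewrite ge0_fin_numE.
exists (fine (schwartz_norm 0 phi)); split; [exact: fine_ge0|by rewrite fineK|move=> x].
by rewrite -lee_fin fineK.
Qed.

Lemma schwartz_mc2 phi : schwartz phi -> mc2 (fun x => F x * cre phi x) /\
  mc2 (fun x => F x * cim phi x).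
Proof.
move=> sphi; have [S [S0 _ hS]] := schwartz_bnd sphi.
have [[c1 c2] _] := sphi.1 [::].
have hb x : `|cre phi x| <= S /\ `|cim phi x| <= S.
  have := hS x; rewrite /cre /cim; case: (phi x) => u v h; have [h1 h2] := cabs_ge u v.
  by split; apply: le_trans h.
split; apply: mcsMr => //; try exact: continuous_plane_measurable; exists S => x;
  by have [] := hb x.
Qed.

(** Order 0 suffices: the pairing is at most the sup of the test function times the integral of |F|,
    with a factor 2 for real and imaginary parts. *)
Lemma rdist_tempered : tempered_distribution rdist.
Proof.
split.
  move=> [u v] phi psi hphi hpsi; rewrite !rdistE.
  have [m1 m2] := schwartz_mc2 hphi; have [m3 m4] := schwartz_mc2 hpsi.
  set a := I2 _; set b := I2 _; set c := I2 (fun x => F x * cre phi x);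
    set d := I2 (fun x => F x * cim phi x).
  set e := I2 (fun x => F x * cre psi x); set f := I2 (fun x => F x * cim psi x).
  have -> : a = u * c - v * d + e.
    rewrite /c /d /e -(I2Z u m1) -(I2Z v m2) -(I2B (mcsZ u m1) (mcsZ v m2))
      -(I2D (mcsB (mcsZ u m1) (mcsZ v m2)) m3).
    apply: I2_ext => x; rewrite /cre /cim; case: (phi x) => p q; case: (psi x) => p' q' /=; ring.
  have -> : b = u * d + v * c + f.
    rewrite /c /d /f -(I2Z u m2) -(I2Z v m1) -(I2D (mcsZ u m2) (mcsZ v m1))
      -(I2D (mcsD (mcsZ u m2) (mcsZ v m1)) m4).
    apply: I2_ext => x; rewrite /cre /cim; case: (phi x) => p q; case: (psi x) => p' q' /=; ring.
  by apply/eqP; rewrite eq_complex /= !eqxx.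
exists 0%N, (2 * I2 (fun x => `|F x|)) => phi sphi; have [S [S0 -> hS]] := schwartz_bnd sphi.
have [m1 m2] := schwartz_mc2 sphi.
rewrite -EFinM lee_fin rdistE; apply: le_trans (cabs_le _ _) _.
have mS := mcsZ S (mcs_abs mF).
have key (h : plane -> R) : mc2 (fun x => F x * h x) -> (forall x, `|h x| <= S) ->
  `|I2 (fun x => F x * h x)| <= S * I2 (fun x => `|F x|).
  move=> mh hh; rewrite -(I2Z S (mcs_abs mF)); apply: norm_I2 => // x.
  by rewrite normrM mulrC ler_wpM2r.
have hb x : `|cre phi x| <= S /\ `|cim phi x| <= S.
  have := hS x; rewrite /cre /cim; case: (phi x) => u v h; have [h1 h2] := cabs_ge u v.
  by split; apply: le_trans h.
rewrite -mulrA mulr2n mulrDl mul1r mulrC; apply: lerD; apply: key => // x; by have [] := hb x.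
Qed.

Lemma rdist_dsupport : dsupport rdist `<=` unit_square.
Proof.
move=> x hx; apply: contrapT => nx.
have cl : closed (@unit_square R).
  have e : @unit_square R = `[2^-1 - 2^-1, 2^-1 + 2^-1]%classic `*` `[2^-1 - 2^-1, 2^-1 +
    2^-1]%classic.
    by rewrite subrr (_ : 2^-1 + 2^-1 = 1)//; field.
  by rewrite e; apply: compact_closed; [exact: norm_hausdorff|exact: closed_box_compact].
have [phi [_ _ sub] /eqP nz] := hx (~` unit_square) (closed_openC cl) nx.
apply: nz; rewrite rdistE.
have z y : F y = 0 \/ phi y = 0.
  have [hy|hy] := pselect (unit_square y); last by left; exact: sF.
  right; apply/eqP/negPn/negP => ny.
  by have : fsupport phi y by [exact: subset_closure]; move=> /sub; apply.
have -> : I2 (fun y => F y * cre phi y) = 0.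
  by rewrite -I20; apply: I2_ext => y; rewrite /cre; case: (z y) => ->; rewrite ?mul0r ?mulr0.
have -> : I2 (fun y => F y * cim phi y) = 0.
  by rewrite -I20; apply: I2_ext => y; rewrite /cim; case: (z y) => ->; rewrite ?mul0r ?mulr0.
by [].
Qed.

Lemma rdens_continuous : ccontinuous rdens.
Proof. by split; [exact: cF|exact: cst_continuous]. Qed.

Lemma rdist_represents : represents rdens rdist. Proof. by []. Qed.

Lemma rdist_dconv L Psi0 m x : test1 Psi0 ->
  dconv (Psi2 L Psi0 m) rdist x = (conv2 (ker (Psi L Psi0) m) F x)%:C%C.
Proof.
move=> t0; rewrite (dconv_conv2 L m x t0 rdist_represents); congr (_ +i* _)%C.
by rewrite /conv2 -I20; apply: I2_ext => y; rewrite mulr0.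
Qed.

Lemma rdist_block L Psi0 (p : \bar R) m (M : R) : test1 Psi0 -> (forall x, 1 < `|x| -> Psi0 x = 0)
  -> (1 <= p)%E -> 0 <= M ->
  (forall x, `|conv2 (ker (Psi L Psi0) m) F x| <= M) -> (LpC p (dconv (Psi2 L Psi0 m) rdist) <=
    (16 * M)%:E)%E.
Proof.
move=> t0 o0 p1 M0 hM.
have -> : dconv (Psi2 L Psi0 m) rdist = fun x => (conv2 (ker (Psi L Psi0) m) F x)%:C%C.
  by apply/funext => x; exact: rdist_dconv.
have mc := mc2_conv2 (mc2_Psi L t0 m) mF.
apply: LpC_le => // [|x|x hx].
- by have := mcs_abs mc; congr mc2; apply/funext => x; rewrite cabs_real.
- by rewrite cabs_real normr_id.
rewrite cabs_real (_ : conv2 _ _ _ = 0) ?normr0//.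
rewrite -I20; apply: I2_ext => y.
have [/unit_squareP[/andP[y1 y2] /andP[y3 y4]]|hy] := pselect (unit_square y);
  last by rewrite sF// mulr0.
have key (a b : R) : 2 < `|a| -> 0 <= b -> b <= 1 -> 1 < `|a - b|.
  by move=> ha hb0 hb1; have := ler_normD (a - b) b; rewrite subrK (ger0_norm hb0); lra.
move: hx; rewrite nm2_gt /ker => /orP[] hx.
  by rewrite (Psi_out _ o0 _ (key _ _ hx y1 y2)) !mul0r.
by rewrite (Psi_out _ o0 _ (key _ _ hx y3 y4)) mulr0 mul0r.
Qed.

Lemma rdist_wce L Psi0 s (p theta : \bar R) (N : nat) (X : 'I_N -> plane) :
  (besov_norm L Psi0 s p theta rdist <= 1)%E -> (forall n, F (X n) = 0) ->
  ((I2 F)%:E <= wce L Psi0 s p theta X)%E.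
Proof.
move=> n1 FX.
have bu : besov_unit_square L Psi0 s p theta rdist rdens.
  split; [|exact: rdist_dsupport|exact: rdens_continuous|exact: rdist_represents].
  by split; [exact: rdist_tempered|exact: le_lt_trans n1 (ltry _)].
apply: (@le_trans _ _ (cabs (cintegral unit_square rdens - N%:R^-1 * \sum_(n < N) rdens (X n)))%:E);
  last first.
  by apply: ereal_sup_ubound; exists rdist, rdens.
rewrite big1 ?mulr0 ?subr0; last by move=> n _; rewrite /rdens FX.
rewrite lee_fin /cintegral (Rintegral_square sF).
by apply: le_trans (ler_norm _) _;
  have [] := cabs_ge (I2 F) (Rintegral leb2 unit_square (cim rdens)).
Qed.

End distribution.

End lower_bound.

(** * Normalising the fooling function; the two-sided bound *)

Section main.
Context {R : realType}.
Local Notation plane := (R * R)%type.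

Lemma squared_bump (Psi0 : R -> R) : test1 Psi0 -> (forall x, 1 < `|x| -> Psi0 x = 0) ->
  I1 Psi0 = 1 ->
  exists2 beta : R -> R, test1 beta /\ narrow beta & 0 < I1 beta.
Proof.
move=> t0 o0 i0; have n4 : (4 : R) != 0 by rewrite gt_eqF.
(* The map t -> 4t - 2 sends [1/4, 3/4] onto [-1, 1], the support of [Psi0], so [phi] is narrow and
   has integral 1/4. *)
pose phi t := 1 * Psi0 (4 * t + - 2).
have tphi : test1 phi by exact: test1_affine.
have nphi : narrow phi.
  move=> t ht; rewrite /phi o0 ?mulr0//.
  have -> : 4 * t + - 2 = 4 * (t - 2^-1) :> R by field.
  by rewrite normrM ger0_norm//; lra.
exists (fun t => phi t * phi t); first by split; [exact: test1M|move=> t /nphi ->; rewrite mul0r].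
have mb := test1_mc1 (test1M tphi tphi); have mp := test1_mc1 tphi.
have mB := mc1_box_ind (2^-1 : R) 4^-1.
have Iphi : I1 phi = 4^-1.
  rewrite /phi I1Z; last exact: (mc1_affine (- 2) n4 (test1_mc1 t0)).
  by rewrite (I1_affine (- 2) n4 (test1_mc1 t0)) i0 mul1r mulr1 ger0_norm.
(* Young's inequality [phi <= 2 phi^2 + 1/8] on the support of phi *)
have h : I1 phi <= 2 * I1 (fun t => phi t * phi t) + 8^-1 * I1 (box_ind (2^-1 : R) 4^-1).
  rewrite -(I1Z 2 mb) -(I1Z 8^-1 mB) -(I1D (mcsZ 2 mb) (mcsZ 8^-1 mB)).
  apply: le_I1 => //; first exact: (mcsD (mcsZ 2 mb) (mcsZ 8^-1 mB)).
  move=> t; have [ht|ht] := ltP 4^-1 `|t - 2^-1|.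
    by rewrite (nphi t ht) mulr0 mulr0 add0r mulr_ge0 ?box_ind_ge0// invr_ge0.
  rewrite box_ind_in// mulr1; have := sqr_ge0 (phi t - 4^-1); rewrite expr2; lra.
by move: h; rewrite Iphi I1_box_ind//; lra.
Qed.

(** The fooling function divided by the bound for its norm is admissible, and its error is its
    integral, of order (l + 1)^(1-1/theta) 2^(-sl) with 2^l comparable to N. Only the number of
    points matters. *)
Lemma lower_half (L : nat) (Psi0 : R -> R) (s : R) (p theta : \bar R) :
  up_function Psi0 -> (1 <= p)%E -> (1 <= theta)%E -> (p^-1 < s%:E)%E -> s < L.+1%:R ->
  exists2 c : R, 0 < c & forall N (X : 'I_N -> plane), (2 <= N)%N ->
  ((c * (log2 N%:R `^ (1 - fine (theta^-1)%E) / N%:R `^ s))%:E <= wce L Psi0 s p theta X)%E.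
Proof.
move=> up p1 t1 ps sL; have [t0 o0 i0] := up_function_facts up.
have s0 : 0 < s by apply: le_lt_trans (fine_inv_lt p1 ps); case/andP: (fine_inv_bounds p1).
have [tau0 tau1] := andP (fine_inv_bounds t1); set tau := fine _ in tau0 tau1 *.
have [beta [tb nb] ib] := squared_bump t0 o0 i0.
have [C C0 hC] := conv_cells_decay L t0 tb nb.
have [A A0 hA] := besov_le_levels s0 sL.
(* 16 comes from passing from sup to L_p, C^2 from the two one-dimensional convolutions, A from the
   weighted sum. *)
pose k := I1 beta; pose c := 16 * C ^+ 2 * A.
have c0 : 0 < c by rewrite !mulr_gt0// exprn_gt0.
have p4 : 0 < 4 `^ s :> R by rewrite powR_gt0.
exists ((2^-1 * k ^+ 2) / (c * 4 `^ s)).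
  by rewrite divr_gt0 ?mulr_gt0 ?invr_gt0 ?exprn_gt0.
move=> N X N2; have N0 : (0 < N)%N by apply: leq_trans N2.
(* The lower bound on 2^l keeps half of the boxes empty; the upper bound keeps 2^(sl) within 4^s
   N^s. *)
have [l /andP[l1 l2]] : exists l : nat, (2 * N <= 2 ^ l < 4 * N)%N.
  have := @up_log_bounds 2 (2 * N) isT _; rewrite (leq_trans _ (leq_mul (leqnn 2) N0))// =>
    /(_ isT) /andP[h1 h2].
  exists (up_log 2 (2 * N)); rewrite h2 /=.
  have : (0 < up_log 2 (2 * N))%N by rewrite up_log_gt0 ?(leq_trans _ (leq_mul (leqnn 2) N0)).
  by move: h1; case: (up_log _ _) => [//|j] /=; rewrite expnS; lia.
pose D := 2 `^ (s * l%:R) * l.+1%:R `^ tau.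
have D0 : 0 < D by rewrite mulr_gt0 ?powR_gt0.
pose u : R := (c * D)^-1; have u0 : 0 < u by rewrite invr_gt0 mulr_gt0.
pose F x := u * fooling beta l X x.
have mf := fooling_mc2 l X tb.
have cF : continuous F by move=> x; apply: cvgM; [exact: cvg_cst|exact: fooling_continuous].
have sF : square_supp F by move=> z hz; rewrite /F fooling_supp ?mulr0.
have FX n : F (X n) = 0 by rewrite /F fooling_vanish mulr0.
pose W (m : nat * nat) : R := \sum_(a < l.+1) 2 ^- (L.+1 * (m.1 - a)) * 2 ^-
  (L.+1 * (m.2 - (l - a))).
have W0 m : 0 <= W m by apply: sumr_ge0 => a _; rewrite mulr_ge0 ?invr_ge0 ?exprn_ge0.
have blk m x : `|conv2 (ker (Psi L Psi0) m) F x| <= u * (C ^+ 2 * W m).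
  have -> : conv2 (ker (Psi L Psi0) m) F x = u * conv2 (ker (Psi L Psi0) m) (fooling beta l X) x.
    rewrite /conv2 -(I2Z u (conv2_int x (mc2_Psi L t0 m) mf)); apply: I2_ext => y; exact: mulrCA.
  rewrite normrM gtr0_norm// ler_wpM2l ?(ltW u0)//.
  exact: (conv2_fooling l X tb m x (test1_Psi L t0) hC).
have M0 m : 0 <= u * (C ^+ 2 * W m) by rewrite mulr_ge0 ?(ltW u0)// mulr_ge0 ?sqr_ge0 ?W0.
have nF : (besov_norm L Psi0 s p theta (rdist F) <= 1)%E.
  apply: (besov_norm_le1 t1 _ _ (hA l theta t1)) => m.
    apply: mulr_ge0; [by rewrite invr_ge0 -mulrA mulr_ge0 ?(ltW A0) ?(ltW D0)|exact: W0].
  apply: le_trans (rdist_block cF sF t0 o0 p1 (M0 m) (blk m)) _.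
  rewrite lee_fin -/tau -/(W m) le_eqVlt; apply/orP; left; apply/eqP; rewrite /u /c /D.
  by field; rewrite !gt_eqF ?powR_gt0.
apply: le_trans (rdist_wce cF sF nF FX); rewrite lee_fin /F I2Z//.
apply: le_trans (ler_wpM2l (ltW u0) (fooling_integral X tb nb l1)).
have N0R : 0 < N%:R :> R by rewrite ltr0n.
have lg : log2 N%:R <= l.+1%:R :> R.
  rewrite /log2 ler_pdivrMr ?ln_gt0 ?ltr1n// mulr_natl -lnXn//.
  rewrite ler_ln ?posrE ?exprn_gt0// -natrX ler_nat expnS.
  by apply: leq_trans (leq_trans l1 _); [rewrite leq_pmull|rewrite leq_pmull].
have e1 : log2 N%:R `^ (1 - tau) <= l.+1%:R / l.+1%:R `^ tau :> R.
  have -> : l.+1%:R / l.+1%:R `^ tau = l.+1%:R `^ (1 - tau) :> R.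
    by rewrite powRB ?powRr1//; apply/implyP => _; rewrite pnatr_eq0.
  apply: ge0_ler_powR; rewrite ?nnegrE ?subr_ge0//.
  by apply: le_trans (log2_ge1 N2).
have e2 : 2 `^ (s * l%:R) <= 4 `^ s * N%:R `^ s :> R.
  rewrite mulrC powRrM powR_mulrn// -powRM//; apply: ge0_ler_powR;
    rewrite ?nnegrE ?(ltW s0) ?exprn_ge0//.
  by rewrite -natrX -natrM ler_nat ltnW.
have pN : 0 < N%:R `^ s :> R by rewrite powR_gt0.
have pt : 0 < l.+1%:R `^ tau :> R by rewrite powR_gt0.
have p2 : 0 < 2 `^ (s * l%:R) :> R by rewrite powR_gt0.
have -> : u * (l.+1%:R * (2^-1 * I1 beta ^+ 2)) = (2^-1 * k ^+ 2) / c * (l.+1%:R / l.+1%:R `^ tau)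
  / 2 `^ (s * l%:R).
  by rewrite /u /D -/k; field; rewrite !gt_eqF.
have -> : (2^-1 * k ^+ 2) / (c * 4 `^ s) * (log2 N%:R `^ (1 - tau) / N%:R `^ s) =
          (2^-1 * k ^+ 2) / c * log2 N%:R `^ (1 - tau) / (4 `^ s * N%:R `^ s).
  by field; rewrite !gt_eqF.
have kc : 0 <= (2^-1 * k ^+ 2) / c by rewrite divr_ge0 ?(ltW c0)// mulr_ge0 ?sqr_ge0 ?invr_ge0.
apply: ler_pM.
- by rewrite mulr_ge0 ?kc ?powR_ge0.
- by rewrite invr_ge0 mulr_ge0 ?powR_ge0.
- by rewrite ler_wpM2l.
- by rewrite lef_pV2 ?posrE ?mulr_gt0.
Qed.

End main.

Theorem theorem23 (R : realType) (p theta : \bar R) (s C : R) (L : nat)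
    (Psi0 : R -> R) :
  (1 <= p)%E -> (1 <= theta)%E -> (p^-1 < s%:E)%E -> 0 < C ->
  s < L.+1%:R -> up_function Psi0 ->
  exists c1 c2 : R, [/\ 0 < c1, c1 <= c2 &
    forall N g : nat, (0 < g < N)%N -> coprime g N ->
      (max_quotient g N)%:R <= C ->
      let rate := log2 (N%:R) `^ (1 - fine (theta^-1)%E) / N%:R `^ s in
      ((c1 * rate)%:E <= wce L Psi0 s p theta (@lattice_points R N g))%E /\
      (wce L Psi0 s p theta (@lattice_points R N g) <= (c2 * rate)%:E)%E].
Proof.
(* The real bound C is rounded up to a natural number, as the Euclidean algorithm compares quotients
   with an integer. *)
move=> p1 t1 ps C0 sL up; have [K hK] := nat_bound C.
have [c1 c10 lower] := lower_half up p1 t1 ps sL.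
have [c2 c20 upper] := upper_half L K up p1 t1 ps.
exists c1, (c1 + c2); split => //; first by rewrite lerDl ltW.
move=> N g gN cop gC rate.
have N2 : (2 <= N)%N by case/andP: gN => g0 gN; exact: leq_trans gN.
have gK : (max_quotient g N <= K)%N by rewrite -(ler_nat R); exact: le_trans gC hK.
split; first exact: lower.
apply: le_trans (upper N g gN cop gK) _.
by rewrite lee_fin ler_wpM2r ?lerDr ?(ltW c10)// divr_ge0 ?powR_ge0.
Qed.
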